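(* Let $k$ be a field of characteristic $p>0$ with $[k:k^p]<\infty$, let $B$ be a graded polynomial ring over $k$ in finitely many variables whose degrees are positive integers (not necessarily equal), and let $G$ be a finite group acting faithfully on $B$ by graded $k$-algebra automorphisms. Let $F$ be a $\mathbb{Q}$-graded $B*G$-module that is free of (finite) rank $f$ as a $B$-module. Then the Frobenius limit of $F$ exists and $$\mathrm{FL}(F)=\frac{f}{|G|}\,[B*G]\quad\text{in } \Theta^\circ(B*G).$$ Analogously, with $\hat{\ }$ denoting completion at the irrelevant ideal, $$\mathrm{FL}(\hat F)=\frac{f}{|G|}\,[\hat B*G]\quad\text{in } \Theta^\wedge(\hat B*G).$$
   Context: Modules are left modules; graded rings are graded by non-negative integers, modules are $\mathbb{Q}$-graded, and morphisms preserve degree. $M[\lambda]$ is the shift of degree, $M[\lambda]_\mu=M_{\lambda+\mu}$. Twisted group algebra: if $G$ acts on a commutative ring $R$, then $R*G=\bigoplus_{g\in G}Rg$ with product $(rg)(r'g')=(r\,g(r'))(gg')$. An $R*G$-module is the same as an $R$-module with compatible $G$-action, $g(rm)=(gr)(gm)$. Let $A=B^G$. $\hat{\ }$ denotes completion at the irrelevant maximal ideal $\mathfrak m_B$ of $B$ (equivalently at $\mathfrak m_A$, the irrelevant maximal ideal of $A$); $\hat F=\hat B\otimes_BF$. The groups $\Theta$: Let $S=\bigoplus_{n\ge0}S_n$ be a graded algebra that is module-finite over a commutative Noetherian graded ring $T=\bigoplus_{n\ge 0}T_n$ (acting centrally) with $T_0$ a finite direct product of Henselian local rings. $\Theta^*(S)$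 is the $\mathbb{R}$-vector space generated by classes $[M]$ of finitely generated $\mathbb{Q}$-graded $S$-modules with relations $[M]=[M_1]+[M_2]$ whenever $M\cong M_1\oplus M_2$. $\Theta^\circ(S)$ is the quotient of $\Theta^*(S)$ by the relations $[M]=[M[\lambda]]$, $\lambda\in\mathbb{Q}$. By the Krull–Schmidt property, the classes of indecomposable finitely generated $\mathbb{Q}$-graded modules modulo shift form a basis of $\Theta^\circ(S)$. For $\alpha=\sum_M c_M[M]$ (sum over this basis) put $\|\alpha\|_S=\sum_M|c_M|\,\ell_S(M/\mathfrak m_SM)$, where $\mathfrak m_S=S_++J(S_0)$, $S_+=\bigoplus_{n>0}S_n$, $J$ is the Jacobson radical and $\ell_S$ is length. This is a norm, and limits are taken with respect to it. $\Theta^\wedge(S)$ is defined in the same way using finitely generated ungraded modules; if $S$ is concentrated in degree $0$ it equals $\Theta^\circ(S)$ and carries the norm above (with $\mathfrak m_S=J(S)$). Frobenius limits: for an $R*G$-module $M$ ($R=B$ or $\hat B$) and $e\ge0$, the $e$th Frobenius direct image ${}^eM$ is the additive group $M$ (elements written ${}^em$) with $r\cdot{}^em={}^e(r^{p^e}m)$ for $r\in R$ and $g\cdot{}^em={}^e(gm)$ for $g\in G$; if $m$ is homogeneous of degree $\lambda$ then ${}^em$ has degree $\lambda/p^e$. Let $d=\dim B$, $\mathfrak d=\log_p[k:k^p]$, $\delta=d+\mathfrak d$. Then $\mathrm{FL}(M)=\lim_{e\to\infty}p^{-\delta e}[{}^eM]$, provided the limit exists. *)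

(* Defs.v *)
From HB Require Import structures.
From mathcomp Require Import all_boot all_order all_fingroup all_algebra.
From mathcomp Require Import mpoly.
From mathcomp Require Import boolp classical_sets functions reals exp.

Set Implicit Arguments.
Unset Strict Implicit.
Unset Printing Implicit Defensive.

Import Order.TTheory GRing.Theory Num.Theory.

Local Open Scope ring_scope.

Inductive add_span (V : zmodType) (X : set V) : set V :=
| add_span_gen x : X x -> add_span X x
| add_span0 : add_span X 0
| add_spanB x y : add_span X x -> add_span X y -> add_span X (x - y).

Definition is_add_subgroup (V : zmodType) (H : set V) : Prop :=
  H 0 /\ forall x y, H x -> H y -> H (x - y).

Definition is_submodule (S : nzRingType) (M : lmodType S) (N : set M) : Prop :=
  is_add_subgroup N /\ forall (s : S) x, N x -> N (s *: x).

Definition finitely_generated (S : nzRingType) (M : lmodType S) : Prop :=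
  exists (r : nat) (v : 'I_r -> M), forall x : M,
    exists c : 'I_r -> S, x = \sum_(i < r) c i *: v i.

Definition free_of_rank (S : nzRingType) (M : lmodType S) (r : nat) : Prop :=
  exists v : 'I_r -> M, forall x : M,
    exists! c : {ffun 'I_r -> S}, x = \sum_(i < r) c i *: v i.

(* Chains N <= C_0 < C_1 < ... < C_l of submodules of M; these are the
   chains of length l of submodules of M / N. *)
Definition submodule_chain (S : nzRingType) (M : lmodType S) (N : set M)
    (l : nat) (C : nat -> set M) : Prop :=
  [/\ (N `<=` C 0%N)%classic,
      forall i, (i <= l)%N -> is_submodule (C i) &
      forall i, (i < l)%N ->
        (C i `<=` C i.+1)%classic /\ ~ (C i.+1 `<=` C i)%classic].

(* The length of M / N, as the supremum of the lengths of its chains. *)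
Definition quotient_length (S : nzRingType) (M : lmodType S) (N : set M)
    (l : nat) : Prop :=
  (exists C, submodule_chain N l C) /\
  (forall l' C, submodule_chain N l' C -> (l' <= l)%N).

Definition ideal_mul (S : nzRingType) (M : lmodType S) (I : set S) : set M :=
  add_span [set y | exists s x, I s /\ y = s *: x]%classic.

(* Left ideals and Jacobson radical of a subring A of S. *)
Definition is_left_ideal (S : nzRingType) (A I : set S) : Prop :=
  [/\ (I `<=` A)%classic, is_add_subgroup I &
      forall a x, A a -> I x -> I (a * x)].

Definition is_maximal_left_ideal (S : nzRingType) (A I : set S) : Prop :=
  [/\ is_left_ideal A I, ~ I 1 &
      forall J, is_left_ideal A J -> (I `<=` J)%classic -> ~ J 1 ->
        (J `<=` I)%classic].

Definition jacobson (S : nzRingType) (A : set S) : set S :=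
  [set x | A x /\ forall I, is_maximal_left_ideal A I -> I x]%classic.

Definition restrict_scalars (S' S : nzRingType) (phi : {rmorphism S' -> S})
  (M : lmodType S) : Type := M.

Section Restriction.
Variables (S' S : nzRingType) (phi : {rmorphism S' -> S}) (M : lmodType S).

HB.instance Definition _ := GRing.Zmodule.on (restrict_scalars phi M).

Definition restrict_scale (s : S') (x : restrict_scalars phi M) :
    restrict_scalars phi M :=
  phi s *: (x : M).

Fact restrict_scalerA s t x :
  restrict_scale s (restrict_scale t x) = restrict_scale (s * t) x.
Proof. by rewrite /restrict_scale rmorphM scalerA. Qed.

Fact restrict_scale1r : left_id 1 restrict_scale.
Proof. by move=> x; rewrite /restrict_scale rmorph1 scale1r. Qed.

Fact restrict_scalerDr : right_distributive restrict_scale +%R.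
Proof. by move=> s x y; rewrite /restrict_scale scalerDr. Qed.

Fact restrict_scalerDl x : {morph restrict_scale^~ x : s t / s + t}.
Proof. by move=> s t; rewrite /restrict_scale rmorphD scalerDl. Qed.

HB.instance Definition _ :=
  GRing.Zmodule_isLmodule.Build S' (restrict_scalars phi M) restrict_scalerA
    restrict_scale1r restrict_scalerDr restrict_scalerDl.

End Restriction.

Definition semilinear (A A' : nzRingType) (iota : A -> A') (M : lmodType A)
    (M' : lmodType A') (h : M -> M') : Prop :=
  (forall x y, h (x + y) = h x + h y) /\
  (forall a x, h (a *: x) = iota a *: h x).

(* M' is the extension of scalars A' (x)_A M along iota, and j the canonical
   map x |-> 1 (x) x (universal property of the tensor product). *)
Definition is_base_change (A A' : comNzRingType) (iota : A -> A')
    (M : lmodType A) (M' : lmodType A') (j : M -> M') : Prop :=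
  semilinear iota j /\
  forall (N : lmodType A') (h : M -> N), semilinear iota h ->
    exists h' : {linear M' -> N}, (forall x, h' (j x) = h x) /\
      forall h'' : {linear M' -> N}, (forall x, h'' (j x) = h x) -> h'' =1 h'.

(* V is the direct sum of the subgroups c i. *)
Record is_grading (I : eqType) (V : zmodType) (c : I -> set V) : Prop :=
  IsGrading {
    grading_subgroup : forall i, is_add_subgroup (c i);
    grading_span : forall v, exists (s : seq I) (x : I -> V),
      [/\ uniq s, forall i, c i (x i) & v = \sum_(i <- s) x i];
    grading_indep : forall (s : seq I) (x : I -> V),
      uniq s -> (forall i, c i (x i)) -> \sum_(i <- s) x i = 0 ->
      forall i, i \in s -> x i = 0 }.

Record ring_grading (S : nzRingType) := RingGrading {
  rcomp :> nat -> set S;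
  rcomp_grading : is_grading rcomp;
  rcomp1 : rcomp 0%N 1;
  rcompM : forall m n s t, rcomp m s -> rcomp n t -> rcomp (m + n)%N (s * t) }.

Record graded_module (S : nzRingType) (gr : ring_grading S) := GradedModule {
  gcarrier :> lmodType S;
  gcomp : rat -> set gcarrier;
  gcomp_grading : is_grading gcomp;
  gcompZ : forall n lam s x,
    gr n s -> gcomp lam x -> gcomp (n%:R + lam) (s *: x) }.

Lemma regrade (I J : eqType) (V : zmodType) (c : I -> set V) (f : J -> I)
    (f' : I -> J) : cancel f f' -> cancel f' f ->
  is_grading c -> is_grading (fun j => c (f j)).
Proof.
move=> fK f'K [csub cspan cind]; split=> [j|v|s x us cx sx0 j js].
- exact: csub.
- have [s [x [us cx ->]]] := cspan v.
  exists (map f' s), (fun j => x (f j)); split=> //.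
  + by rewrite map_inj_uniq //; exact: can_inj f'K.
  + by rewrite big_map; apply: eq_bigr => i _; rewrite f'K.
- rewrite -(fK j); apply: (cind (map f s) (fun i => x (f' i))).
  + by rewrite map_inj_uniq //; exact: can_inj fK.
  + by move=> i; rewrite -{1}(f'K i).
  + by rewrite big_map -{}[RHS]sx0; apply: eq_bigr => i _; rewrite fK.
  + exact: map_f.
Qed.

Section Shift.
Variables (S : nzRingType) (gr : ring_grading S) (M : graded_module gr).
Variable lam : rat.

Lemma gshift_grading : is_grading (fun mu => @gcomp S gr M (lam + mu)).
Proof.
apply: (@regrade _ _ _ (@gcomp S gr M) _ (fun mu => mu - lam)).
- by move=> mu; rewrite addrC addKr.
- by move=> mu; rewrite addrC subrK.
- exact: gcomp_grading.
Qed.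

Lemma gshiftZ n mu s x : gr n s -> @gcomp S gr M (lam + mu) x ->
  @gcomp S gr M (lam + (n%:R + mu)) (s *: x).
Proof. by rewrite addrCA; exact: gcompZ. Qed.

(* M[lam], with M[lam]_mu = M_(lam + mu). *)
Definition gshift : graded_module gr :=
  GradedModule gshift_grading gshiftZ.

End Shift.

(* S as a Q-graded module over itself. *)
Section Regular.
Variables (S : nzRingType) (gr : ring_grading S).

Definition regular_comp (lam : rat) : set S^o :=
  [set s | s = 0 \/ exists2 n : nat, lam = n%:R & gr n s]%classic.

Definition nat_of_rat (lam : rat) : nat := `|numq lam|%N.

Fact nat_of_ratK (n : nat) : nat_of_rat n%:R = n.
Proof. by rewrite /nat_of_rat -[n%:R]/(n%:Q) numq_int. Qed.

Lemma regular_grading : is_grading regular_comp.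
Proof.
have [csub cspan cind] := rcomp_grading gr.
split=> [lam|v|s x us cx sx0 lam lams].
- split; first by left.
  move=> x y [->|[n ln cx]] [->|[m lm cy]].
  + by left; rewrite subr0.
  + right; exists m => //; apply: (csub m).2 => //; exact: (csub m).1.
  + by right; exists n => //; rewrite subr0.
  + right; exists n => //; apply: (csub n).2 => //.
    have -> // : n = m by rewrite -(nat_of_ratK n) -(nat_of_ratK m) -ln -lm.
- have [s [x [us cx ->]]] := cspan v.
  exists (map (fun n : nat => n%:R) s).
  exists (fun lam => if (nat_of_rat lam)%:R == lam then x (nat_of_rat lam)
                     else 0); split.
  + by rewrite map_inj_uniq //; exact: can_inj nat_of_ratK.
  + move=> lam; case: eqP => [e|_]; last by left.
    by right; exists (nat_of_rat lam).
  + by rewrite big_map; apply: eq_bigr => n _; rewrite nat_of_ratK eqxx.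
- have [e|ne] := eqVneq ((nat_of_rat lam)%:R : rat) lam; last first.
    by have [//|[n e _]] := cx lam; rewrite e nat_of_ratK eqxx in ne.
  pose P := [pred mu : rat | (nat_of_rat mu)%:R == mu].
  have {}sx0 : \sum_(mu <- filter P s) x mu = 0.
    rewrite -{}[RHS]sx0 big_filter big_mkcond /=; apply: eq_bigr => mu _.
    case: ifP => // ne; have [//|[n e' _]] := cx mu.
    by rewrite e' nat_of_ratK eqxx in ne.
  rewrite -e; apply: (cind (map nat_of_rat (filter P s))
                           (fun n : nat => x n%:R)).
  + rewrite map_inj_in_uniq ?filter_uniq // => a b.
    by rewrite !mem_filter => /andP[/eqP ea _] /andP[/eqP eb _] eab;
       rewrite -ea -eb eab.
  + move=> n; have [->|[m enm]] := cx n%:R; first exact: (csub n).1.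
    by have -> : n = m by rewrite -(nat_of_ratK n) -(nat_of_ratK m) enm.
  + rewrite big_map big_filter -[RHS]sx0 big_filter.
    by apply: eq_bigr => mu /eqP ->.
  + by apply: map_f; rewrite mem_filter inE e eqxx.
Qed.

Lemma regular_compZ n lam (s : S) (x : S^o) :
  gr n s -> regular_comp lam x -> regular_comp (n%:R + lam) (s *: x).
Proof.
move=> gs [->|[m -> gx]]; first by left; rewrite scaler0.
by right; exists (n + m)%N; rewrite ?natrD //; exact: rcompM.
Qed.

Definition regular_module : graded_module gr :=
  @GradedModule S gr S^o regular_comp regular_grading regular_compZ.

Lemma regular_finitely_generated : finitely_generated (S^o : lmodType S).
Proof.
exists 1%N, (fun _ => 1) => x; exists (fun _ => x).
by rewrite big_ord1 [RHS]mulr1.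
Qed.

End Regular.

(* A class of modules with the data from which a group Theta and its norm
   are built: classes_eq M N means that [M] = [N] is imposed (isomorphism,
   possibly up to shift), is_sum M M1 M2 that M is isomorphic to M1 (+) M2,
   and top_length M l that l is the length of M / m_S M. *)
Record theta_data := ThetaData {
  tobj : Type;
  classes_eq : tobj -> tobj -> Prop;
  is_sum : tobj -> tobj -> tobj -> Prop;
  is_zero : tobj -> Prop;
  top_length : tobj -> nat -> Prop }.

Section Theta.
Variables (R : realType) (D : theta_data).

(* Formal real linear combinations of objects; Theta is their quotient by
   theta_eq, the least congruence containing the vector space axioms and the
   defining relations. *)
Definition formal_sum := seq (R * tobj D).

Inductive theta_eq : formal_sum -> formal_sum -> Prop :=
| theta_refl a : theta_eq a a
| theta_sym a b : theta_eq a b -> theta_eq b a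
| theta_trans a b c : theta_eq a b -> theta_eq b c -> theta_eq a c
| theta_add a a' b b' :
    theta_eq a a' -> theta_eq b b' -> theta_eq (a ++ b) (a' ++ b')
| theta_comm a b : theta_eq (a ++ b) (b ++ a)
| theta_scale0 M : theta_eq [:: (0, M)] [::]
| theta_scaleD c d M : theta_eq [:: (c + d, M)] [:: (c, M); (d, M)]
| theta_classes c M N : classes_eq M N -> theta_eq [:: (c, M)] [:: (c, N)]
| theta_sum c M M1 M2 :
    is_sum M M1 M2 -> theta_eq [:: (c, M)] [:: (c, M1); (c, M2)].

Definition theta_scale (c : R) (a : formal_sum) : formal_sum :=
  [seq (c * x.1, x.2) | x <- a].

Definition theta_sub (a b : formal_sum) : formal_sum :=
  a ++ theta_scale (-1) b.

Definition indecomposable (M : tobj D) : Prop :=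
  ~ is_zero M /\
  forall M1 M2, is_sum M M1 M2 -> is_zero M1 \/ is_zero M2.

(* x is the norm of the class of a: the class is expanded in the basis of
   classes of indecomposable objects, in which the expansion (hence x) is
   unique by the Krull-Schmidt property. *)
Definition is_theta_norm (a : formal_sum) (x : R) : Prop :=
  exists (r : nat) (c : 'I_r -> R) (M : 'I_r -> tobj D) (l : 'I_r -> nat),
    [/\ forall i, indecomposable (M i),
        forall i j, i != j -> ~ classes_eq (M i) (M j),
        theta_eq a [seq (c i, M i) | i <- enum 'I_r],
        forall i, top_length (M i) (l i) &
        x = \sum_(i < r) `|c i| * (l i)%:R].

Definition theta_limit (u : nat -> formal_sum) (a : formal_sum) : Prop :=
  forall eps : R, 0 < eps -> exists N : nat, forall e : nat, (N <= e)%N ->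
    exists x : R, is_theta_norm (theta_sub (u e) a) x /\ x < eps.

End Theta.

(* Theta^circ of a graded ring: finitely generated Q-graded modules up to
   shift. *)
Section ThetaGraded.
Variables (S : nzRingType) (gr : ring_grading S).

Record fg_graded_module := FgGradedModule {
  fg_gmod :> graded_module gr;
  fg_gmodP : finitely_generated fg_gmod }.

Definition graded_iso (M N : graded_module gr) : Prop :=
  exists2 h : {linear M -> N}, bijective h &
    forall lam x, @gcomp _ _ M lam x <-> @gcomp _ _ N lam (h x).

Definition graded_iso_sum (M M1 M2 : graded_module gr) : Prop :=
  exists2 h : {linear M -> (M1 * M2)%type}, bijective h &
    forall lam x, @gcomp _ _ M lam x <->
      @gcomp _ _ M1 lam (h x).1 /\ @gcomp _ _ M2 lam (h x).2.

(* m_S = S_+ + J(S_0). *)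
Definition graded_radical : set S :=
  [set s | exists y z,
     [/\ add_span [set t | exists2 n, (0 < n)%N & gr n t]%classic y,
         jacobson (gr 0%N) z & s = y + z]]%classic.

Definition theta_circ : theta_data := {|
  tobj := fg_graded_module;
  classes_eq := fun M N => exists lam, graded_iso (gshift M lam) N;
  is_sum := fun M M1 M2 => graded_iso_sum M M1 M2;
  is_zero := fun M => forall x : M, x = 0;
  top_length := fun M l => quotient_length (@ideal_mul S M graded_radical) l |}.

Definition regular_circ : tobj theta_circ :=
  @FgGradedModule (regular_module gr) (regular_finitely_generated S).

End ThetaGraded.

(* Theta^wedge of a ring: finitely generated modules, with m_S = J(S). *)
Section ThetaUngraded.
Variable S : nzRingType.

Record fg_module := FgModule {
  fg_mod :> lmodType S;
  fg_modP : finitely_generated fg_mod }.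

Definition theta_wedge : theta_data := {|
  tobj := fg_module;
  classes_eq := fun M N => exists h : {linear M -> N}, bijective h;
  is_sum := fun M M1 M2 =>
    exists h : {linear M -> (M1 * M2)%type}, bijective h;
  is_zero := fun M => forall x : M, x = 0;
  top_length := fun M l =>
    quotient_length (@ideal_mul S M (jacobson [set: S]%classic)) l |}.

Definition regular_wedge : tobj theta_wedge :=
  @FgModule S^o (regular_finitely_generated S).

End ThetaUngraded.

Record ring_action (G : finGroupType) (R : nzRingType) := RingAction {
  ract :> G -> {rmorphism R -> R};
  ract1 : forall r, ract 1%g r = r;
  ractM : forall g h r, ract (g * h)%g r = ract g (ract h r) }.

(* R * G: the function s stands for the sum of the s(g) g. *)
Definition twisted (G : finGroupType) (R : nzRingType)
  (a : ring_action G R) : Type := {ffun G -> R}.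

Section Twisted.
Variables (G : finGroupType) (R : nzRingType) (a : ring_action G R).

HB.instance Definition _ := GRing.Zmodule.on (twisted a).

Implicit Types s t u : twisted a.

Definition tw_mono (r : R) (g : G) : twisted a :=
  [ffun x => if x == g then r else 0].

Definition tw_one : twisted a := tw_mono 1 1%g.

(* (r g) (r' g') = (r g(r')) (g g') *)
Definition tw_mul (s t : twisted a) : twisted a :=
  [ffun x => \sum_(g : G) s g * a g (t (g^-1 * x)%g)].

Fact tw_mulA : associative tw_mul.
Proof.
move=> s t u; apply/ffunP => x; rewrite !ffunE.
under eq_bigr => g _ do rewrite ffunE rmorph_sum mulr_sumr.
under [RHS]eq_bigr => g _ do rewrite ffunE mulr_suml.
rewrite [RHS]exchange_big; apply: eq_bigr => g _.
rewrite [RHS](reindex_inj (mulgI g)); apply: eq_bigr => h _.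
by rewrite rmorphM mulrA mulKg invMg -mulgA -ractM.
Qed.

Fact tw_mul1 : left_id tw_one tw_mul.
Proof.
move=> s; apply/ffunP => x; rewrite !ffunE (bigD1 1%g) //= !ffunE eqxx.
rewrite mul1r ract1 invg1 mul1g big1 ?addr0 // => g /negPf ng.
by rewrite !ffunE ng mul0r.
Qed.

Fact tw_mulr1 : right_id tw_one tw_mul.
Proof.
move=> s; apply/ffunP => x; rewrite !ffunE (bigD1 x) //= !ffunE mulVg eqxx.
rewrite rmorph1 mulr1 big1 ?addr0 // => g ng.
by rewrite ffunE -eq_mulVg1 (negPf ng) rmorph0 mulr0.
Qed.

Fact tw_mulDl : left_distributive tw_mul +%R.
Proof.
move=> s t u; apply/ffunP => x; rewrite !ffunE -big_split.
by apply: eq_bigr => g _; rewrite ffunE mulrDl.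
Qed.

Fact tw_mulDr : right_distributive tw_mul +%R.
Proof.
move=> s t u; apply/ffunP => x; rewrite !ffunE -big_split.
by apply: eq_bigr => g _; rewrite ffunE rmorphD mulrDr.
Qed.

Fact tw_one_neq0 : tw_one != 0.
Proof.
apply/eqP => /ffunP /(_ 1%g); rewrite !ffunE eqxx => /eqP.
by rewrite oner_eq0.
Qed.

HB.instance Definition _ := GRing.Zmodule_isNzRing.Build (twisted a)
  tw_mulA tw_mul1 tw_mulr1 tw_mulDl tw_mulDr tw_one_neq0.

Lemma tw_mulE s t x : (s * t) x = \sum_(g : G) s g * a g (t (g^-1 * x)%g).
Proof. by rewrite [LHS]ffunE. Qed.

Lemma tw_oneE x : (1 : twisted a) x = if x == 1%g then 1 else 0.
Proof. by rewrite [LHS]ffunE. Qed.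

(* R -> R * G, r |-> r 1. *)
Definition tw_const (r : R) : twisted a := tw_mono r 1%g.

Lemma tw_const_additive : zmod_morphism tw_const.
Proof.
by move=> r r'; apply/ffunP => x; rewrite !ffunE; case: eqP; rewrite ?subr0.
Qed.

Lemma tw_const_multiplicative : monoid_morphism tw_const.
Proof.
split=> // r r'; apply/ffunP => x; rewrite tw_mulE ffunE (bigD1 1%g) //=.
rewrite !ffunE eqxx ract1 invg1 mul1g big1 ?addr0; last first.
  by move=> g /negPf ng; rewrite ffunE ng mul0r.
by case: eqP; rewrite ?mulr0.
Qed.

HB.instance Definition _ :=
  GRing.isZmodMorphism.Build R (twisted a) tw_const tw_const_additive.
HB.instance Definition _ :=
  GRing.isMonoidMorphism.Build R (twisted a) tw_const tw_const_multiplicative.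

Definition underlying (M : lmodType (twisted a)) : lmodType R :=
  restrict_scalars tw_const M.

Definition gact (M : lmodType (twisted a)) (g : G) (x : M) : M :=
  tw_mono 1 g *: x.

(* If R is graded and G preserves degrees, G has degree 0 in R * G. *)
Section Grading.
Variable gr : ring_grading R.
Hypothesis gr_act : forall n g r, gr n r -> gr n (a g r).

Definition tw_comp (n : nat) : set (twisted a) :=
  [set s | forall g, gr n (s g)]%classic.

Lemma tw_comp_grading : is_grading tw_comp.
Proof.
have [csub cspan cind] := rcomp_grading gr.
split=> [n|s|I x uI cx sx0 n nI].
- split=> [g|s t cs ct g]; rewrite !ffunE; first exact: (csub n).1.
  exact: (csub n).2.
- have /choice [J Jp] : forall g, exists Jx : seq nat * (nat -> R),
    [/\ uniq Jx.1, forall i, gr i (Jx.2 i) & s g = \sum_(i <- Jx.1) Jx.2 i].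
    by move=> g; have [J [x H]] := cspan (s g); exists (J, x).
  pose K := undup (flatten [seq (J g).1 | g <- enum G]).
  exists K, (fun i => [ffun g => if i \in (J g).1 then (J g).2 i else 0]).
  split=> [|i g|]; first exact: undup_uniq.
    rewrite ffunE; case: ifP => _; last exact: (csub i).1.
    by case: (Jp g).
  apply/ffunP => g; rewrite sum_ffunE.
  under eq_bigr => i _ do rewrite ffunE.
  have [uJ _ ->] := Jp g; rewrite -big_mkcond -[RHS]big_filter.
  apply: perm_big; apply: uniq_perm => //.
    by rewrite filter_uniq ?undup_uniq.
  move=> i; rewrite mem_filter mem_undup.
  case: (boolP (i \in (J g).1)) => //= iJ; apply/esym/flattenP.
  by exists (J g).1 => //; apply/map_f; rewrite mem_enum.
- apply/ffunP => g; rewrite ffunE.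
  apply: (cind I (fun i => x i g)) => // [i|]; first exact: cx.
  by have /ffunP/(_ g) := sx0; rewrite sum_ffunE ffunE.
Qed.

Lemma tw_comp1 : tw_comp 0%N 1.
Proof.
have [csub _ _] := rcomp_grading gr.
move=> g; rewrite tw_oneE; case: ifP => _; first exact: rcomp1.
exact: (csub 0%N).1.
Qed.

Lemma tw_compM m n s t :
  tw_comp m s -> tw_comp n t -> tw_comp (m + n)%N (s * t).
Proof.
have [csub _ _] := rcomp_grading gr.
move=> cs ct g; rewrite tw_mulE; elim/big_ind: _ => [|x y cx cy|h _].
- exact: (csub _).1.
- rewrite -[y]opprK; apply: (csub _).2 => //; rewrite -[- y]sub0r.
  by apply: (csub _).2 => //; exact: (csub _).1.
- by apply: rcompM => //; exact: gr_act.
Qed.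

Definition tw_grading : ring_grading (twisted a) :=
  RingGrading tw_comp_grading tw_comp1 tw_compM.

End Grading.

End Twisted.

Section Frobenius.
Variables (G : finGroupType) (R : comNzRingType) (a : ring_action G R).
Variables (p : nat) (chRp : p \in [pchar R]) (e : nat).

(* The endomorphism sum r_g g |-> sum r_g^(p^e) g of R * G. *)
Definition tw_frobenius (s : twisted a) : twisted a :=
  [ffun g => s g ^+ (p ^ e)].

Fact frob_p_gt0 : (0 < p)%N.
Proof. exact: prime_gt0 (pcharf_prime chRp). Qed.

Fact frob_pcharX : [pchar R].-nat (p ^ e)%N.
Proof.
rewrite pnatX (eq_pnat _ (pcharf_eq chRp)) pnat_id ?orTb //.
exact: pcharf_prime chRp.
Qed.

Fact frob_B : {morph (fun r : R => r ^+ (p ^ e)) : x y / x - y}.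
Proof.
by move=> x y /=; rewrite exprDn_pchar ?exprNn_pchar ?frob_pcharX.
Qed.

Fact frob_0 : (0 : R) ^+ (p ^ e) = 0.
Proof. by rewrite expr0n expn_eq0 (gtn_eqF frob_p_gt0). Qed.

Lemma tw_frobenius_additive : zmod_morphism tw_frobenius.
Proof. by move=> s t; apply/ffunP => g; rewrite !ffunE; exact: frob_B. Qed.

Lemma tw_frobenius_multiplicative : monoid_morphism tw_frobenius.
Proof.
have frobD : {morph (fun r : R => r ^+ (p ^ e)) : x y / x + y}.
  by move=> x y /=; rewrite exprDn_pchar ?frob_pcharX.
split=> [|s t]; apply/ffunP => g.
  by rewrite ffunE !tw_oneE; case: ifP => _; rewrite ?expr1n ?frob_0.
rewrite ffunE !tw_mulE.
rewrite (big_morph (fun r : R => r ^+ (p ^ e)) frobD frob_0).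
by apply: eq_bigr => h _; rewrite !ffunE exprMn_comm ?rmorphXn //; exact: mulrC.
Qed.

HB.instance Definition _ := GRing.isZmodMorphism.Build (twisted a) (twisted a)
  tw_frobenius tw_frobenius_additive.
HB.instance Definition _ := GRing.isMonoidMorphism.Build (twisted a) (twisted a)
  tw_frobenius tw_frobenius_multiplicative.

(* The e-th Frobenius direct image of M: r . m = r^(p^e) m, g . m = g m. *)
Definition frob_image (M : lmodType (twisted a)) : lmodType (twisted a) :=
  restrict_scalars tw_frobenius M.

Section Graded.
Variables (gr : ring_grading R).
Hypothesis gr_act : forall n g r, gr n r -> gr n (a g r).
Variable M : graded_module (tw_grading gr_act).

(* Elements of degree lam in M have degree lam / p^e in the direct image. *)
Definition frob_comp (mu : rat) : set (frob_image M) :=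
  gcomp (p%:R ^+ e * mu).

Lemma frob_comp_grading : is_grading frob_comp.
Proof.
have pe0 : (p%:R ^+ e : rat) != 0.
  by rewrite expf_neq0 // pnatr_eq0 -lt0n frob_p_gt0.
apply: (@regrade _ _ _ (@gcomp _ _ M) _ (fun lam => lam / p%:R ^+ e)).
- by move=> mu; rewrite mulrC mulKf.
- by move=> mu; rewrite mulrC mulfVK.
- exact: gcomp_grading.
Qed.

Lemma frob_compZ n mu (s : twisted a) x : tw_grading gr_act n s ->
  frob_comp mu x -> frob_comp (n%:R + mu) (s *: x).
Proof.
move=> cs cx; rewrite /frob_comp mulrDr -natrX -natrM natrX.
apply: (gcompZ (s := tw_frobenius s)) cx => g; rewrite ffunE mulnC.
elim: (p ^ e)%N => [|m IHm]; first by rewrite muln0; exact: rcomp1.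
by rewrite mulnS exprS; exact: rcompM.
Qed.

Definition graded_frob_image : graded_module (tw_grading gr_act) :=
  GradedModule frob_comp_grading frob_compZ.

End Graded.

End Frobenius.

Section Completion.
Variables (A : comNzRingType) (I : idealr A).

Fixpoint ideal_pow (n : nat) : set A :=
  if n is n'.+1
  then add_span
    [set z | exists x y, [/\ x \in I, ideal_pow n' y & z = x * y]]%classic
  else [set: A]%classic.

Lemma ideal_pow_subgroup n : is_add_subgroup (ideal_pow n).
Proof.
by case: n => [|n]; split=> //; [exact: add_span0 | exact: add_spanB].
Qed.

Lemma ideal_powM n b x : ideal_pow n x -> ideal_pow n (b * x).
Proof.
elim: n b x => [|n IHn] b x //= ; elim=> [_ [y [z [yI zI ->]]]||y z _ Hy _ Hz].
- apply: add_span_gen; exists y, (b * z); split=> //; first exact: IHn.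
  by rewrite mulrCA.
- by rewrite mulr0; exact: add_span0.
- by rewrite mulrBr; exact: add_spanB.
Qed.

Lemma ideal_pow1 x : ideal_pow 1 x -> x \in I.
Proof.
elim=> [_ [y [z [yI _ ->]]]||y z _ Hy _ Hz]; last exact: rpredB.
- by rewrite mulrC idealMr.
- exact: rpred0.
Qed.

Lemma ideal_powD n x y : ideal_pow n x -> ideal_pow n y -> ideal_pow n (x + y).
Proof.
have [c0 cB] := ideal_pow_subgroup n.
move=> cx cy; rewrite -[y]opprK; apply: (cB) => //.
by rewrite -[- y]sub0r; exact: cB.
Qed.

(* The completion is the inverse limit of the A / I^n: sequences (x_n) with
   x_m = x_n mod I^n for n <= m, modulo the sequences with all x_n in I^n. *)
Definition coherent : {pred nat -> A} :=
  fun x => `[< forall n m, (n <= m)%N -> ideal_pow n (x m - x n) >].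

Lemma coherent_subring : subring_closed coherent.
Proof.
split.
- by apply/asboolP => n m _; rewrite subrr; exact: (ideal_pow_subgroup n).1.
- move=> x y /asboolP cx /asboolP cy; apply/asboolP => n m nm.
  have -> : (x - y) m - (x - y) n = (x m - x n) - (y m - y n).
    by rewrite !fctE !opprB [y n - x n]addrC addrACA [- y m + _]addrC.
  by apply: (ideal_pow_subgroup n).2; [exact: cx | exact: cy].
- move=> x y /asboolP cx /asboolP cy; apply/asboolP => n m nm.
  have -> : (x * y) m - (x * y) n = y m * (x m - x n) + x n * (y m - y n).
    by rewrite !fctE !mulrBr [y m * x n]mulrC [y m * _]mulrC addrA addrNK.
  by apply: ideal_powD; apply: ideal_powM; [exact: cx | exact: cy].
Qed.

HB.instance Definition _ :=
  GRing.isSubringClosed.Build (nat -> A) coherent coherent_subring.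

Record coherent_seq := CoherentSeq {
  coherent_val :> nat -> A;
  coherent_valP : coherent_val \in coherent }.

HB.instance Definition _ := [isSub for coherent_val].
HB.instance Definition _ := [Choice of coherent_seq by <:].
HB.instance Definition _ :=
  [SubChoice_isSubComNzRing of coherent_seq by <:].

Definition null : {pred coherent_seq} :=
  fun x => `[< forall n, ideal_pow n (coherent_val x n) >].

Lemma null_ideal : idealr_closed null.
Proof.
split.
- by apply/asboolP => n; exact: (ideal_pow_subgroup n).1.
- by apply/negP => /asboolP /(_ 1%N) /ideal_pow1; rewrite idealr1.
- move=> u x y /asboolP cx /asboolP cy; apply/asboolP => n.
  by apply: ideal_powD => //; exact: ideal_powM.
Qed.

HB.instance Definition _ := isIdealr.Build coherent_seq null null_ideal.

Definition completion : comNzRingType := {ideal_quot null}.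

Definition completion_pi (x : coherent_seq) : completion :=
  (\pi_({ideal_quot null}) x)%qT.

Fact completion_pi_additive : zmod_morphism completion_pi.
Proof. by move=> x y; rewrite /completion_pi pi_is_zmod_morphism. Qed.

Fact completion_pi_multiplicative : monoid_morphism completion_pi.
Proof. exact: pi_is_monoid_morphism. Qed.

HB.instance Definition _ := GRing.isZmodMorphism.Build coherent_seq completion
  completion_pi completion_pi_additive.
HB.instance Definition _ := GRing.isMonoidMorphism.Build coherent_seq completion
  completion_pi completion_pi_multiplicative.

Lemma completion_eqP (x y : coherent_seq) :
  completion_pi x = completion_pi y <-> forall n, ideal_pow n (x n - y n).
Proof.
have -> : (completion_pi x = completion_pi y) <-> (x - y \in null).
  by rewrite Quotient.idealrBE; split=> /eqP.
by split=> [/asboolP|H]; last exact/asboolP.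
Qed.

Lemma completion_piP (x : completion) : exists y, x = completion_pi y.
Proof.
exists (generic_quotient.repr (x : {ideal_quot null})).
by rewrite /completion_pi reprK.
Qed.

Lemma const_coherent (x : A) : (fun=> x) \in coherent.
Proof.
by apply/asboolP => n m _; rewrite subrr; exact: (ideal_pow_subgroup n).1.
Qed.

Definition to_completion (x : A) : completion :=
  completion_pi (CoherentSeq (const_coherent x)).

Fact to_completion_additive : zmod_morphism to_completion.
Proof.
move=> x y; rewrite /to_completion -rmorphB; congr completion_pi.
exact: val_inj.
Qed.

Fact to_completion_multiplicative : monoid_morphism to_completion.
Proof.
rewrite /to_completion; split=> [|x y].
  by rewrite -[RHS](rmorph1 completion_pi); congr completion_pi; exact: val_inj.
by rewrite -rmorphM; congr completion_pi; exact: val_inj.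
Qed.

HB.instance Definition _ := GRing.isZmodMorphism.Build A completion
  to_completion to_completion_additive.
HB.instance Definition _ := GRing.isMonoidMorphism.Build A completion
  to_completion to_completion_multiplicative.

Section Map.
Variables (f : {rmorphism A -> A}) (fI : forall x, x \in I -> f x \in I).

Lemma ideal_pow_map n x : ideal_pow n x -> ideal_pow n (f x).
Proof.
elim: n x => [|n IHn] x //=; elim=> [_ [y [z [yI zI ->]]]||y z _ Hy _ Hz].
- apply: add_span_gen; exists (f y), (f z).
  by split; [exact: fI | exact: IHn | rewrite rmorphM].
- by rewrite rmorph0; exact: add_span0.
- by rewrite rmorphB; exact: add_spanB.
Qed.

Lemma map_coherent (x : coherent_seq) : (fun n => f (x n)) \in coherent.
Proof.
have /asboolP cx := coherent_valP x.
by apply/asboolP => n m nm; rewrite -rmorphB; exact/ideal_pow_map/cx.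
Qed.

Definition coherent_map (x : coherent_seq) : coherent_seq :=
  CoherentSeq (map_coherent x).

Definition completion_map (x : completion) : completion :=
  completion_pi (coherent_map (generic_quotient.repr (x : {ideal_quot null}))).

Lemma completion_mapE x :
  completion_map (completion_pi x) = completion_pi (coherent_map x).
Proof.
apply/completion_eqP => n /=; rewrite -rmorphB; apply: ideal_pow_map.
by move: n; apply/completion_eqP; rewrite /completion_pi reprK.
Qed.

Fact completion_map_additive : zmod_morphism completion_map.
Proof.
move=> x y; have [x' ->] := completion_piP x; have [y' ->] := completion_piP y.
rewrite -rmorphB !completion_mapE -rmorphB; congr completion_pi.
by apply: val_inj; apply/funext => n; exact: rmorphB.
Qed.

Fact completion_map_multiplicative : monoid_morphism completion_map.
Proof.
split=> [|x y].
  rewrite -(rmorph1 completion_pi) completion_mapE; congr completion_pi.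
  by apply: val_inj; apply/funext => n; exact: rmorph1.
have [x' ->] := completion_piP x; have [y' ->] := completion_piP y.
rewrite -rmorphM !completion_mapE -rmorphM; congr completion_pi.
by apply: val_inj; apply/funext => n; exact: rmorphM.
Qed.

HB.instance Definition _ := GRing.isZmodMorphism.Build completion completion
  completion_map completion_map_additive.
HB.instance Definition _ := GRing.isMonoidMorphism.Build completion completion
  completion_map completion_map_multiplicative.

End Map.

Section Action.
Variables (G : finGroupType) (a : ring_action G A).
Hypothesis aI : forall g x, x \in I -> a g x \in I.

Definition completion_act (g : G) : {rmorphism completion -> completion} :=
  completion_map (aI g).

Fact completion_act1 x : completion_act 1%g x = x.
Proof.
have [y ->] := completion_piP x; rewrite /= completion_mapE.
by congr completion_pi; apply: val_inj; apply/funext => n /=; rewrite ract1.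
Qed.

Fact completion_actM g h x :
  completion_act (g * h)%g x = completion_act g (completion_act h x).
Proof.
have [y ->] := completion_piP x; rewrite /= !completion_mapE.
by congr completion_pi; apply: val_inj; apply/funext => n /=; rewrite ractM.
Qed.

Definition completion_action : ring_action G completion :=
  RingAction completion_act1 completion_actM.

End Action.

Lemma completion_pchar p : p \in [pchar A] -> p \in [pchar completion].
Proof. exact: (rmorph_pchar to_completion). Qed.

End Completion.

Section Weighted.
Variables (k : fieldType) (n : nat) (w : 'I_n -> nat).

Definition wdeg (m : 'X_{1..n}) : nat := (\sum_(i < n) m i * w i)%N.

Fact wdeg0 : wdeg 0%MM = 0%N.
Proof. by rewrite /wdeg big1 // => i _; rewrite mnm0E. Qed.

Fact wdegD : {morph wdeg : m1 m2 / (m1 + m2)%MM >-> (m1 + m2)%N}.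
Proof.
move=> m1 m2; rewrite /wdeg -big_split; apply: eq_bigr => i _.
by rewrite mnmDE mulnDl.
Qed.

HB.instance Definition _ := isMeasure.Build n wdeg wdeg0 wdegD.

Local Notation B := {mpoly k[n]}.

Definition wcomp (d : nat) : set B := [set b | b \is d.-homog for wdeg]%classic.

Lemma wcomp_grading : is_grading wcomp.
Proof.
split=> [d|b|s x us cx sx0 d ds].
- by split=> [|x y]; [exact: rpred0 | exact: rpredB].
- exists (iota 0 (mmeasure wdeg b)), (fun d => pihomog wdeg d b); split.
  + exact: iota_uniq.
  + by move=> d; exact: pihomogP.
  + rewrite {1}(pihomog_partitionE (leqnn (mmeasure wdeg b))).
    by rewrite -val_enum_ord big_map big_enum.
- have := congr1 (pihomog wdeg d) sx0; rewrite raddf0 raddf_sum.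
  rewrite (bigD1_seq d) //= pihomog_dE; last exact: cx.
  rewrite big1 ?addr0 // => i ni.
  by apply: (pihomog_ne0 _ (cx i)).
Qed.

Lemma wcomp1 : wcomp 0%N 1.
Proof. by apply: dhomog1. Qed.

Lemma wcompM d e x y : wcomp d x -> wcomp e y -> wcomp (d + e)%N (x * y).
Proof. by move=> cx cy; apply: dhomogM. Qed.

(* B = k[x_1, ..., x_n] with deg x_i = w i. *)
Definition wgrading : ring_grading B :=
  RingGrading wcomp_grading wcomp1 wcompM.

(* The irrelevant ideal B_+: polynomials all of whose monomials have
   positive degree. *)
Definition irrelevant : {pred B} :=
  fun b => all (fun m => (0 < wdeg m)%N) (msupp b).

Lemma irrelevant_ideal : idealr_closed irrelevant.
Proof.
split; first by apply/allP => m; rewrite msupp0.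
  by apply/negP => /allP/(_ 0%MM); rewrite msupp1 inE eqxx wdeg0 => /(_ isT).
move=> u x y /allP ix /allP iy; apply/allP => m /msuppD_le.
rewrite mem_cat => /orP[/msuppM_le/allpairsP[[m1 m2] [_ m2x ->]]|/iy //].
by rewrite /= wdegD addn_gt0 (ix m2 m2x) orbT.
Qed.

HB.instance Definition _ := isIdealr.Build B irrelevant irrelevant_ideal.

Record graded_action (G : finGroupType) := GradedAction {
  graded_ract :> ring_action G B;
  graded_ractZ : forall g (c : k) (b : B),
    graded_ract g (c *: b) = c *: graded_ract g b;
  graded_ract_homog : forall d g b,
    wgrading d b -> wgrading d (graded_ract g b) }.

Lemma graded_ract_irrelevant (G : finGroupType) (a : graded_action G) g b :
  b \in irrelevant -> a g b \in irrelevant.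
Proof.
move=> /allP ib; rewrite (pihomog_partitionE (leqnn (mmeasure wdeg b))).
rewrite rmorph_sum; apply: rpred_sum => -[[|d] _] _ /=.
  suff -> : pihomog wdeg 0 b = 0 by rewrite rmorph0 rpred0.
  rewrite pihomogE big_seq_cond big1 // => m /andP[/ib].
  by rewrite lt0n => /negPf ->.
have /dhomogP H := graded_ract_homog a g (pihomogP wdeg d.+1 b).
by apply/allP => m /H ->.
Qed.

End Weighted.

Arguments irrelevant k {n} w _.

Lemma mpoly_pchar (k : fieldType) (n p : nat) :
  p \in [pchar k] -> p \in [pchar {mpoly k[n]}].
Proof. exact: (rmorph_pchar (@mpolyC n k)). Qed.

Section WeightedTwisted.
Variables (k : fieldType) (n : nat) (w : 'I_n -> nat) (G : finGroupType).
Variable a : graded_action k w G.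

Definition tw_wgrading : ring_grading (twisted a) :=
  tw_grading (graded_ract_homog a).

Definition hat_ring : comNzRingType := completion (irrelevant k w).

Definition hat_action : ring_action G hat_ring :=
  completion_action (graded_ract_irrelevant a).

(* Fh is the module hat B (x)_B F with g (b (x) x) = g b (x) g x, and j is the
   canonical map x |-> 1 (x) x; this determines (Fh, j) up to unique
   isomorphism. *)
Definition is_completed_module (F : lmodType (twisted a))
    (Fh : lmodType (twisted hat_action)) (j : F -> Fh) : Prop :=
  @is_base_change {mpoly k[n]} hat_ring (to_completion (irrelevant k w))
    (underlying F) (underlying Fh) j /\
  forall g x, j (gact g x) = gact g (j x).

End WeightedTwisted.

(* [k : k^p] = q *)
Definition pth_power_degree (k : fieldType) (p q : nat) : Prop :=
  exists b : 'I_q -> k, forall x : k, exists! c : {ffun 'I_q -> k},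
    (forall i, exists y, c i = y ^+ p) /\ x = \sum_(i < q) c i * b i.

(* delta = d + log_p q *)
Definition frob_delta (R : realType) (d p q : nat) : R :=
  d%:R + ln (q%:R : R) / ln (p%:R : R).

(* FL M = alpha; the existence of fgM is part of the claim that the limit
   exists, the classes of the direct images being in Theta. *)
Definition is_graded_FL (R : realType) (G : finGroupType) (A : comNzRingType)
    (a : ring_action G A) (gr : ring_grading A)
    (gr_act : forall n g r, gr n r -> gr n (a g r))
    (p : nat) (chA : p \in [pchar A]) (delta : R)
    (M : graded_module (tw_grading gr_act))
    (alpha : formal_sum R (theta_circ (tw_grading gr_act))) : Prop :=
  exists fgM : forall e, finitely_generated (graded_frob_image chA e M),
    theta_limit (D := theta_circ _) (fun e : nat =>
      [:: (powR p%:R (- (delta * e%:R)), FgGradedModule (fgM e))]) alpha.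

Definition is_FL (R : realType) (G : finGroupType) (A : comNzRingType)
    (a : ring_action G A) (p : nat) (chA : p \in [pchar A]) (delta : R)
    (M : lmodType (twisted a))
    (alpha : formal_sum R (theta_wedge (twisted a))) : Prop :=
  exists fgM : forall e, finitely_generated (frob_image chA e M),
    theta_limit (D := theta_wedge _) (fun e : nat =>
      [:: (powR p%:R (- (delta * e%:R)), FgModule (fgM e))]) alpha.

(* Main.v *)
(* Let P = p^n [k : k^p] = p^delta, so that ^eF is free over B of rank f P^e.
   The automorphisms of a faithful group are linearly independent over the
   fraction field (Dedekind), so there are monomials X^{m_1}, ..., X^{m_t} with
   t = |G| for which Delta = det (g_i X^{m_j}) is not zero.  For z in a basis of
   ^eF consider the vector (X^{m_1} z, ..., X^{m_t} z) of (^eF)^t.  By Cramer's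
   rule the G-translates of these vectors span Delta (^eF)^t over B.  Hence,
   modulo the irrelevant ideal, they miss at most those standard basis vectors
   of (^eF)^t whose monomial is not divisible by the leading monomial of Delta,
   and these form a fraction O(p^{-e}) of the basis.  So all but O(P^e / p^e) of
   the G-orbits form part of a B-basis and span a free B * G-module, which is a
   direct summand because B * G is coinduced from B.  The complement needs
   O(P^e / p^e) generators over B, which bounds its norm.  Counting ranks and
   dividing by t P^e gives the limit.  After completion the same bases remain
   bases. *)
Require Import Defs.
From HB Require Import structures.
From mathcomp Require Import all_boot all_order all_fingroup all_algebra.
From mathcomp Require Import mpoly.
From Stdlib Require List Permutation.
From mathcomp Require Import boolp classical_sets functions reals exp.
From mathcomp Require Import ring.
(* Again, because mathcomp shadows semilinear and gact. *)
Import Defs.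

Set Implicit Arguments.
Unset Strict Implicit.
Unset Printing Implicit Defensive.
Import Order.TTheory GRing.Theory Num.Theory.
Local Open Scope ring_scope.

(** * The norm on formal sums *)

Section ThetaNorm.
Variables (R : realType) (D : theta_data).
Implicit Types (a b : formal_sum R D) (M : tobj D).

(** Passing to t copies of ^eF is what makes Cramer's rule available: one vector (X^{m_i} z)_i has
    translates (g(X^{m_i}) g(z))_i, so running through g produces the rows of a square matrix. The
    price is a factor t, which can be divided out because the coefficients are real. Delta acts on F
    by ordinary multiplication, while B acts on ^eF through p^e-th powers; so Delta, which stays
    fixed as e grows, costs only the exponents that its leading monomial does not divide. B is not
    local, so generation modulo the irrelevant ideal lifts to B only for homogeneous elements. For
    this reason the copies of ^eF are shifted by deg(X^{m_i}) / p^e, which does not change their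
    classes. The selection of orbits is made before completion and then transported. The limit asks
    for one expansion into distinct indecomposable classes whose weight is small. Such an expansion
    is obtained by splitting and merging, which use three properties of top lengths: existence,
    superadditivity on direct sums, and positivity on nonzero modules. The number of B-generators
    bounds them from above. *)

Lemma theta_eq_catl a b b' : theta_eq b b' -> theta_eq (a ++ b) (a ++ b').
Proof. by move=> ?; apply: theta_add => //; exact: theta_refl. Qed.

Lemma theta_eq_catr a a' b : theta_eq a a' -> theta_eq (a ++ b) (a' ++ b).
Proof. by move=> ?; apply: theta_add => //; exact: theta_refl. Qed.

Lemma theta_eq_perm a b : Permutation.Permutation a b -> theta_eq a b.
Proof.
elim=> [|x s t _ IH|x y s|s t u _ IH1 _ IH2].
- exact: theta_refl.
- exact: (theta_eq_catl [:: x]).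
- exact: (theta_eq_catr _ (theta_comm [:: y] [:: x])).
- exact: theta_trans IH1 IH2.
Qed.

Hypothesis top_exists : forall M, exists l, top_length M l.
Hypothesis top_sum : forall M M1 M2 l l1 l2, is_sum M M1 M2 ->
  top_length M l -> top_length M1 l1 -> top_length M2 l2 -> (l1 + l2 <= l)%N.
Hypothesis top_gt0 : forall M l, ~ is_zero M -> top_length M l -> (0 < l)%N.
Hypothesis zero_sum : forall M, is_zero M -> is_sum M M M.

(** A zero object is the sum of two copies of itself, so [M] = 2 [M]; adding a term of coefficient
    -c cancels one copy. *)
Lemma theta_eq_zero M (c : R) : is_zero M -> theta_eq [:: (c, M)] [::].
Proof.
move=> /zero_sum MM.
have H := theta_sum c MM.
have H1 := theta_eq_catr [:: (- c, M)] H.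
have E (x y : R) : theta_eq [:: (x, M); (y, M)] [:: (x + y, M)].
  exact/theta_sym/theta_scaleD.
have Z : theta_eq [:: (c, M); (- c, M)] [::].
  by have := E c (- c); rewrite subrr => h; apply: theta_trans h _; exact: theta_scale0.
apply: theta_sym; apply: theta_trans (theta_sym Z) _.
apply: theta_trans H1 _; apply: theta_trans (theta_eq_catl [:: (c, M)] Z) _.
exact: theta_refl.
Qed.

(* A formal sum together with the lengths of its terms. *)
Let weighted := seq (R * tobj D * nat).
Let terms (s : weighted) : formal_sum R D := map fst s.
Let weight (s : weighted) : R := \sum_(x <- s) `|x.1.1| * x.2%:R.
Let good (s : weighted) :=
  forall x, List.In x s -> indecomposable x.1.2 /\ top_length x.1.2 x.2.

(** Both parts of a proper splitting have positive top length, hence each has a smaller one than M,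
    and the splitting process ends. Superadditivity keeps the weight from growing. *)
Lemma theta_decompose M (c : R) l : top_length M l -> exists s : weighted,
  [/\ good s, theta_eq [:: (c, M)] (terms s) & weight s <= `|c| * l%:R].
Proof.
have [n] := ubnP l; elim: n M l => // n IHn M l ln Ml.
have [M0|M0] := pselect (is_zero M).
  exists [::]; split=> //; first exact: theta_eq_zero.
  by rewrite /weight big_nil mulr_ge0.
have [Mi|Mi] := pselect (indecomposable M).
  exists [:: (c, M, l)]; split=> [x [<-|//]//||].
    exact: theta_refl.
  by rewrite /weight big_seq1.
have [M1 [M2 [M12 M1n0 M2n0]]] :
    exists M1 M2, [/\ is_sum M M1 M2, ~ is_zero M1 & ~ is_zero M2].
  apply/not_existsP => H; apply: Mi; split=> // M1 M2 M12.
  apply: contrapT => /not_orP[? ?]; apply: (H M1); exists M2; split=> //.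
have [l1 Ml1] := top_exists M1; have [l2 Ml2] := top_exists M2.
have l12 := top_sum M12 Ml Ml1 Ml2.
have l1_gt0 := top_gt0 M1n0 Ml1; have l2_gt0 := top_gt0 M2n0 Ml2.
have [|s1 [g1 e1 w1]] := IHn M1 l1 _ Ml1.
  rewrite -ltnS; apply: leq_trans ln; rewrite ltnS; apply: leq_trans l12.
  by rewrite -addn1 leq_add2l.
have [|s2 [g2 e2 w2]] := IHn M2 l2 _ Ml2.
  rewrite -ltnS; apply: leq_trans ln; rewrite ltnS; apply: leq_trans l12.
  by rewrite -addn1 addnC leq_add2r.
exists (s1 ++ s2); split.
- by move=> x /List.in_app_iff[/g1|/g2].
- rewrite /terms map_cat; apply: theta_trans (theta_sum c M12) _.
  exact: (theta_add e1 e2).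
- rewrite /weight big_cat /=; apply: le_trans (lerD w1 w2) _.
  by rewrite -mulrDr -natrD ler_wpM2l // ler_nat.
Qed.

Lemma theta_decompose_sum a (l : seq nat) :
  size l = size a ->
  (forall i M0, (i < size a)%N -> top_length (nth (0, M0) a i).2 (nth 0%N l i)) ->
  exists s : weighted, [/\ good s, theta_eq a (terms s) &
    weight s <= \sum_(x <- zip a l) `|x.1.1| * x.2%:R].
Proof.
elim: a l => [|[c M] a IHa] [|n l] //= => [_ _|[sl] H].
  by exists [::]; split=> //; rewrite ?/weight ?big_nil //; exact: theta_refl.
have [s1 [g1 e1 w1]] := theta_decompose c (H 0%N M isT).
have [i M0 ia|s2 [g2 e2 w2]] := IHa l sl; first exact: (H i.+1).
exists (s1 ++ s2); split.
- by move=> x /List.in_app_iff[/g1|/g2].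
- rewrite /terms map_cat; exact: (theta_add e1 e2).
- by rewrite /weight big_cat big_cons /= lerD.
Qed.

Lemma theta_merge (s : weighted) : good s -> exists s' : weighted,
  [/\ good s', theta_eq (terms s) (terms s'), weight s' <= weight s &
   forall x0 i j, (i < size s')%N -> (j < size s')%N -> i != j ->
     ~ classes_eq (nth x0 s' i).1.2 (nth x0 s' j).1.2].
Proof.
have [n] := ubnP (size s); elim: n s => // n IHn s sn gs.
have [H|H] := pselect (forall x0 i j, (i < size s)%N -> (j < size s)%N ->
    i != j -> ~ classes_eq (nth x0 s i).1.2 (nth x0 s j).1.2).
  by exists s; split=> //; exact: theta_refl.
have [x0 [i [j [si sj ij cij]]]] : exists x0 i j, [/\ (i < size s)%N,
    (j < size s)%N, i != j &
    classes_eq (nth x0 s i).1.2 (nth x0 s j).1.2].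
  apply/not_existsP => H'; apply: H => x0 i j si sj ij cij.
  by apply: (H' x0); exists i, j.
have [x [y [t [Hp cxy]]]] : exists x y t,
    Permutation.Permutation s (x :: y :: t) /\ classes_eq x.1.2 y.1.2.
  have split1 (u : weighted) (m : nat) : (m < size u)%N ->
      Permutation.Permutation u (nth x0 u m :: (take m u ++ drop m.+1 u)).
    move=> mu; rewrite -{1}(cat_take_drop m u) (drop_nth x0) //.
    exact/Permutation.Permutation_sym/Permutation.Permutation_middle.
  have P1 := split1 s i si.
  set u := take i s ++ drop i.+1 s in P1.
  (* The position of the j-th term after the i-th one has been removed: indices beyond i drop by
     one. *)
  pose j' := if (j < i)%N then j else j.-1.
  have su : (size u).+1 = size s.
    by rewrite size_cat size_take si size_drop -addnS -subSn // subSS subnKC // ltnW.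
  have ju : (j' < size u)%N.
    rewrite -ltnS su /j'; case: ifP => [ji|/negbT]; first exact: leq_ltn_trans si.
    by rewrite -leqNgt => ij'; rewrite (ltn_predK (m := i)) // ltn_neqAle ij.
  have E : nth x0 u j' = nth x0 s j.
    rewrite nth_cat size_take si /j'; case: (ltnP j i) => [ji|]; first by rewrite ji nth_take.
    move=> ij'; have {}ij' : (i < j)%N by rewrite ltn_neqAle ij.
    have ji : (j.-1 < i)%N = false by apply/negbTE; rewrite -leqNgt -ltnS (ltn_predK ij').
    by rewrite ji nth_drop; congr nth; rewrite addSn subnKC ?(ltn_predK ij') // -ltnS (ltn_predK ij').
  exists (nth x0 s i), (nth x0 s j), (take j' u ++ drop j'.+1 u); split=> //.
  apply: Permutation.perm_trans P1 _; apply: Permutation.perm_skip.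
  by rewrite -E; exact: split1.
have [gx lx] := gs x (Permutation.Permutation_in _
  (Permutation.Permutation_sym Hp) (or_introl erefl)).
have [gy ly] := gs y (Permutation.Permutation_in _
  (Permutation.Permutation_sym Hp) (or_intror (or_introl erefl))).
have gt z : List.In z t -> indecomposable z.1.2 /\ top_length z.1.2 z.2.
  move=> zt; apply: gs; apply: (Permutation.Permutation_in _
    (Permutation.Permutation_sym Hp)); by right; right.
have wP (u v : weighted) : Permutation.Permutation u v -> weight u = weight v.
  rewrite /weight; elim=> [|a0 b0 b1 _ IH|a0 b0 b1|? ? ? _ -> _ -> //] //.
  - by rewrite !big_cons IH.
  - by rewrite !big_cons addrCA.
have tP (u v : weighted) : Permutation.Permutation u v ->
    Permutation.Permutation (terms u) (terms v).
  by move=> uv; exact: Permutation.Permutation_map.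
have st : (size t).+2 = size s.
  have <- : size (x :: y :: t) = size s.
    exact/esym/(Permutation.Permutation_length Hp).
  by [].
(* The representative with the smaller recorded length is kept. Then the triangle inequality bounds
   the new weight, and the lengths of two objects with the same class need not be compared
   otherwise. *)
pose z : R * tobj D * nat := if (x.2 <= y.2)%N then (x.1.1 + y.1.1, x.1.2, x.2)
  else (x.1.1 + y.1.1, y.1.2, y.2).
have [||s' [gs' es' ws' ds']] := IHn (z :: t).
- by rewrite /= -ltnS st.
- by move=> v [<-|/gt//]; rewrite /z; case: ifP.
exists s'; split=> //.
- apply: theta_trans es'; apply: theta_trans (theta_eq_perm (tP _ _ Hp)) _.
  apply: (theta_eq_catr _ (a := [:: _; _]) (a' := [:: _])).
  rewrite /z; case: ifP => _ /=; apply: theta_trans _ (theta_sym (theta_scaleD _ _ _)).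
    rewrite -surjective_pairing; apply: (theta_eq_catl [:: _]).
    rewrite [y.1]surjective_pairing; exact/theta_sym/theta_classes.
  rewrite [x.1]surjective_pairing {1}[y.1]surjective_pairing.
  by apply: (theta_eq_catr [:: _] (a := [:: _]) (a' := [:: _])); exact: theta_classes.
- apply: le_trans ws' _; rewrite (wP _ _ Hp) /weight !big_cons addrA lerD2r.
  rewrite /z; case: leqP => /= xy.
    apply: le_trans (_ : (`|x.1.1| + `|y.1.1|) * x.2%:R <= _).
      by rewrite ler_wpM2r // ler_normD.
    by rewrite mulrDl lerD2l ler_wpM2l // ler_nat.
  apply: le_trans (_ : (`|x.1.1| + `|y.1.1|) * y.2%:R <= _).
    by rewrite ler_wpM2r // ler_normD.
  by rewrite mulrDl lerD2r ler_wpM2l // ler_nat ltnW.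
Qed.

(** This is the form in which [theta_limit] is verified: any expression with known top lengths
    yields a norm that is no larger than its weight. *)
Lemma theta_norm_le a (l : seq nat) :
  size l = size a ->
  (forall i M0, (i < size a)%N -> top_length (nth (0, M0) a i).2 (nth 0%N l i)) ->
  exists2 x : R, is_theta_norm a x & x <= \sum_(y <- zip a l) `|y.1.1| * y.2%:R.
Proof.
move=> sl la; have [s [gs es ws]] := theta_decompose_sum sl la.
have [s' [gs' es' ws' ds']] := theta_merge gs.
exists (weight s'); last exact: le_trans ws' ws.
have {es es'}es : theta_eq a (terms s') by exact: theta_trans es es'.
case: s' => [|x0 s'] in gs' ds' es ws' *.
  exists 0%N, (fun i : 'I_0 => False_rect _ (notF (ltn_ord i))),
    (fun i : 'I_0 => False_rect _ (notF (ltn_ord i))),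
    (fun i : 'I_0 => False_rect _ (notF (ltn_ord i))).
  split=> [[]|[]||[]|] //; [by rewrite enum_ord0 | by rewrite /weight big_nil big_ord0].
set s1 := x0 :: s' in gs' ds' es ws' *.
have nin (u : weighted) i : (i < size u)%N -> List.In (nth x0 u i) u.
  elim: u i => [|x u IH] [|i] //= ; first by left.
  by move=> ii; right; exact: IH.
exists (size s1), (fun i => (nth x0 s1 i).1.1), (fun i => (nth x0 s1 i).1.2),
  (fun i => (nth x0 s1 i).2); split.
- by move=> i; have [] := gs' _ (nin _ _ (ltn_ord i)).
- by move=> i j ij; exact: ds'.
- have <- : terms s1 = [seq ((nth x0 s1 (nat_of_ord i)).1.1,
      (nth x0 s1 (nat_of_ord i)).1.2) | i <- enum 'I_(size s1)].
    rewrite (map_comp (fun i : nat => ((nth x0 s1 i).1.1, (nth x0 s1 i).1.2)) (@nat_of_ord _)).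
    rewrite val_enum_ord /terms -{1}(mkseq_nth x0 s1) -map_comp.
    by apply: eq_map => i /=; rewrite -surjective_pairing.
  exact: es.
- by move=> i; have [] := gs' _ (nin _ _ (ltn_ord i)).
- by rewrite /weight (big_nth x0) big_mkord.
Qed.

End ThetaNorm.

(** * Submodule chains and the Jacobson radical *)

Section Lengths.
Variable S : nzRingType.
Implicit Types M : lmodType S.

Lemma add_subgroupD (V : zmodType) (H : set V) : is_add_subgroup H ->
  forall x y, H x -> H y -> H (x + y).
Proof.
move=> [H0 HB] x y Hx Hy; rewrite -[y]opprK; apply: (HB) => //.
by rewrite -sub0r; exact: HB.
Qed.

Lemma add_subgroupN (V : zmodType) (H : set V) : is_add_subgroup H ->
  forall x, H x -> H (- x).
Proof. by move=> [H0 Hs] x Hx; rewrite -sub0r; exact: Hs. Qed.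

Lemma add_subgroup_sum (V : zmodType) (H : set V) : is_add_subgroup H ->
  forall (I : eqType) (s : seq I) (P : pred I) (F : I -> V),
  (forall i, i \in s -> P i -> H (F i)) -> H (\sum_(i <- s | P i) F i).
Proof.
move=> HH I s P F HF; rewrite big_seq_cond; elim/big_ind: _ => [|x y|i /andP[]].
- exact: HH.1.
- exact: add_subgroupD.
- exact: HF.
Qed.

Lemma add_span_subgroup (V : zmodType) (X : set V) : is_add_subgroup (add_span X).
Proof. by split; [exact: add_span0 | exact: add_spanB]. Qed.

Lemma add_span_min (V : zmodType) (X H : set V) : is_add_subgroup H ->
  (X `<=` H)%classic -> (add_span X `<=` H)%classic.
Proof.
by move=> [H0 HB] XH x; elim=> [y /XH||y z _ Hy _ Hz] //; exact: HB.
Qed.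

Lemma submodule_setT M : is_submodule [set: M].
Proof. by split. Qed.

Lemma ideal_mul_hom (M M' : lmodType S) (h : {linear M -> M'}) (I : set S) x :
  ideal_mul I x -> ideal_mul I (h x).
Proof.
elim=> [_ [s [y [Is ->]]]||y z _ Hy _ Hz].
- by apply: add_span_gen; exists s, (h y); rewrite linearZ.
- by rewrite linear0; exact: add_span0.
- by rewrite linearB; exact: add_spanB.
Qed.

Lemma length_exists M (N : set M) r :
  (forall C l, submodule_chain N l C -> (l <= r)%N) ->
  exists l, quotient_length N l.
Proof.
move=> Nr; pose P l := `[< exists C, submodule_chain N l C >].
have P0 : exists l, P l.
  exists 0%N; apply/asboolP; exists (fun=> [set: M]%classic).
  by split=> // i _; exact: submodule_setT.
have Pr l : P l -> (l <= r)%N by move=> /asboolP[C]; exact: Nr.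
have [l /asboolP Pl maxl] := ex_maxnP P0 Pr.
by exists l; split=> // l' C NC; apply: maxl; apply/asboolP; exists C.
Qed.

(** Two chains are concatenated: the first component climbs for l1 steps and then stays at its top,
    while truncated subtraction holds the second component at index 0 until it starts to climb. *)
Lemma length_sum (M M1 M2 : lmodType S) (I : set S)
    (h : {linear M -> (M1 * M2)%type}) l l1 l2 : bijective h ->
  quotient_length (@ideal_mul S M I) l ->
  quotient_length (@ideal_mul S M1 I) l1 ->
  quotient_length (@ideal_mul S M2 I) l2 -> (l1 + l2 <= l)%N.
Proof.
move=> [h' h'K hK] [_ lmax] [[C1 [N1 s1 c1]] _] [[C2 [N2 s2 c2]] _].
have add_h x y : (h (x - y)).1 = (h x).1 - (h y).1 /\
    (h (x - y)).2 = (h x).2 - (h y).2 by rewrite linearB.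
apply: (lmax _ (fun i => [set x | C1 (minn i l1) (h x).1 /\
                             C2 (i - l1)%N (h x).2]%classic)).
split.
- move=> x Ix; have := ideal_mul_hom h Ix; rewrite min0n sub0n /=.
  have fstP y : ideal_mul I y -> ideal_mul I (y : M1 * M2).1.
    elim=> [_ [s [z [Is ->]]]||z t _ Hz _ Ht].
    + by apply: add_span_gen; exists s, z.1.
    + exact: add_span0.
    + exact: add_spanB.
  have sndP y : ideal_mul I y -> ideal_mul I (y : M1 * M2).2.
    elim=> [_ [s [z [Is ->]]]||z t _ Hz _ Ht].
    + by apply: add_span_gen; exists s, z.2.
    + exact: add_span0.
    + exact: add_spanB.
  by move=> hx; split; [exact/N1/fstP | exact/N2/sndP].
- move=> i il.
  have [[z1 b1] m1] := s1 (minn i l1) (geq_minr _ _).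
  have [|[z2 b2] m2] := s2 (i - l1)%N; first by rewrite leq_subLR.
  split; first split.
  + by rewrite /= linear0.
  + move=> x y [x1 x2] [y1 y2] /=; have [-> ->] := add_h x y.
    by split; [exact: b1 | exact: b2].
  + move=> s x [x1 x2] /=; rewrite linearZ.
    by split; [exact: m1 | exact: m2].
- move=> i il; have [il1|il1] := ltnP i l1.
    have -> : minn i.+1 l1 = i.+1 by apply/minn_idPl.
    have -> : (i - l1 = 0)%N by apply/eqP; rewrite subn_eq0 ltnW.
    have -> : (i.+1 - l1 = 0)%N by apply/eqP; rewrite subn_eq0.
    have [sub nsub] := c1 i il1; split=> [x [/sub x1 x2] //|H].
    apply: nsub => y y1; have [|] := H (h' (y, 0)); rewrite /= hK //.
    by split=> //; exact: (s2 0%N isT).1.1.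
  have -> : minn i.+1 l1 = l1 by apply/minn_idPr/leqW.
  rewrite subSn //; have [|sub nsub] := c2 (i - l1)%N; first by rewrite ltn_subLR.
  split=> [x [x1 /sub x2] //|H].
  apply: nsub => y y1; have [|] := H (h' (0, y)); rewrite /= hK //.
  by split=> //; exact: (s1 l1 (leqnn _)).1.1.
Qed.

(** Choose an element of each [C i.+1] outside [C i]. If l > r, their coefficient vectors in k^r are
    linearly dependent, so a nontrivial combination lies in [C 0]; the element with the last nonzero
    coefficient then falls into the submodule it was chosen to avoid. *)
Lemma chain_le (k : fieldType) (iota : {rmorphism k -> S}) M (N : set M) r
    (v : 'I_r -> M) :
  (forall x, exists c : 'I_r -> k, N (x - \sum_i iota (c i) *: v i)) ->
  forall C l, submodule_chain N l C -> (l <= r)%N.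
Proof.
move=> vN C l [NC sC cC].
have mono i j : (i <= j <= l)%N -> (C i `<=` C j)%classic.
  elim: j => [|j IHj]; first by rewrite leqn0 => /andP[/eqP -> _] x.
  rewrite leq_eqVlt => /andP[/predU1P[-> _ x //|ij] jl] x Cx.
  apply: (cC j jl).1; apply: IHj Cx; exact/andP/(conj ij)/ltnW.
have /choice [y yP] : forall i : 'I_l, exists y, C i.+1 y /\ ~ C i y.
  move=> i; have [_ nsub] := cC i (ltn_ord i); apply: contrapT => H.
  by apply: nsub => x Cx; apply: contrapT => nx; apply: H; exists x.
have /choice [c cP] := fun i => vN (y i).
rewrite leqNgt; apply/negP => rl.
pose A : 'M[k]_(l, r) := \matrix_(i, j) c i j.
have : kermx A != 0.
  rewrite kermx_eq0 /row_free; apply/eqP => rA.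
  by have := rank_leq_col A; rewrite rA leqNgt rl.
case/rowV0Pn => a /sub_kermxP aA a0.
have [i1 ai1] : exists i, a 0 i != 0.
  by case/rV0Pn: a0 => i; exists i.
have [C00 C0Z] := sC 0%N isT.
have Sum0 : C 0%N (\sum_i iota (a 0 i) *: y i).
  have -> : \sum_i iota (a 0 i) *: y i =
      \sum_i iota (a 0 i) *: (y i - \sum_j iota (c i j) *: v j).
    under [RHS]eq_bigr do rewrite scalerBr scaler_sumr.
    rewrite sumrB exchange_big /= [X in _ - X]big1 ?subr0 // => j _.
    under eq_bigr do rewrite scalerA -rmorphM.
    rewrite -scaler_suml -rmorph_sum.
    have := congr1 (fun B : 'rV_r => B 0 j) aA; rewrite !mxE.
    by under eq_bigr do rewrite mxE; move=> ->; rewrite rmorph0 scale0r.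
  by apply: add_subgroup_sum => // i _ _; apply: C0Z; apply: NC.
case: (@arg_maxnP _ i1 (fun i => a 0 i != 0) (fun i => i : nat) ai1) => i0 ai0 imax.
have [_ []] := yP i0; have [Ci Ciz] := sC i0 (ltnW (ltn_ord i0)).
have -> : y i0 = iota (a 0 i0)^-1 *: (iota (a 0 i0) *: y i0).
  by rewrite scalerA -rmorphM mulVf // rmorph1 scale1r.
apply: (Ciz).
have -> : iota (a 0 i0) *: y i0 = \sum_i iota (a 0 i) *: y i -
    \sum_(i | i != i0) iota (a 0 i) *: y i by rewrite (bigD1 i0) //= addrK.
apply: Ci.2; first by apply: mono Sum0; rewrite leq0n ltnW.
apply: add_subgroup_sum => // i _ ii0; have [->|ai] := eqVneq (a 0 i) 0.
  by rewrite rmorph0 scale0r; exact: Ci.1.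
apply: (Ciz); have [yi _] := yP i; apply: mono yi.
by rewrite (ltnW (ltn_ord i0)) andbT ltn_neqAle ii0; exact: imax.
Qed.

Definition maximal_submodule M (Q : set M) :=
  [/\ is_submodule Q, exists x, ~ Q x &
      forall Q', is_submodule Q' -> (Q `<=` Q')%classic ->
        (exists x, ~ Q' x) -> (Q' `<=` Q)%classic].

(** The bound on chains takes the place of Zorn's lemma: a proper last term that is not maximal
    prolongs the chain. *)
Lemma maximal_submodule_exists M (P : set M) r : is_submodule P ->
  (exists x, ~ P x) -> (forall C l, submodule_chain P l C -> (l <= r)%N) ->
  exists2 Q, (P `<=` Q)%classic & maximal_submodule Q.
Proof.
move=> sP nP Pr.
suff H m C l : submodule_chain P l C -> (exists x, ~ C l x) -> (r - l < m)%N ->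
    exists2 Q, (P `<=` Q)%classic & maximal_submodule Q.
  by apply: (H (r - 0).+1 (fun=> P) 0%N) => //; split.
elim: m C l => // m IHm C l CC nC lm.
have [PC sC cC] := CC.
have PCl j : (j <= l)%N -> (P `<=` C j)%classic.
  elim: j => // j IHj jl; apply: subset_trans (IHj (ltnW jl)) _.
  exact: (cC j jl).1.
have [Cmax|] := pselect (maximal_submodule (C l)).
  by exists (C l) => //; exact: PCl.
move=> nmax.
have [Q' [sQ' CQ' nQ' nsub]] : exists Q', [/\ is_submodule Q',
    (C l `<=` Q')%classic, exists x, ~ Q' x & ~ (Q' `<=` C l)%classic].
  apply: contrapT => H; apply: nmax; split=> //; first exact: sC.
  by move=> Q' sQ' CQ' nQ'; apply: contrapT => nsub; apply: H; exists Q'.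
have CC' : submodule_chain P l.+1 (fun i => if (i <= l)%N then C i else Q').
  split=> // [i|i].
    by case: (leqP i l) => // il _; exact: sC.
  rewrite ltnS => il; rewrite il; case: (ltnP i l) => li; first exact: cC.
  by have -> : i = l by apply/eqP; rewrite eqn_leq il.
apply: (IHm _ _ CC'); first by rewrite ltnn.
by have := Pr _ _ CC' => lr; rewrite -ltnS; apply: leq_trans lm; rewrite ltnS subnSK.
Qed.

Lemma length_gt0 M (N Q : set M) l : is_submodule Q -> (exists x, ~ Q x) ->
  (N `<=` Q)%classic -> quotient_length N l -> (0 < l)%N.
Proof.
move=> sQ [x nQ] NQ [_ lmax].
apply: (lmax _ (fun i => if i is 0%N then Q else [set: M]%classic)).
split=> // [[|i] _|[|i] //]; [exact: sQ | exact: submodule_setT | move=> _].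
by split=> // /(_ x I).
Qed.

(* The annihilator in A of an element of the simple A-module M / Q is a
   maximal left ideal. *)
Lemma jacobson_maximal_submodule (A nn : set S) M (Q : set M) :
  is_add_subgroup A -> A 1 -> (forall s t, A s -> A t -> A (s * t)) ->
  (forall s, exists a b, [/\ A a, nn b & s = a + b]) ->
  (forall b x, nn b -> Q (b *: x)) -> maximal_submodule Q ->
  forall j x, jacobson A j -> Q (j *: x).
Proof.
move=> sA A1 AM Ann nnQ [[sQ QZ] _ Qmax] j x [Aj Jj].
have [/QZ //|nQx] := pselect (Q x).
pose I : set S := [set s | A s /\ Q (s *: x)]%classic.
suff /Jj [] : is_maximal_left_ideal A I by [].
split; first split.
- by move=> s [].
- split; first by split; [exact: sA.1 | rewrite scale0r; exact: sQ.1].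
  move=> s t [As Qs] [At Qt]; split; first exact: sA.2.
  by rewrite scalerBl; exact: sQ.2.
- by move=> a s Aa [As Qs]; split; [exact: AM | rewrite -scalerA; exact: QZ].
- by move=> [_]; rewrite scale1r.
move=> J [JA sJ JM] IJ nJ1 s Js; split; first exact: JA.
apply: contrapT => nQs; apply: nJ1.
pose Q' : set M := [set y | exists q t, [/\ Q q, A t & y = q + t *: (s *: x)]]%classic.
have sQ' : is_submodule Q'.
  split; first split.
  - by exists 0, 0; split; [exact: sQ.1|exact: sA.1|rewrite scale0r addr0].
  - move=> _ _ [q [t [Qq At ->]]] [q' [t' [Qq' At' ->]]].
    exists (q - q'), (t - t'); split; [exact: sQ.2|exact: sA.2|].
    by rewrite scalerBl opprD addrACA.
  (* The component b in [nn] maps everything into Q, so only the component a in A moves the second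
     term; thus Q + A s x is stable under all of S. *)
  - move=> u _ [q [t [Qq At ->]]]; have [a [b [Aa nb ->]]] := Ann u.
    exists ((a + b) *: q + b *: (t *: (s *: x))), (a * t); split; last 1 first.
    + by rewrite scalerDr -addrA; congr (_ + _); rewrite scalerDl addrC scalerA.
    + by apply: add_subgroupD => //; [exact: QZ | exact: nnQ].
    + exact: AM.
have [y [t [Qy At Ex]]] : Q' x.
  apply: contrapT => nQ'x; apply: nQs; apply: (Qmax Q' sQ') => //.
  - by move=> y Qy; exists y, 0; split; [|exact: sA.1|rewrite scale0r addr0].
  - by exists x.
  - by exists 0, 1; split; [exact: sQ.1| |rewrite scale1r add0r].
have I1 : I (1 - t * s).
  split; first by apply: sA.2 => //; apply: AM => //; exact: JA.
  by rewrite scalerBl scale1r -scalerA {1}Ex addrK.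
rewrite -[1](subrK (t * s)); apply: add_subgroupD => //; first exact: IJ.
exact: JM.
Qed.

End Lengths.

Lemma sum_enum_val (V : nmodType) (I : finType) (F : I -> V) :
  \sum_i F i = \sum_(t < #|I|) F (enum_val t).
Proof.
rewrite (reindex (@enum_val _ (mem I))) //.
by exists enum_rank => i _; [exact: enum_valK | exact: enum_rankK].
Qed.

(** * Free modules and modules over twisted group algebras *)

Section FreeBasis.
Variable R : comNzRingType.
Implicit Types M : lmodType R.

Definition free_basis M (I : finType) (v : I -> M) (co : M -> I -> R) : Prop :=
  (forall x, x = \sum_i co x i *: v i) /\
  (forall c i, co (\sum_j c j *: v j) i = c i).

Section Coordinates.
Variables (M : lmodType R) (I : finType) (v : I -> M) (co : M -> I -> R).
Hypothesis v_basis : free_basis v co.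

Lemma basis_sum x : x = \sum_i co x i *: v i.
Proof. exact: v_basis.1. Qed.

Lemma coordK c i : co (\sum_j c j *: v j) i = c i.
Proof. exact: v_basis.2. Qed.

Lemma coordD x y i : co (x + y) i = co x i + co y i.
Proof.
rewrite {1}[x]basis_sum {1}[y]basis_sum -big_split /=.
by under eq_bigr do rewrite -scalerDl; rewrite coordK.
Qed.

Lemma coordZ b x i : co (b *: x) i = b * co x i.
Proof.
rewrite {1}[x]basis_sum scaler_sumr.
by under eq_bigr do rewrite scalerA; rewrite coordK.
Qed.

Lemma coord0 i : co 0 i = 0.
Proof. by rewrite -(scale0r 0) coordZ mul0r. Qed.

Lemma coordB x y i : co (x - y) i = co x i - co y i.
Proof. by rewrite -scaleN1r coordD coordZ mulN1r. Qed.

Lemma coord_sum (T : Type) (s : seq T) (P : pred T) (F : T -> M) i :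
  co (\sum_(t <- s | P t) F t) i = \sum_(t <- s | P t) co (F t) i.
Proof.
by apply: (big_morph (fun x => co x i)) => [x y|]; [exact: coordD|exact: coord0].
Qed.

Lemma coord_basis i j : co (v j) i = (i == j)%:R.
Proof.
rewrite (_ : v j = \sum_l (l == j)%:R *: v l) ?coordK //.
rewrite (bigD1 j) //= eqxx scale1r big1 ?addr0 // => l /negPf ->.
by rewrite scale0r.
Qed.

End Coordinates.

Lemma free_of_rank_basis M f : free_of_rank M f ->
  exists (v : 'I_f -> M) co, free_basis v co.
Proof.
move=> [v vP].
have /choice [co coP] : forall x, exists c : {ffun 'I_f -> R},
    x = \sum_(i < f) c i *: v i by move=> x; have [c []] := vP x; exists c.
exists v, (fun x => co x); split=> // c i.
set x := \sum_j _; have [c0 [_ c0P]] := vP x.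
rewrite -(c0P _ (coP x)) (c0P [ffun i => c i]) ?ffunE //.
by apply: eq_bigr => j _; rewrite ffunE.
Qed.

(** The two transition matrices are square. Generation says AB = 1, and over a commutative ring this
    gives BA = 1, which is independence. *)
Lemma basis_of_generators M (K Z : finType) (y : K -> M) co (z : Z -> M) :
  free_basis y co -> #|Z| = #|K| ->
  (forall l, exists c : Z -> R, y l = \sum_i c i *: z i) ->
  exists co', free_basis z co'.
Proof.
move=> yb ZK /choice [P' zP].
pose iZ (t : 'I_#|K|) : Z := enum_val (cast_ord (esym ZK) t).
pose iK (t : 'I_#|K|) : K := enum_val t.
have reZ (V : zmodType) (F : Z -> V) : \sum_i F i = \sum_t F (iZ t).
  rewrite (reindex iZ) //; exists (fun i => cast_ord ZK (enum_rank i)) => i _.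
    by rewrite /iZ enum_valK cast_ordKV.
  by rewrite /iZ cast_ordK enum_rankK.
have reK (V : zmodType) (F : K -> V) : \sum_i F i = \sum_t F (iK t).
  rewrite (reindex iK) //; exists enum_rank => i _; first exact: enum_valK.
  exact: enum_rankK.
pose A : 'M[R]_#|K| := \matrix_(s, t) P' (iK s) (iZ t).
pose B : 'M[R]_#|K| := \matrix_(t, s) co (z (iZ t)) (iK s).
have AB : A *m B = 1%:M.
  apply/matrixP => s s'; rewrite !mxE.
  under eq_bigr do rewrite !mxE -(coordZ yb).
  rewrite -(coord_sum yb) -(reZ _ (fun i => P' (iK s) i *: z i)) -zP.
  by rewrite (coord_basis yb) (inj_eq enum_val_inj) eq_sym.
have BA := mulmx1C AB.
exists (fun x i => \sum_l co x l * P' l i); split=> [x|c i].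
  rewrite {1}(basis_sum yb x).
  under [RHS]eq_bigr do rewrite scaler_suml.
  rewrite exchange_big /=; apply: eq_bigr => l _.
  by rewrite zP scaler_sumr; apply: eq_bigr => i _; rewrite scalerA.
have [t ->] : exists t, i = iZ t.
  by exists (cast_ord ZK (enum_rank i)); rewrite /iZ cast_ordK enum_rankK.
rewrite (reZ _ (fun j => c j *: z j)) reK.
under eq_bigr => s _ do rewrite (coord_sum yb) mulr_suml.
rewrite exchange_big /=.
have E u : \sum_s co (c (iZ u) *: z (iZ u)) (iK s) * P' (iK s) (iZ t) =
    c (iZ u) * (B *m A) u t.
  rewrite !mxE mulr_sumr; apply: eq_bigr => s _.
  by rewrite (coordZ yb) !mxE mulrA.
under eq_bigr do rewrite E BA mxE.
rewrite (bigD1 t) //= eqxx mulr1 big1 ?addr0 // => u /negPf ->.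
by rewrite mulr0.
Qed.

End FreeBasis.

Lemma semilinear_sum (R R' : nzRingType) (theta : R -> R') (M : lmodType R)
    (M' : lmodType R') (j : M -> M') : semilinear theta j ->
  forall (I : Type) (s : seq I) (c : I -> R) (v : I -> M),
  j (\sum_(i <- s) c i *: v i) = \sum_(i <- s) theta (c i) *: j (v i).
Proof.
move=> [jD jZ] I s c v.
have j0 : j 0 = 0 by apply: (addrI (j 0)); rewrite -jD !addr0.
by rewrite (big_morph j jD j0); apply: eq_bigr => i _; exact: jZ.
Qed.

(** One basis that remains a basis under j is enough: the images of any other basis generate it and
    are equally many. In this way bases reach the completion. *)
Lemma basis_transport (R R' : comNzRingType) (theta : R -> R')
    (M : lmodType R) (M' : lmodType R') (j : M -> M') (K Z : finType)
    (y : K -> M) (z : Z -> M) co coz coy :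
  semilinear theta j -> #|Z| = #|K| -> free_basis y co ->
  free_basis z coz -> free_basis (j \o y) coy ->
  exists co', free_basis (j \o z) co'.
Proof.
move=> jl ZK yb zb jyb; apply: (basis_of_generators jyb ZK) => l.
exists (fun i => theta (coz (y l) i)); rewrite /= {1}(basis_sum zb (y l)).
exact: semilinear_sum.
Qed.

Section Submodule.
Variables (S : nzRingType) (M : lmodType S) (N : set M) (sN : is_submodule N).

Definition submod_pred of is_submodule N : {pred M} := fun x => `[< N x >].

Fact submod_pred_closed : submod_closed (submod_pred sN).
Proof.
have [NB NZ] := sN; split; first exact/asboolP/NB.1.
move=> s x y /asboolP Nx /asboolP Ny; apply/asboolP.
by apply: add_subgroupD => //; exact: NZ.
Qed.

HB.instance Definition _ := GRing.isSubmodClosed.Build S M (submod_pred sN)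
  submod_pred_closed.

Record submod := Submod {
  submod_val :> M;
  submod_valP : submod_val \in submod_pred sN }.

HB.instance Definition _ := [isSub for submod_val].
HB.instance Definition _ := [Choice of submod by <:].
HB.instance Definition _ := [SubChoice_isSubLmodule of submod by <:].

Lemma submodP (x : submod) : N (submod_val x).
Proof. by have /asboolP := submod_valP x. Qed.

Lemma submod_intro x : N x -> x \in submod_pred sN.
Proof. by move=> Nx; apply/asboolP. Qed.

End Submodule.

Section TwistedModules.
Variables (G : finGroupType) (R : comNzRingType) (a : ring_action G R).
Local Notation S := (twisted a).

Lemma tw_monoE r g x : tw_mono a r g x = if x == g then r else 0.
Proof. by rewrite ffunE. Qed.

Lemma tw_mono1M r r' g h :
  tw_mono a r g * tw_mono a r' h = tw_mono a (r * a g r') (g * h)%g.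
Proof.
apply/ffunP => x; rewrite tw_mulE tw_monoE (bigD1 g) //= !tw_monoE eqxx.
rewrite big1 ?addr0 => [|i /negPf ig]; last by rewrite tw_monoE ig mul0r.
rewrite -(inj_eq (mulgI g)) mulKVg; case: eqP => // _.
by rewrite rmorph0 mulr0.
Qed.

Lemma tw_const_monoM r g : tw_const a r * tw_mono a 1 g = tw_mono a r g.
Proof. by rewrite tw_mono1M rmorph1 mulr1 mul1g. Qed.

Lemma tw_mono_constM r g :
  tw_mono a 1 g * tw_const a r = tw_const a (a g r) * tw_mono a 1 g.
Proof. by rewrite tw_const_monoM tw_mono1M mul1r mulg1. Qed.

Lemma tw_sum (s : S) : s = \sum_g tw_const a (s g) * tw_mono a 1 g.
Proof.
apply/ffunP => x; rewrite sum_ffunE (bigD1 x) //= tw_const_monoM tw_monoE eqxx.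
rewrite big1 ?addr0 // => g /negPf gx.
by rewrite tw_const_monoM tw_monoE eq_sym gx.
Qed.

Section Actions.
Variable M : lmodType S.
Implicit Types x y : M.

Lemma gactD g x y : gact g (x + y) = gact g x + gact g y.
Proof. exact: scalerDr. Qed.

Lemma gact_sum g I (s : seq I) P (F : I -> M) :
  gact g (\sum_(i <- s | P i) F i) = \sum_(i <- s | P i) gact g (F i).
Proof. exact: scaler_sumr. Qed.

Lemma gactZ g b x : gact g (tw_const a b *: x) = tw_const a (a g b) *: gact g x.
Proof. by rewrite /gact !scalerA tw_mono_constM. Qed.

Lemma gactM g h x : gact (g * h)%g x = gact g (gact h x).
Proof. by rewrite /gact scalerA tw_mono1M rmorph1 mulr1. Qed.

Lemma gact1 x : gact 1%g x = x.
Proof. exact: scale1r. Qed.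

Lemma gactVK g x : gact g (gact g^-1 x) = x.
Proof. by rewrite -gactM mulgV gact1. Qed.

Lemma tw_scaleE (s : S) x : s *: x = \sum_g tw_const a (s g) *: gact g x.
Proof.
rewrite {1}[s]tw_sum scaler_suml; apply: eq_bigr => g _.
by rewrite scalerA.
Qed.

Lemma underlyingE b x : b *: (x : underlying M) = tw_const a b *: x.
Proof. by []. Qed.

Lemma underlying_generated : finitely_generated M ->
  exists r (v : 'I_r -> M),
    forall x, exists c : 'I_r -> R, x = \sum_i tw_const a (c i) *: v i.
Proof.
move=> [r [v vP]]; pose T := ('I_r * G)%type.
exists #|{: T}|, (fun i => gact (enum_val i).2 (v (enum_val i).1)) => x.
have [c ->] := vP x; exists (fun i => c (enum_val i).1 (enum_val i).2).
under eq_bigr do rewrite tw_scaleE.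
rewrite pair_big /= (reindex (@enum_val _ (mem {: T}))) //=.
by exists enum_rank => i _; [exact: enum_valK | exact: enum_rankK].
Qed.

Lemma generated_underlying (I : finType) (v : I -> M) :
  (forall x, exists c : I -> R, x = \sum_i tw_const a (c i) *: v i) ->
  finitely_generated M.
Proof.
move=> vP; exists #|I|, (fun i => v (enum_val i)) => x; have [c ->] := vP x.
exists (fun i => tw_const a (c (enum_val i))).
rewrite (reindex (@enum_val _ (mem I))) //=.
by exists enum_rank => i _; [exact: enum_valK | exact: enum_rankK].
Qed.

End Actions.

Lemma gact_ffun (M : lmodType S) (U : finType) g (x : {ffun U -> M}) u :
  gact g x u = gact g (x u).
Proof. by rewrite ffunE. Qed.

(* B * G is coinduced from B, so a B-linear retraction onto the free summand
   spanned by the orbit of x can be averaged to a B * G-linear one. *)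
Section Split.
Variables (M : lmodType S) (U I : finType) (x : U -> M).
Variables (z : (U * G) + I -> M) (co : M -> (U * G) + I -> R).
Hypothesis z_basis : free_basis (z : _ -> underlying M) co.
Hypothesis z_orbit : forall u g, z (inl (u, g)) = gact g (x u).

(** The image of a B-linear coordinate l under the isomorphism Hom_B(M, B) = Hom_{B * G}(M, B * G),
    which sends l to m |-> sum_g g(l(g^-1 m)) g. *)
Definition split_coef (u : U) (m : M) : S :=
  [ffun g => a g (co (gact g^-1 m) (inl (u, 1%g)))].

Lemma split_coefD u m m' : split_coef u (m + m') = split_coef u m + split_coef u m'.
Proof.
by apply/ffunP => g; rewrite !ffunE gactD (coordD z_basis) rmorphD.
Qed.

Lemma split_coefZ u s m : split_coef u (s *: m) = s * split_coef u m.
Proof.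
apply/ffunP => g; rewrite tw_mulE ffunE tw_scaleE gact_sum (coord_sum z_basis).
rewrite rmorph_sum; apply: eq_bigr => h _; rewrite ffunE gactZ -gactM.
rewrite (coordZ z_basis) rmorphM -ractM mulgV ract1; congr (_ * _).
by rewrite -ractM mulKVg invMg invgK.
Qed.

Lemma split_coef_orbit u u' : split_coef u (x u') = (u == u')%:R.
Proof.
apply/ffunP => g; rewrite ffunE -z_orbit (coord_basis z_basis).
rewrite -[inl _ == inl _]/((u, 1%g) == (u', g^-1%g)) xpair_eqE.
have [_|_] := eqVneq u u'; last by rewrite rmorph0 ffunE.
rewrite tw_oneE eq_sym invg_eq1; case: eqP => _; first by rewrite rmorph1.
by rewrite rmorph0.
Qed.

Lemma split_coef0 u : split_coef u 0 = 0.
Proof. by rewrite -(scale0r 0) split_coefZ mul0r. Qed.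

Lemma split_coef_sum u T (s : seq T) (F : T -> M) :
  split_coef u (\sum_(t <- s) F t) = \sum_(t <- s) split_coef u (F t).
Proof.
by apply: (big_morph (split_coef u)); [exact: split_coefD | exact: split_coef0].
Qed.

Definition split_kernel : set M := [set m | forall u, split_coef u m = 0]%classic.

Lemma split_kernel_submodule : is_submodule split_kernel.
Proof.
split; first split=> [u|m m' Km Km' u]; first exact: split_coef0.
  by rewrite -scaleN1r split_coefD split_coefZ Km Km' mulr0 addr0.
by move=> s m Km u; rewrite split_coefZ Km mulr0.
Qed.

Local Notation N := (submod split_kernel_submodule).

Definition split_proj (m : M) : M := m - \sum_u split_coef u m *: x u.

Lemma split_proj_kernel m : split_kernel (split_proj m).
Proof.
move=> u; rewrite /split_proj -scaleN1r split_coefD split_coefZ mulN1r split_coef_sum.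
rewrite (bigD1 u) //= big1 ?addr0 => [|i /negPf iu].
  by rewrite split_coefZ split_coef_orbit eqxx mulr1 subrr.
by rewrite split_coefZ split_coef_orbit eq_sym iu mulr0.
Qed.

Definition split_map (m : M) : ({ffun U -> S^o} * N)%type :=
  ([ffun u => split_coef u m : S^o],
   Submod (submod_intro split_kernel_submodule (split_proj_kernel m))).

Fact split_map_additive : zmod_morphism split_map.
Proof.
have sB u m m' : split_coef u (m - m') = split_coef u m - split_coef u m'.
  by rewrite -scaleN1r split_coefD split_coefZ mulN1r.
move=> m m'; congr pair.
  by apply/ffunP => u; rewrite !ffunE sB.
apply: val_inj; rewrite /= /split_proj.
under eq_bigr do rewrite sB scalerBl.
by rewrite sumrB !opprB addrACA [RHS]addrACA [- m' - _]addrC.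
Qed.

Fact split_map_scalable : scalable split_map.
Proof.
move=> s m; congr pair; first by apply/ffunP => u; rewrite !ffunE split_coefZ.
apply: val_inj; rewrite /= /split_proj scalerBr scaler_sumr.
by under eq_bigr do rewrite split_coefZ -scalerA.
Qed.

HB.instance Definition _ := GRing.isZmodMorphism.Build M ({ffun U -> S^o} * N)%type
  split_map split_map_additive.
HB.instance Definition _ := GRing.isScalable.Build S M ({ffun U -> S^o} * N)%type
  *:%R split_map split_map_scalable.

Definition split_lmap : {linear M -> ({ffun U -> S^o} * N)%type} := split_map.

Lemma split_map_bij : bijective split_lmap.
Proof.
exists (fun y : ({ffun U -> S^o} * N)%type => \sum_u (y.1 u : S) *: x u + submod_val y.2) => [m|[y n]].
  rewrite /=; under eq_bigr do rewrite ffunE.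
  by rewrite /split_proj addrCA subrr addr0.
have coef u : split_coef u (\sum_u (y u : S) *: x u + submod_val n) = y u.
  rewrite split_coefD (submodP n u) addr0 split_coef_sum (bigD1 u) //=.
  rewrite big1 ?addr0 => [|i /negPf iu].
    by rewrite split_coefZ split_coef_orbit eqxx mulr1.
  by rewrite split_coefZ split_coef_orbit eq_sym iu mulr0.
congr pair; first by apply/ffunP => u; rewrite ffunE coef.
apply: val_inj; rewrite /= /split_proj.
by under [X in _ - X]eq_bigr do rewrite coef; rewrite addrC addKr.
Qed.

(** The projection to the kernel kills the orbits, so the images of the remaining basis vectors
    generate the complement over B. Their number bounds its top length. *)
Lemma split_kernel_generated (n : N) : exists c : I -> R,
  n = \sum_i tw_const a (c i) *: (split_map (z (inr i))).2.
Proof.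
exists (fun i => co (submod_val n) (inr i)).
have {1}-> : n = (split_lmap (submod_val n)).2.
  apply: val_inj; rewrite /= /split_proj big1 ?subr0 // => u _.
  by rewrite (submodP n u) scale0r.
rewrite {1}(basis_sum z_basis (submod_val n)) big_sumType.
have sndD y y' : (split_lmap (y + y')).2 = (split_lmap y).2 + (split_lmap y').2.
  by rewrite linearD.
have snd0 : (split_lmap 0).2 = 0 by rewrite linear0.
rewrite sndD !(big_morph (fun y => (split_lmap y).2) sndD snd0).
rewrite [X in X + _]big1 ?add0r => [|[u g] _].
  by apply: eq_bigr => i _; rewrite underlyingE linearZ.
rewrite underlyingE linearZ z_orbit.
rewrite -[LHS]/(tw_const a _ *: (split_lmap (gact g (x u))).2).
have -> : (split_lmap (gact g (x u))).2 = 0.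
  have -> : (split_lmap (gact g (x u))).2 =
    tw_mono a 1 g *: (split_lmap (x u)).2 by rewrite /gact linearZ.
  have -> : (split_lmap (x u)).2 = 0; last by rewrite scaler0.
  apply: val_inj; rewrite /= /split_proj (bigD1 u) //= split_coef_orbit eqxx.
  rewrite scale1r big1 ?addr0 ?subrr // => i /negPf iu.
  by rewrite split_coef_orbit iu scale0r.
exact: scaler0.
Qed.

End Split.

End TwistedModules.

(** * Tops of ungraded modules *)

Section Augmented.
Variables (G : finGroupType) (R : comNzRingType) (a : ring_action G R).
Variables (k : fieldType) (iota : {rmorphism k -> R}) (eps : {rmorphism R -> k}).
Hypothesis iotaK : cancel iota eps.
Hypothesis eps_act : forall g b, eps (a g b) = eps b.
Local Notation S := (twisted a).

Definition aug_mul (M : lmodType S) : set M :=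
  add_span [set y | exists b x, eps b = 0 /\ y = tw_const a b *: x]%classic.
Arguments aug_mul : clear implicits.

Lemma aug_mul_submodule (M : lmodType S) : is_submodule (aug_mul M).
Proof.
split; first exact: add_span_subgroup.
move=> s x; elim=> [_ [b [y [b0 ->]]]||y z _ Hy _ Hz].
- rewrite (tw_scaleE s).
  apply: (add_subgroup_sum (add_span_subgroup _)) => g _ _.
  apply: add_span_gen; exists (s g * a g b), (gact g y).
  by rewrite rmorphM eps_act b0 mulr0 gactZ scalerA rmorphM.
- by rewrite scaler0; exact: add_span0.
- by rewrite scalerBr; exact: add_spanB.
Qed.

Lemma aug_chain_le (M : lmodType S) (N : set M) (I : finType) (v : I -> M) :
  (aug_mul M `<=` N)%classic ->
  (forall x, exists c : I -> R, x = \sum_i tw_const a (c i) *: v i) ->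
  forall C l, submodule_chain N l C -> (l <= #|I|)%N.
Proof.
move=> mN vP; apply: (@chain_le _ _ (tw_const a \o iota) _ _ _
  (fun i => v (enum_val i))) => x.
have [c xc] := vP x; exists (fun i => eps (c (enum_val i))); apply: mN.
rewrite {1}xc sum_enum_val -sumrB.
apply: (add_subgroup_sum (add_span_subgroup _)) => i _ _.
rewrite -scalerBl -rmorphB; apply: add_span_gen.
by do 2!eexists; split; last reflexivity; rewrite rmorphB iotaK subrr.
Qed.

Hypothesis eps_unit : forall b, eps b != 0 -> exists c, c * b = 1.

(** Determinant trick: 1 - b reduces to the identity matrix under [eps], so its determinant is
    invertible, and the adjugate writes det times each y_i as a combination of elements of H. *)
Lemma nakayama (V : lmodType R) (H : set V) (I : finType) (y : I -> V)
    (b : I -> I -> R) : is_submodule H ->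
  (forall i j, eps (b i j) = 0) -> (forall i, H (y i - \sum_j b i j *: y j)) ->
  forall i, H (y i).
Proof.
move=> [sH HZ] b0 yH i.
pose A : 'M[R]_#|I| := 1%:M - \matrix_(s, t) b (enum_val s) (enum_val t).
have [c cA] : exists c, c * \det A = 1.
  apply: eps_unit; rewrite -det_map_mx map_mxB map_mx1.
  rewrite (_ : map_mx _ _ = 0) ?subr0 ?det1 ?oner_eq0 //.
  by apply/matrixP => s t; rewrite !mxE; exact: b0.
rewrite -(enum_rankK i); set t := enum_rank i.
rewrite -[y _]scale1r -cA -scalerA; apply: (HZ).
have -> : \det A *: y (enum_val t) = \sum_s \adj A t s *:
    (y (enum_val s) - \sum_j b (enum_val s) j *: y j).
  transitivity (\sum_u (\adj A *m A) t u *: y (enum_val u)).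
    rewrite mul_adj_mx (bigD1 t) //= mxE eqxx big1 ?addr0 // => u /negPf ut.
    by rewrite mxE eq_sym ut scale0r.
  under eq_bigr do rewrite mxE scaler_suml.
  rewrite exchange_big /=; apply: eq_bigr => s _.
  under eq_bigr do rewrite -scalerA.
  rewrite -scaler_sumr; congr (_ *: _).
  have AE u : A s u = (s == u)%:R - b (enum_val s) (enum_val u) by rewrite !mxE.
  transitivity (\sum_u ((s == u)%:R *: y (enum_val u) -
      b (enum_val s) (enum_val u) *: y (enum_val u))).
    by apply: eq_bigr => u _; rewrite -scalerBl; congr (_ *: _); exact: AE.
  rewrite sumrB (sum_enum_val (fun j => b (enum_val s) j *: y j)); congr (_ - _).
  rewrite (bigD1 s) //= eqxx scale1r big1 ?addr0 // => u /negPf us.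
  by rewrite eq_sym us scale0r.
by apply: add_subgroup_sum => // s _ _; apply: (HZ).
Qed.

Lemma aug_mulE (M : lmodType S) (I : finType) (v : I -> M) x :
  (forall x, exists c : I -> R, x = \sum_i tw_const a (c i) *: v i) ->
  aug_mul M x -> exists c : I -> R,
    (forall i, eps (c i) = 0) /\ x = \sum_i tw_const a (c i) *: v i.
Proof.
move=> vP; elim=> [_ [b [y [b0 ->]]]||_ _ _ [c [c0 ->]] _ [c' [c'0 ->]]].
- have [c ->] := vP y; exists (fun i => b * c i).
  split=> [i|]; first by rewrite rmorphM b0 mul0r.
  by rewrite scaler_sumr; apply: eq_bigr => i _; rewrite scalerA rmorphM.
- exists (fun=> 0); split=> [i|]; first exact: rmorph0.
  by rewrite big1 // => i _; rewrite rmorph0 scale0r.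
- exists (fun i => c i - c' i); split=> [i|].
    by rewrite rmorphB c0 c'0 subrr.
  by rewrite -sumrB; apply: eq_bigr => i _; rewrite rmorphB scalerBl.
Qed.

(** If every element lay in [aug_mul], the generators would be combinations of themselves with
    coefficients in the kernel of [eps], and Nakayama with H = 0 would kill them. *)
Lemma aug_mul_proper (M : lmodType S) : finitely_generated M ->
  ~ (forall x : M, x = 0) -> exists x, ~ aug_mul M x.
Proof.
move=> /underlying_generated [r [v vP]] M0; apply: contrapT => nP.
have {}nP x : aug_mul M x by apply: contrapT => nx; apply: nP; exists x.
have /choice [c cP] := fun i => aug_mulE vP (nP (v i)).
apply: M0 => x; have [d ->] := vP x; apply: big1 => i _.
suff -> : v i = 0 by rewrite scaler0.
apply: (@nakayama (underlying M) [set 0]%classic _ v c).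
- by split=> [|s y ->]; [split=> // y y' -> ->; rewrite subr0 | rewrite scaler0].
- by move=> i' j; have [] := cP i'.
- by move=> i'; have [_ E] := cP i'; apply/eqP; rewrite subr_eq0 {1}E.
Qed.

(** If a maximal left ideal I misses b, then I plus the elements with all coefficients in the kernel
    of [eps] contains 1. Nakayama over R, applied modulo I to the finite basis G of the twisted
    group algebra, then puts 1 into I itself. *)
Lemma aug_jacobson b : eps b = 0 -> jacobson [set: S]%classic (tw_const a b).
Proof.
move=> b0; split=> // I [[_ sI IM] nI1 Imax]; apply: contrapT => nIb.
pose J : set S := [set s | exists i (m : S), [/\ I i, forall g, eps (m g) = 0 & s = i + m]]%classic.
have lJ : is_left_ideal [set: S]%classic J.
  split=> //; first split.
  - exists 0, 0; split; [exact: sI.1|by move=> g; rewrite ffunE rmorph0|].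
    by rewrite addr0.
  - move=> _ _ [i [m [Ii m0 ->]]] [i' [m' [Ii' m'0 ->]]].
    exists (i - i'), (m - m'); split; first exact: sI.2.
      by move=> g; rewrite !ffunE rmorphB m0 m'0 subrr.
    by rewrite opprD addrACA.
  - move=> s _ _ [i [m [Ii m0 ->]]]; exists (s * i), (s * m).
    split; [exact: IM | | exact: mulrDr] => g.
    rewrite tw_mulE rmorph_sum big1 // => h _.
    by rewrite rmorphM eps_act m0 mulr0.
have IJ : (I `<=` J)%classic.
  move=> i Ii; exists i, 0; split=> //; last by rewrite addr0.
  by move=> g; rewrite ffunE rmorph0.
have [i [m [Ii m0 E1]]] : J 1.
  apply: contrapT => nJ1; apply: nIb; apply: (Imax J lJ IJ nJ1).
  exists 0, (tw_const a b); split; [exact: sI.1 | | by rewrite add0r] => g.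
  by rewrite tw_monoE; case: ifP; rewrite ?rmorph0.
apply: nI1.
have -> : (1 : S) = tw_mono a 1 1%g by [].
apply: (@nakayama (underlying (S^o : lmodType S)) I G (tw_mono a 1)
  (fun g h => (tw_mono a 1 g * m) h)).
- by split=> // s t It; exact: IM.
- move=> g h; rewrite tw_mulE rmorph_sum big1 // => h' _.
  by rewrite rmorphM eps_act m0 mulr0.
- move=> g; have -> : \sum_h ((tw_mono a 1 g * m) h : R) *:
      (tw_mono a 1 h : underlying (S^o : lmodType S)) = tw_mono a 1 g * m.
    by rewrite [RHS]tw_sum.
  rewrite (_ : _ - _ = tw_mono a 1 g * i); first exact: IM.
  apply/eqP; rewrite subr_eq -mulrDr -E1 mulr1; exact/eqP.
Qed.

Section Wedge.
Implicit Types M : fg_module S.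

Lemma aug_ideal_mul (M : lmodType S) :
  (aug_mul M `<=` @ideal_mul S M (jacobson [set: S]))%classic.
Proof.
apply: add_span_min; first exact: add_span_subgroup.
move=> _ [b [x [b0 ->]]]; apply: add_span_gen.
by exists (tw_const a b), x; split=> //; exact: aug_jacobson.
Qed.

Lemma wedge_top_exists (M : tobj (theta_wedge S)) : exists l, top_length M l.
Proof.
have [r [v vP]] := underlying_generated (fg_modP M).
by apply: (@length_exists _ _ _ #|'I_r|); apply: aug_chain_le vP; exact: aug_ideal_mul.
Qed.

Lemma wedge_top_le (M : tobj (theta_wedge S)) l (I : finType) (v : I -> M) :
  (forall x, exists c : I -> R, x = \sum_i tw_const a (c i) *: v i) ->
  top_length M l -> (l <= #|I|)%N.
Proof.
by move=> vP [[C lC] _]; apply: aug_chain_le lC => //; exact: aug_ideal_mul.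
Qed.

Lemma wedge_top_sum (M M1 M2 : tobj (theta_wedge S)) l l1 l2 : is_sum M M1 M2 ->
  top_length M l -> top_length M1 l1 -> top_length M2 l2 -> (l1 + l2 <= l)%N.
Proof. by move=> [h h_bij]; exact: length_sum h_bij. Qed.

(** By Nakayama [aug_mul] is proper, hence contained in a maximal submodule; the latter also
    contains J(S) M, because J(S) annihilates simple modules. *)
Lemma wedge_top_gt0 (M : tobj (theta_wedge S)) l : ~ is_zero M ->
  top_length M l -> (0 < l)%N.
Proof.
move=> M0 Ml; have [r [v vP]] := underlying_generated (fg_modP M).
have [Q mQ Qmax] := maximal_submodule_exists (@aug_mul_submodule M)
  (aug_mul_proper (fg_modP M) M0) (aug_chain_le (@subset_refl _ _) vP).
have [[sQ QZ] nQ _] := Qmax.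
apply: (length_gt0 (Q := Q)) Ml => //.
apply: add_span_min => // _ [s [x [Js ->]]].
apply: (jacobson_maximal_submodule (A := [set: S]%classic)
  (nn := [set 0]%classic)) Js => //.
- by move=> t; exists t, 0; split=> //; rewrite addr0.
- by move=> _ y ->; rewrite scale0r; exact: sQ.1.
Qed.

End Wedge.

End Augmented.

(** * Zero modules and powers in the ungraded group *)

Section WedgeSums.
Variables (R : realType) (S : nzRingType).

Lemma wedge_zero_sum (M : tobj (theta_wedge S)) : is_zero M -> is_sum M M M.
Proof.
move=> M0; pose h (x : M) : (M * M)%type := (x, x).
have hB : zmod_morphism h by [].
have hZ : scalable h by [].
exists (HB.pack_for {linear M -> (M * M)%type} h
  (GRing.isZmodMorphism.Build _ _ _ hB) (GRing.isScalable.Build _ _ _ _ _ hZ)).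
exists fst => [x|[x y]] //=.
by rewrite /h (M0 x) (M0 y).
Qed.

Section Power.
Variables (M : lmodType S) (r : nat).

Definition ffun_split (x : {ffun 'I_r.+1 -> M}) : (M * {ffun 'I_r -> M})%type :=
  (x ord0, [ffun i => x (lift ord0 i)]).

Fact ffun_split_additive : zmod_morphism ffun_split.
Proof.
move=> x y; congr pair; first by rewrite !ffunE.
by apply/ffunP => i; rewrite !ffunE.
Qed.

Fact ffun_split_scalable : scalable ffun_split.
Proof.
move=> s x; congr pair; first by rewrite ffunE.
by apply/ffunP => i; rewrite !ffunE.
Qed.

HB.instance Definition _ := GRing.isZmodMorphism.Build
  {ffun 'I_r.+1 -> M} (M * {ffun 'I_r -> M})%type ffun_split ffun_split_additive.
HB.instance Definition _ := GRing.isScalable.Build S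
  {ffun 'I_r.+1 -> M} (M * {ffun 'I_r -> M})%type *:%R ffun_split
  ffun_split_scalable.

Lemma ffun_split_bij : bijective ffun_split.
Proof.
exists (fun y : (M * {ffun 'I_r -> M})%type =>
  [ffun i => if unlift ord0 i is Some j then y.2 j else y.1]) => [x|[y z]].
  apply/ffunP => i; rewrite ffunE; case: unliftP => [j ->|-> //].
  by rewrite /= ffunE.
congr pair; first by rewrite ffunE unlift_none.
by apply/ffunP => i; rewrite !ffunE liftK.
Qed.

End Power.

Lemma ffun_finitely_generated (M : lmodType S) r :
  finitely_generated M -> finitely_generated {ffun 'I_r -> M}.
Proof.
move=> [s [v vP]]; pose T := ('I_r * 'I_s)%type.
exists #|{: T}|, (fun t : 'I_#|{: T}| => [ffun i =>
  if i == (enum_val t).1 then v (enum_val t).2 else 0]) => x.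
have /choice [c cP] := fun i => vP (x i).
exists (fun t => c (enum_val t).1 (enum_val t).2).
rewrite -(sum_enum_val (fun t : T => c t.1 t.2 *:
  [ffun i => if i == t.1 then v t.2 else 0])) /=.
apply/ffunP => i; rewrite -(pair_bigA _ (fun t1 t2 => c t1 t2 *:
  [ffun i => if i == t1 then v t2 else 0])) /= sum_ffunE (bigD1 i) //=.
rewrite [X in _ + X]big1 ?addr0 => [|j /negPf ji].
  by rewrite sum_ffunE {1}(cP i); apply: eq_bigr => j _; rewrite !ffunE eqxx.
by rewrite sum_ffunE big1 // => l _; rewrite !ffunE eq_sym ji scaler0.
Qed.

Lemma theta_wedge_power (M : lmodType S) r (fM : finitely_generated M)
    (fP : finitely_generated {ffun 'I_r -> M}) (c : R) :
  theta_eq (D := theta_wedge S) [:: (c, FgModule fP)] [:: (c * r%:R, FgModule fM)].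
Proof.
elim: r fP => [|r IHr] fP.
  apply: theta_trans (theta_eq_zero wedge_zero_sum c _) _.
    by move=> x; apply/ffunP => -[].
  by rewrite mulr0; exact/theta_sym/theta_scale0.
have fPr : finitely_generated {ffun 'I_r -> M} by exact: ffun_finitely_generated.
have sumP : @is_sum (theta_wedge S) (FgModule fP) (FgModule fM) (FgModule fPr).
  by exists (@ffun_split M r : {linear _ -> _}); exact: ffun_split_bij.
apply: theta_trans (theta_sum c sumP) _.
apply: theta_trans (theta_eq_catl [:: _] (IHr fPr)) _.
rewrite -[r.+1]add1n natrD mulrDr mulr1; exact/theta_sym/theta_scaleD.
Qed.

End WedgeSums.

(** * Graded modules *)

Section GradingProjections.
Variables (I : eqType) (V : zmodType) (c : I -> set V).
Hypothesis gr : is_grading c.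

Let csub i : is_add_subgroup (c i) := grading_subgroup gr i.

Lemma big_uniq_extend (s u : seq I) (x : I -> V) : uniq s -> uniq u ->
  {subset s <= u} -> (forall i, i \notin s -> x i = 0) ->
  \sum_(i <- s) x i = \sum_(i <- u) x i.
Proof.
move=> us uu su x0; rewrite [RHS](bigID (mem s)) /= [X in _ + X]big1 ?addr0 //.
rewrite -[RHS]big_filter; apply: perm_big; apply: uniq_perm => // [|i].
  exact: filter_uniq.
by rewrite mem_filter andb_idr //; exact: su.
Qed.

Lemma grading_unique (s t : seq I) (x y : I -> V) : uniq s -> uniq t ->
  (forall i, c i (x i)) -> (forall i, c i (y i)) ->
  (forall i, i \notin s -> x i = 0) -> (forall i, i \notin t -> y i = 0) ->
  \sum_(i <- s) x i = \sum_(i <- t) y i -> x =1 y.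
Proof.
move=> us ut cx cy x0 y0 E i; pose u := undup (s ++ t).
have uu : uniq u := undup_uniq _.
have [iu|iu] := boolP (i \in u); last first.
  by move: iu; rewrite mem_undup mem_cat negb_or => /andP[/x0 -> /y0 ->].
apply/eqP; rewrite -subr_eq0; apply/eqP.
apply: (grading_indep gr (s := u) (x := fun i => x i - y i)) => // [j|].
  exact: (csub j).2.
rewrite sumrB -(big_uniq_extend us uu _ x0) => [|j js]; last first.
  by rewrite mem_undup mem_cat js.
rewrite -(big_uniq_extend ut uu _ y0) ?E ?subrr // => j jt.
by rewrite mem_undup mem_cat jt orbT.
Qed.

Lemma grading_span_choice : exists sx : V -> seq I * (I -> V), forall v,
  [/\ uniq (sx v).1, forall i, c i ((sx v).2 i),
    forall i, i \notin (sx v).1 -> (sx v).2 i = 0 &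
    v = \sum_(i <- (sx v).1) (sx v).2 i].
Proof.
suff /choice [f fP] : forall v, exists sx : seq I * (I -> V),
    [/\ uniq sx.1, forall i, c i (sx.2 i),
      forall i, i \notin sx.1 -> sx.2 i = 0 & v = \sum_(i <- sx.1) sx.2 i].
  by exists f.
(* The family is reset to 0 off the list s, so that [gr_proj] is the true homogeneous component in
   every degree. *)
move=> v; have [s [x [us cx ->]]] := grading_span gr v.
exists (s, fun i => if i \in s then x i else 0); split=> //= [i|i /negPf -> //|].
  by case: ifP => // _; exact: (csub i).1.
by rewrite big_seq [RHS]big_seq; apply: eq_bigr => i ->.
Qed.

Definition gr_supp v := (sval (cid grading_span_choice) v).1.
Definition gr_proj i v := (sval (cid grading_span_choice) v).2 i.

Lemma gr_suppP v : uniq (gr_supp v).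
Proof. by rewrite /gr_supp; case: cid => sx /= /(_ v)[]. Qed.

Lemma gr_projP i v : c i (gr_proj i v).
Proof. by rewrite /gr_proj; case: cid => sx /= /(_ v)[]. Qed.

Lemma gr_proj_out i v : i \notin gr_supp v -> gr_proj i v = 0.
Proof. by rewrite /gr_proj /gr_supp; case: cid => sx /= /(_ v)[? ? H _] /H. Qed.

Lemma gr_sum v : v = \sum_(i <- gr_supp v) gr_proj i v.
Proof. by rewrite /gr_proj /gr_supp; case: cid => sx /= /(_ v)[]. Qed.

Lemma gr_proj_unique v (s : seq I) (x : I -> V) i : uniq s ->
  (forall i, c i (x i)) -> (forall i, i \notin s -> x i = 0) ->
  v = \sum_(i <- s) x i -> gr_proj i v = x i.
Proof.
move=> us cx x0 vE; have := gr_projP ^~ v; have := gr_proj_out (v := v).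
move=> p0 pc; apply: (grading_unique (gr_suppP v) us) => //.
by rewrite -gr_sum.
Qed.

Lemma gr_proj_hom i j x : c i x -> gr_proj j x = if j == i then x else 0.
Proof.
move=> cx; apply: (@gr_proj_unique x [:: i] (fun j => if j == i then x else 0)).
- by [].
- by move=> l; case: eqP => [->|_] //; exact: (csub l).1.
- by move=> l; rewrite inE => /negPf ->.
- by rewrite big_seq1 eqxx.
Qed.

Lemma gr_projB i v w : gr_proj i (v - w) = gr_proj i v - gr_proj i w.
Proof.
pose u := undup (gr_supp v ++ gr_supp w).
have uu : uniq u := undup_uniq _.
have vu : {subset gr_supp v <= u}.
  by move=> j jv; rewrite mem_undup mem_cat jv.
have wu : {subset gr_supp w <= u}.
  by move=> j jv; rewrite mem_undup mem_cat jv orbT.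
apply: (@gr_proj_unique _ u (fun i => gr_proj i v - gr_proj i w)) => // [j|j ju|].
- by apply: (csub j).2; exact: gr_projP.
- have -> : gr_proj j v = 0 by apply: gr_proj_out; apply: contra ju => /vu.
  by rewrite gr_proj_out ?subr0 //; apply: contra ju => /wu.
- rewrite sumrB {1}(gr_sum v) {1}(gr_sum w); congr (_ - _).
    by apply: big_uniq_extend => // [|j]; [exact: gr_suppP | exact: gr_proj_out].
  by apply: big_uniq_extend => // [|j]; [exact: gr_suppP | exact: gr_proj_out].
Qed.

Lemma gr_proj0 i : gr_proj i 0 = 0.
Proof. by have := gr_projB i 0 0; rewrite !subrr. Qed.

Lemma gr_projD i v w : gr_proj i (v + w) = gr_proj i v + gr_proj i w.
Proof. by rewrite -{1}[w]opprK gr_projB -[- w]sub0r gr_projB gr_proj0 sub0r opprK. Qed.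

Lemma gr_proj_sum i T (s : seq T) P (F : T -> V) :
  gr_proj i (\sum_(t <- s | P t) F t) = \sum_(t <- s | P t) gr_proj i (F t).
Proof. by apply: big_morph; [exact: gr_projD | exact: gr_proj0]. Qed.

End GradingProjections.

Section GradedModules.
Variables (G : finGroupType) (R : comNzRingType) (a : ring_action G R).
Variables (k : fieldType) (iota : {rmorphism k -> R}) (eps : {rmorphism R -> k}).
Hypothesis iotaK : cancel iota eps.
Hypothesis eps_act : forall g b, eps (a g b) = eps b.
Variable gr : ring_grading R.
Hypothesis gr_act : forall n g r, gr n r -> gr n (a g r).
Hypothesis gr_pos : forall n b, (0 < n)%N -> gr n b -> eps b = 0.
Hypothesis gr_0 : forall b, gr 0%N b -> b = iota (eps b).
Local Notation S := (twisted a).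
Local Notation grS := (tw_grading gr_act).

Lemma tw_const_comp n b : gr n b -> grS n (tw_const a b).
Proof.
move=> gb g; rewrite tw_monoE; case: eqP => // _.
exact: (grading_subgroup (rcomp_grading gr) n).1.
Qed.

Lemma tw_mono_comp g : grS 0%N (tw_mono a 1 g).
Proof.
move=> h; rewrite tw_monoE; case: eqP => // _; first exact: rcomp1.
exact: (grading_subgroup (rcomp_grading gr) 0%N).1.
Qed.

(* The ideal S_+ of S = B * G. *)
Definition tw_pos : set S :=
  add_span [set t | exists2 n, (0 < n)%N & grS n t]%classic.

(** The component of degree 0 is the constant [eps b], since [eps] kills positive degrees and degree
    0 consists of constants; what is left has positive degree. *)
Lemma gr_supp_pos b : eps b = 0 -> exists (s : seq nat) (x : nat -> R),
  [/\ forall n, n \in s -> (0 < n)%N, forall n, gr n (x n) &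
    b = \sum_(n <- s) x n].
Proof.
move=> b0; pose H := rcomp_grading gr.
exists [seq n <- gr_supp H b | (0 < n)%N], (fun n => gr_proj H n b).
split=> [n|n|]; first by rewrite mem_filter => /andP[].
  exact: gr_projP.
rewrite {1}(gr_sum H b) (bigID (fun n => (0 < n)%N)) /= big_filter.
rewrite [X in _ + X]big1 ?addr0 // => -[|//] _.
suff p0 : eps (gr_proj H 0%N b) = 0.
  by rewrite [LHS](gr_0 (gr_projP H 0%N b)) p0 rmorph0.
rewrite -b0 [in RHS](gr_sum H b) rmorph_sum /=.
have [s0|s0] := boolP (0%N \in gr_supp H b).
  rewrite (bigD1_seq 0%N) ?gr_suppP //= big1 ?addr0 // => n n0.
  by apply: gr_pos (gr_projP _ _ _); rewrite lt0n.
rewrite (gr_proj_out s0) rmorph0 big_seq big1 // => -[sn|n _].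
  by rewrite sn in s0.
exact: gr_pos (gr_projP _ _ _).
Qed.

Lemma tw_const_pos b : eps b = 0 -> tw_pos (tw_const a b).
Proof.
move=> /gr_supp_pos [s [x [s0 gx ->]]]; rewrite rmorph_sum.
apply: (add_subgroup_sum (add_span_subgroup _)) => n ns _.
by apply: add_span_gen; exists n; [exact: s0 | exact: tw_const_comp].
Qed.

Lemma tw_pos_mul s t : tw_pos t -> tw_pos (s * t).
Proof.
elim=> [{}t [n n0 gt]||y z _ Hy _ Hz].
- rewrite (gr_sum (rcomp_grading grS) s) mulr_suml.
  apply: (add_subgroup_sum (add_span_subgroup _)) => m _ _.
  apply: add_span_gen; exists (m + n)%N; first by rewrite addn_gt0 n0 orbT.
  exact: rcompM (gr_projP _ _ _) gt.
- by rewrite mulr0; exact: add_span0.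
- by rewrite mulrBr; exact: add_spanB.
Qed.

Lemma tw_pos_decomp s : exists b t, [/\ grS 0%N b, tw_pos t & s = b + t].
Proof.
pose H := rcomp_grading grS.
exists (gr_proj H 0%N s), (\sum_(n <- gr_supp H s | n != 0%N) gr_proj H n s).
split; first exact: gr_projP.
  apply: (add_subgroup_sum (add_span_subgroup _)) => n _ n0.
  apply: add_span_gen; exists n; first by rewrite lt0n.
  exact: gr_projP.
rewrite {1}(gr_sum H s); have [s0|s0] := boolP (0%N \in gr_supp H s).
  by rewrite (bigD1_seq 0%N) ?gr_suppP.
rewrite (gr_proj_out s0) add0r big_seq [RHS]big_seq_cond; apply: eq_bigl => n.
by case: eqP => [->|_]; rewrite ?andbT // (negPf s0).
Qed.

Section OneModule.
Variable M : graded_module grS.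
Implicit Types x : M.
Local Notation pr := (gr_proj (@gcomp_grading _ _ M)).
Local Notation supp := (gr_supp (@gcomp_grading _ _ M)).

Lemma gcomp0 lam : @gcomp _ _ M lam 0.
Proof. exact: (grading_subgroup (@gcomp_grading _ _ M) lam).1. Qed.

Lemma gcomp_sum lam (I : eqType) (s : seq I) (P : pred I) (F : I -> M) :
  (forall i, i \in s -> P i -> @gcomp _ _ M lam (F i)) ->
  @gcomp _ _ M lam (\sum_(i <- s | P i) F i).
Proof.
exact: add_subgroup_sum (grading_subgroup (@gcomp_grading _ _ M) lam) _ _ _ _.
Qed.

Lemma gr_projZ n s x lam : grS n s -> pr (n%:R + lam) (s *: x) = s *: pr lam x.
Proof.
move=> gs; rewrite {1}(gr_sum (@gcomp_grading _ _ M) x) scaler_sumr gr_proj_sum.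
have E mu : pr (n%:R + lam) (s *: pr mu x) =
    if mu == lam then s *: pr lam x else 0.
  rewrite (gr_proj_hom _ _ (gcompZ gs (gr_projP _ _ _))) (inj_eq (addrI _)) eq_sym.
  by case: eqP => [->|].
under eq_bigr do rewrite E.
have [sl|sl] := boolP (lam \in supp x).
  rewrite (bigD1_seq lam) ?gr_suppP //= eqxx big1 ?addr0 // => mu /negPf -> //.
rewrite (gr_proj_out sl) scaler0 big_seq big1 // => mu smu.
by case: eqP => // mul; rewrite -mul smu in sl.
Qed.

Definition degrees_in (L : rat -> Prop) : set M :=
  [set x | forall lam, pr lam x <> 0 -> L lam]%classic.

Lemma degrees_in_subgroup L : is_add_subgroup (degrees_in L).
Proof.
split=> [lam|x y Lx Ly lam]; first by rewrite gr_proj0.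
rewrite gr_projB => H; apply: contrapT => nL.
have x0 : pr lam x = 0 by apply: contrapT => /Lx.
have y0 : pr lam y = 0 by apply: contrapT => /Ly.
by apply: H; rewrite x0 y0 subrr.
Qed.

Lemma degrees_inZ (L L' : rat -> Prop) (n : nat) s x : grS n s ->
  degrees_in L x -> (forall lam, L lam -> L' (n%:R + lam)) ->
  degrees_in L' (s *: x).
Proof.
move=> gs Lx LL' lam; have -> : lam = n%:R + (lam - n%:R) by rewrite addrC subrK.
rewrite (gr_projZ _ _ gs) => H; apply: LL'; apply: Lx => px.
by apply: H; rewrite px scaler0.
Qed.

(** S has no negative degrees, so the least degree of a nonzero component of a generator bounds all
    degrees of M from below, and that component attains it. *)
Lemma degree_bound : finitely_generated M -> ~ (forall x, x = 0) ->
  exists mu, (forall x, degrees_in (fun lam => mu <= lam) x) /\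
    exists2 x, x <> 0 & @gcomp _ _ M mu x.
Proof.
move=> [r [v vP]] M0.
pose L := flatten [seq [seq lam <- supp (v i) | pr lam (v i) != 0] | i <- enum 'I_r].
have LP lam : lam \in L -> exists i, pr lam (v i) != 0.
  by move=> /flattenP[_ /mapP[i _ ->]]; rewrite mem_filter => /andP[? _]; exists i.
have LI lam i : pr lam (v i) != 0 -> lam \in L.
  move=> p0; apply/flattenP; exists [seq lam <- supp (v i) | pr lam (v i) != 0].
    by apply: map_f; rewrite mem_enum.
  rewrite mem_filter p0; apply: contraT => /gr_proj_out p0'.
  by rewrite p0' eqxx in p0.
have [mu muL muP] : exists2 mu, mu \in L & forall lam, lam \in L -> mu <= lam.
  have : L != [::].
    apply/negP => /eqP L0; apply: M0 => x; have [c ->] := vP x.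
    apply: big1 => i _; rewrite (gr_sum (@gcomp_grading _ _ M) (v i)) big1 ?scaler0 //.
    move=> lam _; apply/eqP; apply: contraT => /LI.
    by rewrite L0.
  elim: (L) => // l0 s IHs _; have [s0|/IHs [mu mus muP]] := eqVneq s [::].
    by exists l0; rewrite s0 ?mem_head // => lam; rewrite inE => /eqP ->.
  have [lm|/ltW ml] := leP l0 mu.
    exists l0; first exact: mem_head.
    by move=> lam; rewrite inE => /predU1P[->//|/muP]; exact: le_trans.
  exists mu; first by rewrite inE mus orbT.
  by move=> lam; rewrite inE => /predU1P[->|/muP].
exists mu; split; last first.
  have [i pi] := LP _ muL; exists (pr mu (v i)); first exact/eqP.
  exact: gr_projP.
move=> x; have [c ->] := vP x.
apply: (add_subgroup_sum (degrees_in_subgroup _)) => i _ _.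
rewrite (gr_sum (rcomp_grading grS) (c i)) scaler_suml.
apply: (add_subgroup_sum (degrees_in_subgroup _)) => n _ _.
apply: (degrees_inZ (L := fun lam => mu <= lam) (gr_projP _ _ _)) => [lam pl|lam].
  by apply: muP; apply: (LI _ i); exact/eqP.
by move=> /le_trans; apply; rewrite lerDr ler0n.
Qed.

(** Graded Nakayama: S_+ M has components only in degrees above the least degree mu, so a nonzero
    element of degree mu lies outside it. *)
Lemma tw_pos_proper : finitely_generated M -> ~ (forall x, x = 0) ->
  exists x, ~ @ideal_mul S M tw_pos x.
Proof.
move=> fM M0; have [mu [mu_le [x x0 mx]]] := degree_bound fM M0.
exists x => Px; apply: x0.
suff H : degrees_in (fun lam => mu < lam) x.
  apply: contrapT => x0; have := H mu.
  by rewrite (gr_proj_hom _ _ mx) eqxx ltxx => /(_ x0).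
elim: Px => [_ [s [y [ps ->]]]||y z _ Hy _ Hz]; last 2 first.
- exact: (degrees_in_subgroup _).1.
- exact: (degrees_in_subgroup _).2.
elim: ps => [{}s [n n0 gs]||t u _ Ht _ Hu].
- apply: (degrees_inZ gs (mu_le y)) => lam ml.
  by apply: le_lt_trans ml _; rewrite ltrDr ltr0n.
- by rewrite scale0r; exact: (degrees_in_subgroup _).1.
- by rewrite scalerBl; exact: (degrees_in_subgroup _).2.
Qed.

Lemma tw_pos_submodule : is_submodule (@ideal_mul S M tw_pos).
Proof.
split; first exact: add_span_subgroup.
move=> s x; elim=> [_ [t [y [pt ->]]]||y z _ Hy _ Hz].
- rewrite scalerA; apply: add_span_gen; exists (s * t), y.
  by split=> //; exact: tw_pos_mul.
- by rewrite scaler0; exact: add_span0.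
- by rewrite scalerBr; exact: add_spanB.
Qed.

Lemma aug_mul_tw_pos : (aug_mul eps (M := M) `<=` @ideal_mul S M tw_pos)%classic.
Proof.
apply: add_span_min; first exact: add_span_subgroup.
move=> _ [b [x [b0 ->]]]; apply: add_span_gen.
by exists (tw_const a b), x; split=> //; exact: tw_const_pos.
Qed.

Lemma tw_pos_radical :
  (@ideal_mul S M tw_pos `<=` @ideal_mul S M (graded_radical grS))%classic.
Proof.
apply: add_span_min; first exact: add_span_subgroup.
move=> _ [t [x [pt ->]]]; apply: add_span_gen; exists t, x; split=> //.
exists t, 0; split=> //; last by rewrite addr0.
split; first exact: (grading_subgroup (rcomp_grading grS) 0%N).1.
by move=> I [[_ sI _] _ _]; exact: sI.1.
Qed.

End OneModule.

Lemma circ_top_le (M : tobj (theta_circ grS)) l (I : finType) (v : I -> M) :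
  (forall x, exists c : I -> R, x = \sum_i tw_const a (c i) *: v i) ->
  top_length M l -> (l <= #|I|)%N.
Proof.
move=> vP [[C lC] _]; apply: (aug_chain_le iotaK) vP _ _ lC.
exact: subset_trans (@aug_mul_tw_pos M) (@tw_pos_radical M).
Qed.

Lemma circ_top_exists (M : tobj (theta_circ grS)) : exists l, top_length M l.
Proof.
have [r [v vP]] := underlying_generated (fg_gmodP M).
apply: (@length_exists _ _ _ #|'I_r|); apply: (aug_chain_le iotaK) vP.
exact: subset_trans (@aug_mul_tw_pos M) (@tw_pos_radical M).
Qed.

Lemma circ_top_sum (M M1 M2 : tobj (theta_circ grS)) l l1 l2 : is_sum M M1 M2 ->
  top_length M l -> top_length M1 l1 -> top_length M2 l2 -> (l1 + l2 <= l)%N.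
Proof. by move=> [h h_bij _]; exact: length_sum h_bij. Qed.

Lemma circ_top_gt0 (M : tobj (theta_circ grS)) l : ~ is_zero M ->
  top_length M l -> (0 < l)%N.
Proof.
move=> M0 Ml; have [r [v vP]] := underlying_generated (fg_gmodP M).
have [Q mQ Qmax] := maximal_submodule_exists (@tw_pos_submodule M)
  (tw_pos_proper (fg_gmodP M) M0) (aug_chain_le iotaK (@aug_mul_tw_pos M) vP).
have [[sQ QZ] nQ _] := Qmax.
apply: (length_gt0 (Q := Q)) Ml => //.
have posQ (t : S) (x : M) : tw_pos t -> Q (t *: x).
  by move=> pt; apply: mQ; apply: add_span_gen; exists t, x.
apply: add_span_min => // _ [_ [x [[y [z [py Jz ->]]] ->]]].
rewrite scalerDl; apply: add_subgroupD => //; first exact: posQ.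
(* The radical in question is that of S_0 alone, so S_+ serves as [nn]: S = S_0 + S_+, and S_+ M is
   already contained in Q. *)
apply: (jacobson_maximal_submodule (A := grS 0%N) (nn := tw_pos)) Jz => //.
- exact: (grading_subgroup (rcomp_grading grS) 0%N).
- exact: rcomp1.
- by move=> s t gs gt; exact: (rcompM gs gt).
- exact: tw_pos_decomp.
Qed.

End GradedModules.

(** * Direct sums of shifts and their classes *)

Section GradedPower.
Variables (S : nzRingType) (gr : ring_grading S).

Section Power.
Variables (M : graded_module gr) (r : nat) (lam : 'I_r -> rat).

Definition gpow_comp (mu : rat) : set {ffun 'I_r -> M} :=
  [set f | forall i, @gcomp _ _ M (lam i + mu) (f i)]%classic.

Lemma gpow_grading : is_grading gpow_comp.
Proof.
pose H := @gcomp_grading _ _ M; have sub mu := grading_subgroup H mu.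
split=> [mu|f|s x us cx sx0 mu mus].
- split=> [i|f g cf cg i]; rewrite !ffunE; first exact: (sub _).1.
  exact: (sub _).2.
- pose K := undup (flatten [seq [seq nu - lam i | nu <- gr_supp H (f i)]
                           | i <- enum 'I_r]).
  exists K, (fun mu => [ffun i => gr_proj H (lam i + mu) (f i)]).
  split=> [|mu i|]; first exact: undup_uniq.
    by rewrite ffunE; exact: gr_projP.
  apply/ffunP => i; rewrite sum_ffunE.
  under eq_bigr do rewrite ffunE.
  rewrite -(big_map (fun mu => lam i + mu) xpredT (gr_proj H ^~ (f i))).
  rewrite {1}(gr_sum H (f i)); apply: big_uniq_extend => [|||j].
  + exact: gr_suppP.
  + by rewrite map_inj_uniq ?undup_uniq //; exact: addrI.
  + move=> nu nuf; apply/mapP; exists (nu - lam i); last by rewrite addrC subrK.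
    rewrite mem_undup; apply/flattenP.
    exists [seq nu - lam i | nu <- gr_supp H (f i)]; last exact: map_f.
    by apply: map_f; rewrite mem_enum.
  + exact: gr_proj_out.
- apply/ffunP => i; rewrite ffunE -[mu](addKr (lam i)) addrC.
  apply: (grading_indep H (s := [seq lam i + nu | nu <- s])
    (x := fun nu => x (nu - lam i) i)) => [|nu||].
  + by rewrite map_inj_uniq //; exact: addrI.
  + by have := cx (nu - lam i) i; rewrite addrC subrK.
  + rewrite big_map; have /ffunP/(_ i) := sx0; rewrite sum_ffunE ffunE => s0.
    by rewrite -[RHS]s0; apply: eq_bigr => nu _; rewrite addrC addKr.
  + by apply/mapP; exists mu => //; rewrite addrC subrK addrC.
Qed.

Lemma gpow_compZ n mu s (f : {ffun 'I_r -> M}) : gr n s -> gpow_comp mu f ->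
  gpow_comp (n%:R + mu) (s *: f).
Proof. by move=> gs cf i; rewrite ffunE addrCA; exact: gcompZ. Qed.

(* The direct sum of the shifts M[lam i]. *)
Definition gpow : graded_module gr := GradedModule gpow_grading gpow_compZ.

End Power.

Lemma circ_zero_sum (M : tobj (theta_circ gr)) : is_zero M -> is_sum M M M.
Proof.
move=> M0; pose h (x : M) : (M * M)%type := (x, x).
have hB : zmod_morphism h by [].
have hZ : scalable h by [].
exists (HB.pack_for {linear M -> (M * M)%type} h
  (GRing.isZmodMorphism.Build _ _ _ hB) (GRing.isScalable.Build _ _ _ _ _ hZ)).
  exists fst => [x|[x y]] //=.
  by rewrite /h (M0 x) (M0 y).
by move=> lam x; split=> [|[]].
Qed.

Variable R : realType.

Lemma theta_shift (M : graded_module gr) lam (fM : finitely_generated M) (c : R) :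
  theta_eq (D := theta_circ gr)
    [:: (c, @FgGradedModule _ _ (gshift M lam) fM)] [:: (c, FgGradedModule fM)].
Proof.
apply/theta_sym/theta_classes; exists lam.
exists (idfun : {linear M -> M}); first by exists id.
by [].
Qed.

Lemma theta_circ_power (M : graded_module gr) r (lam : 'I_r -> rat)
    (fM : finitely_generated M) (fP : finitely_generated (gpow M lam)) (c : R) :
  theta_eq (D := theta_circ gr)
    [:: (c, FgGradedModule fP)] [:: (c * r%:R, FgGradedModule fM)].
Proof.
elim: r lam fP => [|r IHr] lam fP.
  apply: theta_trans (theta_eq_zero circ_zero_sum c _) _.
    by move=> x; apply/ffunP => -[].
  by rewrite mulr0; exact/theta_sym/theta_scale0.
have fPr : finitely_generated (gpow M (lam \o lift ord0)).
  exact: ffun_finitely_generated.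
have sumP : @is_sum (theta_circ gr) (FgGradedModule fP)
    (@FgGradedModule _ _ (gshift M (lam ord0)) fM) (FgGradedModule fPr).
  exists (@ffun_split _ M r : {linear _ -> _}); first exact: ffun_split_bij.
  move=> mu x; split=> [cx|[cx0 cx] i].
    by split=> [|i]; rewrite /= ?ffunE; exact: cx.
  case: (unliftP ord0 i) => [j|] ->; last exact: cx0.
  by have := cx j; rewrite /= ffunE.
apply: theta_trans (theta_sum c sumP) _.
apply: theta_trans (theta_eq_catl [:: _] (IHr _ fPr)) _.
apply: theta_trans (theta_eq_catr [:: _] (theta_shift _ fM c)) _.
rewrite -[r.+1]add1n natrD mulrDr mulr1; exact/theta_sym/theta_scaleD.
Qed.

End GradedPower.

(** * Homogeneous bases and graded lifting of generators *)

Section HomogeneousBases.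
Variables (G : finGroupType) (R : comNzRingType) (a : ring_action G R).
Variables (k : fieldType) (iota : {rmorphism k -> R}) (eps : {rmorphism R -> k}).
Hypothesis iotaK : cancel iota eps.
Variable gr : ring_grading R.
Hypothesis gr_act : forall n g r, gr n r -> gr n (a g r).
Hypothesis gr_pos : forall n b, (0 < n)%N -> gr n b -> eps b = 0.
Hypothesis gr_0 : forall b, gr 0%N b -> b = iota (eps b).
Local Notation S := (twisted a).
Local Notation grS := (tw_grading gr_act).
Local Notation prR := (gr_proj (regular_grading gr)).

(** R is given rational degrees through [regular_comp], so that a difference of degrees of module
    elements, possibly fractional or negative, indexes a component of R. *)
Lemma gcomp_scale (M : graded_module grS) nu d b (x : M) :
  regular_comp gr nu b -> gcomp d x -> gcomp (nu + d) (tw_const a b *: x).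
Proof.
move=> [-> _|[n -> gb] dx]; first by rewrite rmorph0 scale0r; exact: gcomp0.
by apply: gcompZ => //; exact: tw_const_comp.
Qed.

Lemma gr_proj_scale (M : graded_module grS) lam d b (x : M) : gcomp d x ->
  gr_proj (@gcomp_grading _ _ M) lam (tw_const a b *: x) =
  tw_const a (prR (lam - d) b) *: x.
Proof.
move=> dx; set H := regular_grading gr.
rewrite {1}(gr_sum H b) rmorph_sum scaler_suml gr_proj_sum.
have E nu : gr_proj (@gcomp_grading _ _ M) lam (tw_const a (prR nu b) *: x) =
    if nu == lam - d then tw_const a (prR (lam - d) b) *: x else 0.
  rewrite (gr_proj_hom _ _ (gcomp_scale (gr_projP H nu b) dx)).
  by rewrite -subr_eq eq_sym; case: eqP => [->|].
under eq_bigr do rewrite E.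
have [sl|sl] := boolP (lam - d \in gr_supp H b).
  by rewrite (bigD1_seq (lam - d)) ?gr_suppP //= eqxx big1 ?addr0 // => mu /negPf ->.
rewrite (gr_proj_out sl) rmorph0 scale0r big_seq big1 // => mu smu.
by case: eqP => // mul; rewrite -mul smu in sl.
Qed.

Lemma eps_regular nu b : nu != 0 -> regular_comp gr nu b -> eps b = 0.
Proof.
move=> nu0 [->|[n En gb]]; first exact: rmorph0.
by apply: (gr_pos (n := n)) => //; rewrite lt0n; apply: contra nu0 => /eqP n0; rewrite En n0.
Qed.

(** Components in negative degrees vanish, and the one in degree 0 is the constant [eps b]. *)
Lemma prR_nonpos nu b : eps b = 0 -> ~~ (0 < nu) -> prR nu b = 0.
Proof.
move=> b0 nu0; set H := regular_grading gr.
have [//|[n En gb]] := gr_projP H nu b.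
have n0 : n = 0%N by move: nu0; rewrite En ltr0n lt0n negbK => /eqP.
move: En gb; rewrite n0 => -> g0; rewrite [LHS](gr_0 g0).
suff -> : eps (prR 0 b) = 0 by rewrite rmorph0.
rewrite -b0 [in RHS](gr_sum H b) rmorph_sum /=.
have [s0|s0] := boolP (0 \in gr_supp H b).
  rewrite (bigD1_seq 0) ?gr_suppP //= big1 ?addr0 // => mu mu0.
  exact: eps_regular (gr_projP _ _ _).
rewrite (gr_proj_out s0) rmorph0 big_seq big1 // => mu smu.
apply: eps_regular (gr_projP _ _ _); apply: contraNneq s0 => <-.
exact: smu.
Qed.

Section Basis.
Variables (M : graded_module grS) (I : finType).
Variables (z : I -> M) (co : M -> I -> R) (dz : I -> rat).
Hypothesis z_basis : free_basis (z : I -> underlying M) co.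
Hypothesis z_hom : forall i, gcomp (dz i) (z i).

Lemma coord_homogeneous lam m i : gcomp lam m ->
  regular_comp gr (lam - dz i) (co m i).
Proof.
move=> mlam; set H := regular_grading gr.
have E : m = \sum_j prR (lam - dz j) (co m j) *: (z j : underlying M).
  have := gr_proj_hom (@gcomp_grading _ _ M) lam mlam; rewrite eqxx => {1}<-.
  rewrite {1}(basis_sum z_basis m) gr_proj_sum.
  by apply: eq_bigr => j _; rewrite !underlyingE (gr_proj_scale _ _ (z_hom j)).
by rewrite E (coordK z_basis); exact: gr_projP.
Qed.

End Basis.

(* B is not local: it is homogeneity that lets elements which generate M modulo
   the augmentation ideal generate M. *)
Lemma homogeneous_basis (M : graded_module grS) (I0 Y Z : finType)
    (y0 : I0 -> M) co0 (y : Y -> M) (dy : Y -> rat) (z : Z -> M) (dz : Z -> rat) :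
  free_basis (y0 : I0 -> underlying M) co0 ->
  (forall i, gcomp (dy i) (y i)) -> (forall i, gcomp (dz i) (z i)) ->
  (forall x : M, exists c : Y -> R, x = \sum_i tw_const a (c i) *: y i) ->
  #|Z| = #|I0| ->
  (forall j, exists c : Z -> k, forall i,
     eps (co0 (y j) i) = \sum_l c l * eps (co0 (z l) i)) ->
  exists co, free_basis (z : Z -> underlying M) co.
Proof.
move=> b0 y_hom z_hom yP ZI0 zP.
pose H : set M := [set x | exists c : Z -> R, x = \sum_l tw_const a (c l) *: z l]%classic.
have sH : is_add_subgroup H.
  split; first by exists (fun=> 0); rewrite big1 // => l _; rewrite rmorph0 scale0r.
  move=> _ _ [c ->] [c' ->]; exists (fun l => c l - c' l).
  by rewrite -sumrB; apply: eq_bigr => l _; rewrite rmorphB scalerBl.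
have HZ b x : H x -> H (tw_const a b *: x).
  move=> [c ->]; exists (fun l => b * c l); rewrite scaler_sumr.
  by apply: eq_bigr => l _; rewrite scalerA rmorphM.
pose pr := gr_proj (@gcomp_grading _ _ M).
have Hpr lam x : H x -> H (pr lam x).
  move=> [c ->]; exists (fun l => prR (lam - dz l) (c l)).
  by rewrite /pr gr_proj_sum; apply: eq_bigr => l _; exact: gr_proj_scale.
(* The approximation h agrees with y j modulo the kernel of [eps]. In degree [dy j] the error
   involves only those y i whose degree is strictly smaller, and they lie in H by induction on the
   number of such i. *)
have Hy j : H (y j).
  have [n] := ubnP #|[set i | dy i < dy j]|; elim: n j => // n IHn j jn.
  have [c cP] := zP j.
  pose h := \sum_l tw_const a (iota (c l)) *: z l.
  have Hh : H h by exists (fun l => iota (c l)).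
  have x0 i : eps (co0 (y j - h) i) = 0.
    have -> : co0 (y j - h) i = co0 (y j) i - \sum_l iota (c l) * co0 (z l) i.
      rewrite (coordB b0) (coord_sum b0); congr (_ - _).
      by apply: eq_bigr => l _; rewrite -(coordZ b0).
    rewrite rmorphB cP rmorph_sum -sumrB big1 // => l _.
    by rewrite rmorphM iotaK subrr.
  have /choice [d dP] := fun i => yP (y0 i).
  have Ex : y j = h + \sum_i tw_const a (\sum_l co0 (y j - h) l * d l i) *: y i.
    apply/eqP; rewrite addrC -subr_eq; apply/eqP.
    rewrite {1}(basis_sum b0 (y j - h)).
    under [RHS]eq_bigr do rewrite rmorph_sum scaler_suml.
    rewrite exchange_big; apply: eq_bigr => l _; rewrite underlyingE {1}(dP l).
    by rewrite scaler_sumr; apply: eq_bigr => i _; rewrite rmorphM scalerA.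
  have {Ex} : pr (dy j) (y j) = pr (dy j) h +
      \sum_i pr (dy j) (tw_const a (\sum_l co0 (y j - h) l * d l i) *: y i).
    have := congr1 (pr (dy j)) Ex; rewrite {2}/pr gr_projD => {1}->.
    by congr (_ + _); exact: gr_proj_sum.
  rewrite {1}/pr (gr_proj_hom _ _ (y_hom j)) eqxx => ->.
  apply: add_subgroupD => //; first exact: Hpr.
  apply: add_subgroup_sum => // i _ _; rewrite /pr (gr_proj_scale _ _ (y_hom i)).
  have [dij|dij] := boolP (0 < dy j - dy i).
    apply: HZ; apply: IHn; rewrite -ltnS; apply: leq_trans jn; rewrite ltnS.
    apply: proper_card; apply/properP; split.
      apply/fintype.subsetP => l; rewrite !inE => li; apply: lt_trans li _.
      by rewrite -subr_gt0.
    by exists i; rewrite !inE ?ltxx // -subr_gt0.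
  rewrite prR_nonpos ?rmorph0 ?scale0r; [exact: sH.1| |exact: dij].
  by rewrite rmorph_sum big1 // => l _; rewrite rmorphM x0 mul0r.
apply: (basis_of_generators (M := underlying M) b0 ZI0) => i.
have [c ->] : H (y0 i); last by exists c.
have [c ->] := yP (y0 i); apply: add_subgroup_sum => // j _ _.
exact: HZ.
Qed.

End HomogeneousBases.

(** * The splitting of free orbits respects degrees *)

Section GradedSplit.
Variables (G : finGroupType) (R : comNzRingType) (a : ring_action G R).
Variable gr : ring_grading R.
Hypothesis gr_act : forall n g r, gr n r -> gr n (a g r).
Local Notation S := (twisted a).
Local Notation grS := (tw_grading gr_act).
Variables (M : graded_module grS) (r : nat) (I : finType) (x : 'I_r -> M).
Variables (z : ('I_r * G) + I -> M) (co : M -> ('I_r * G) + I -> R).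
Variable dz : ('I_r * G) + I -> rat.
Hypothesis z_basis : free_basis (z : _ -> underlying M) co.
Hypothesis z_orbit : forall u g, z (inl (u, g)) = gact g (x u).
Hypothesis z_hom : forall i, gcomp (dz i) (z i).

Let dx u := dz (inl (u, 1%g)).

Lemma orbit_hom u : gcomp (dx u) (x u).
Proof. by have := z_hom (inl (u, 1%g)); rewrite z_orbit gact1. Qed.

Lemma gact_hom lam g m : @gcomp _ _ M lam m -> gcomp lam (gact g m).
Proof.
by move=> cm; have := gcompZ (tw_mono_comp gr_act g) cm; rewrite add0r.
Qed.

Lemma split_coef_hom lam u m : @gcomp _ _ M lam m ->
  regular_comp grS (- dx u + lam) (split_coef co u m).
Proof.
move=> cm; have cog g := coord_homogeneous z_basis z_hom (inl (u, 1%g))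
  (gact_hom g^-1 cm).
(* All coefficients must share one degree n, so n is fixed before the individual coefficients are
   examined; if the difference is no natural number, every coefficient is 0. *)
rewrite addrC; have [[n En]|nn] := pselect (exists n, lam - dx u = n%:R).
  right; exists n => // g; rewrite ffunE; apply: gr_act.
  have [->|[m' Em gm]] := cog g.
    exact: (grading_subgroup (rcomp_grading gr) n).1.
  have -> // : n = m'.
  by rewrite -(nat_of_ratK n) -En /dx Em nat_of_ratK.
left; apply/ffunP => g; rewrite !ffunE.
by have [->|[n En _]] := cog g; [exact: rmorph0 | case: nn; exists n].
Qed.

Lemma scale_orbit_hom lam u s : regular_comp grS (- dx u + lam) s ->
  gcomp lam (s *: x u).
Proof.
move=> [->|[n En gs]]; first by rewrite scale0r; exact: gcomp0.
have -> : lam = n%:R + dx u by rewrite -En addrAC addNr add0r.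
exact: gcompZ gs (orbit_hom u).
Qed.

Lemma split_proj_hom lam m : @gcomp _ _ M lam m -> gcomp lam (split_proj x co m).
Proof.
move=> cm; apply: (grading_subgroup (@gcomp_grading _ _ M) lam).2 => //.
by apply: gcomp_sum => u _ _; apply/scale_orbit_hom/split_coef_hom.
Qed.

Local Notation N := (submod (split_kernel_submodule z_basis)).

Definition split_comp (mu : rat) : set N := [set n | gcomp mu (submod_val n)]%classic.

Lemma split_comp_grading : is_grading split_comp.
Proof.
pose H := @gcomp_grading _ _ M.
split=> [mu|n|s y us cy sy0 mu mus].
- split; first exact: gcomp0.
  by move=> n n' cn cn'; exact: (grading_subgroup H mu).2.
(* The components of n are pushed into the kernel by [split_proj]. The corrections add up to the
   correction of n itself, which vanishes. *)
- exists (gr_supp H (submod_val n)), (fun mu => Submod (submod_intro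
    (split_kernel_submodule z_basis)
    (split_proj_kernel z_basis z_orbit (gr_proj H mu (submod_val n))))).
  split=> [|mu|]; first exact: gr_suppP.
    by apply: split_proj_hom; exact: gr_projP.
  apply: val_inj; rewrite raddf_sum /=.
  have E m : split_proj x co m = m - \sum_u split_coef co u m *: x u by [].
  under eq_bigr do rewrite E.
  rewrite sumrB -(gr_sum H) exchange_big /= big1 ?subr0 // => u _.
  rewrite -scaler_suml -(split_coef_sum z_basis) -(gr_sum H).
  by rewrite (submodP n u) scale0r.
- suff y0 : submod_val (y mu) = 0 by apply: val_inj; rewrite raddf0.
  apply: (grading_indep H (x := fun mu => submod_val (y mu)) us) => //.
  by have := congr1 val sy0; rewrite raddf_sum.
Qed.

Lemma split_compZ n mu s (y : N) : grS n s -> split_comp mu y ->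
  split_comp (n%:R + mu) (s *: y).
Proof. by move=> gs cy; exact: gcompZ. Qed.

Definition split_gmodule : graded_module grS :=
  GradedModule split_comp_grading split_compZ.

Lemma split_graded_iso : graded_iso_sum M
  (gpow (regular_module grS) (fun u => - dx u)) split_gmodule.
Proof.
exists (split_lmap z_basis z_orbit); first exact: split_map_bij.
move=> lam m; split=> [cm|[cm1 cm2]].
  split; last exact: split_proj_hom.
  by move=> u; rewrite ffunE; exact: split_coef_hom.
have -> : m = split_proj x co m + \sum_u split_coef co u m *: x u.
  by rewrite subrK.
apply: (add_subgroupD (grading_subgroup (@gcomp_grading _ _ M) lam)) => //.
apply: gcomp_sum => u _ _; apply: scale_orbit_hom.
by have := cm1 u; rewrite ffunE.
Qed.

End GradedSplit.

(** * Bases of orbits and bases over Frobenius powers *)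

Section Selection.
Variables (k : fieldType) (V : vectType k).

Lemma extend_free (I : eqType) (w : I -> V) (s0 s : seq I) :
  free (map w s0) -> exists s1, [/\ subseq s1 s, free (map w (s1 ++ s0)) &
    forall i, i \in s -> w i \in <<map w (s1 ++ s0)>>%VS].
Proof.
move=> fs0; elim: s => [|i s [s1 [ss1 fs1 sp]]]; first by exists [::].
have [wi|wi] := boolP (w i \in <<map w (s1 ++ s0)>>%VS).
  exists s1; split=> //; first exact: subseq_trans (subseq_cons _ _).
  by move=> j; rewrite inE => /predU1P[->|/sp].
exists (i :: s1); split; first by rewrite /= eqxx.
  by rewrite /= free_cons wi.
move=> j; rewrite inE /= span_cons => /predU1P[->|/sp wj].
  by rewrite memvE addvSl.
exact: (subvP (addvSr _ _)).
Qed.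

Lemma sub_free (I : eqType) (w : I -> V) (s t : seq I) : uniq t ->
  {subset t <= s} -> free (map w s) -> free (map w t).
Proof.
move=> ut ts fs; have us : uniq s := map_uniq (free_uniq fs).
have st : perm_eq s (t ++ [seq i <- s | i \notin t]).
  apply: uniq_perm => // [|i].
    rewrite cat_uniq ut filter_uniq // andbT; apply/hasPn => i.
    by rewrite mem_filter => /andP[].
  rewrite mem_cat mem_filter; case: (boolP (i \in t)) => //= it.
  by rewrite ts.
by move: fs; rewrite (perm_free (perm_map w st)) map_cat => /catl_free.
Qed.

Lemma span_coef (I : eqType) (w : I -> V) (s : seq I) v : uniq s ->
  v \in <<map w s>>%VS -> exists c : I -> k, v = \sum_(i <- s) c i *: w i.
Proof.
elim: s v => [|i s IHs] v /=.
  by rewrite span_nil memv0 => _ /eqP ->; exists (fun=> 0); rewrite big_nil.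
move=> /andP[ns us]; rewrite span_cons => /memv_addP[_ /vlineP[b ->] [v' /(IHs _ us)]].
move=> [c ->] ->; exists (fun j => if j == i then b else c j).
rewrite big_cons eqxx; congr (_ + _).
by apply: eq_big_seq => j js; case: eqP => // ji; rewrite -ji js in ns.
Qed.

(** Steinitz exchange: [K'] consists of the indices of [wK] that a greedy extension of w retains. *)
Lemma complete_basis (I K : finType) (w : I -> V) (wK : K -> V) :
  free (codom w) -> (forall v, v \in <<codom wK>>%VS) ->
  exists (K' : finType) (kappa : K' -> K), (#|I| + #|K'|)%N = \dim {:V} /\
    forall v, exists c : I + K' -> k,
      v = \sum_i c (inl i) *: w i + \sum_j c (inr j) *: wK (kappa j).
Proof.
rewrite codomE => fw spK; pose wIK (i : I + K) := match i with inl i => w i | inr j => wK j end.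
have fw' : free (map wIK (map inl (enum I))) by rewrite -map_comp.
have [s1 [ss1 fs1 sp]] := extend_free (map inr (enum K)) fw'.
pose K' := {j : K | inr j \in s1}.
exists K', val; set s := s1 ++ _ in fs1 sp.
pose rho (z : I + K') : I + K := match z with inl i => inl i | inr j => inr (val j) end.
have us : uniq s := map_uniq (free_uniq fs1).
have ps : perm_eq (map rho (enum {: I + K'})) s.
  apply: uniq_perm => // [|i].
    rewrite map_inj_uniq ?enum_uniq // => -[i|j] [i'|j'] //= [] => [->//|e].
    by congr inr; exact: val_inj.
  apply/mapP/idP => [[[i'|j] _ ->]|].
  - by rewrite mem_cat /= map_f ?orbT // mem_enum.
  - by rewrite mem_cat /= (valP j).
  - rewrite mem_cat => /orP[is1|/mapP[i' _ ->]]; last first.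
      by exists (inl i') => //; rewrite mem_enum.
    have /mapP[j _ Ej] := mem_subseq ss1 is1; rewrite Ej in is1 *.
    by exists (inr (exist _ j is1)) => //; rewrite mem_enum.
have spV v : v \in <<map wIK s>>%VS.
  have : (<<codom wK>> <= <<map wIK s>>)%VS.
    apply/span_subvP => _ /codomP[j ->]; apply: (sp (inr j)).
    by apply: map_f; rewrite mem_enum.
  by move=> /subvP; apply; exact: spK.
split=> [|v].
  have bs : basis_of {:V} (map wIK s).
    rewrite basisEfree fs1 subvf /=; apply: leq_trans (dim_span _).
    by apply: dimvS; apply/subvP => v _; exact: spV.
  have /andP[/eqP <- /eqP ->] := bs.
  by rewrite size_map -(perm_size ps) size_map -cardE card_sum.
have [c ->] := span_coef us (spV v); exists (c \o rho).
by rewrite -(perm_big _ ps) big_map big_enum big_sumType.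
Qed.

(* If w and few vectors y together span V, a basis of V extracted from w must
   contain most of the blocks w (u, _) in full. *)
Lemma orbit_selection (U G Y K : finType) (w : U * G -> V) (y : Y -> V)
    (wK : K -> V) : (#|U| * #|G|)%N = \dim {:V} ->
  (forall v, v \in <<codom w ++ codom y>>%VS) ->
  (forall v, v \in <<codom wK>>%VS) ->
  exists r (u : 'I_r -> U) (K' : finType) (kappa : K' -> K),
    [/\ (r * #|G| + #|K'|)%N = \dim {:V}, (#|U| <= r + #|Y|)%N &
     forall v, exists c : ('I_r * G) + K' -> k,
      v = \sum_i c (inl i) *: w (u i.1, i.2) + \sum_j c (inr j) *: wK (kappa j)].
Proof.
move=> dimV spY spK.
have [T [sT fT spT]] := extend_free (s0 := [::]) (enum {: U * G}) (nil_free V : free (map w [::])).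
rewrite cats0 in fT spT.
have uT : uniq T := subseq_uniq sT (enum_uniq _).
have sizeT : (\dim {:V} <= size T + #|Y|)%N.
  have sub : ({:V} <= <<map w T>> + <<codom y>>)%VS.
    apply/subvP => v _; have := spY v; rewrite span_cat; apply/subvP: v.
    apply: addvS => //; apply/span_subvP => _ /codomP[i ->]; apply: spT.
    by rewrite mem_enum.
  apply: leq_trans (dimvS sub) _; apply: leq_trans (dimv_add_leqif _ _) _.
  rewrite -(size_codom y) -(size_map w T); exact: leq_add (dim_span _) (dim_span _).
pose U' := [set u | [forall g, (u, g) \in T]].
(* Each block outside [U'] has an index missing from T, and at most #|Y| indices are missing because
   T and y together span V. *)
have cardU' : (#|U| <= #|U'| + #|Y|)%N.
  rewrite -(cardsC U') leq_add2l.
  have sub : ~: U' \subset fst @: [set x | x \notin T].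
    apply/fintype.subsetP => u; rewrite !inE negb_forall => /existsP[g ug].
    by apply/imsetP; exists (u, g); rewrite ?inE.
  apply: leq_trans (subset_leq_card sub) _; apply: leq_trans (leq_imset_card _ _) _.
  have -> : #|[set x | x \notin T]| = (#|{: U * G}| - size T)%N.
    have := cardsC [set x in T]; rewrite cardsE (card_uniqP uT) => <-.
    by rewrite addKn; apply: eq_card => x; rewrite !inE.
  by rewrite card_prod dimV leq_subLR.
pose wI (i : 'I_#|U'| * G) := w (enum_val i.1, i.2).
have fwI : free (codom wI).
  rewrite codomE (map_comp w (fun i : 'I_#|U'| * G => (enum_val i.1, i.2))).
  apply: sub_free fT.
    rewrite map_inj_uniq ?enum_uniq // => -[i g] [i' g'] [] /enum_val_inj -> -> //.
  move=> _ /mapP[[i g] _ ->] /=.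
  by have := enum_valP i; rewrite inE => /forallP.
have [K' [kappa [dimK' spK']]] := complete_basis fwI spK.
exists #|U'|, enum_val, K', kappa; split=> //.
by rewrite -dimK' card_prod card_ord.
Qed.

End Selection.

Section PowerBases.

Lemma frobX_sum (R : comNzRingType) p (chR : p \in [pchar R]) e (I : Type)
    (s : seq I) (P : pred I) (F : I -> R) :
  (\sum_(i <- s | P i) F i) ^+ (p ^ e) = \sum_(i <- s | P i) F i ^+ (p ^ e).
Proof.
apply: (big_morph (fun x => x ^+ (p ^ e))) => [x y|]; last exact: frob_0.
by rewrite exprDn_pchar // frob_pcharX.
Qed.

(** A basis of R over its Q-th powers. D returns Q-th roots of the coefficients, since these are the
    coordinates when R acts through Q-th powers. *)
Definition power_basis (R : comNzRingType) (Q : nat) (J : finType)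
    (zeta : J -> R) (D : R -> J -> R) : Prop :=
  (forall y, y = \sum_j D y j ^+ Q * zeta j) /\
  (forall c j, D (\sum_j c j ^+ Q * zeta j) j = c j).

Lemma power_basis_comp (R : comNzRingType) p (chR : p \in [pchar R]) e Q'
    (J J' : finType) (zeta : J -> R) D (zeta' : J' -> R) D' :
  power_basis (p ^ e) zeta D -> power_basis Q' zeta' D' ->
  power_basis (p ^ e * Q') (fun j : J * J' => zeta' j.2 ^+ (p ^ e) * zeta j.1)
    (fun y j => D' (D y j.1) j.2).
Proof.
move=> [Dy DK] [D'y D'K].
have E (c : J * J' -> R) : \sum_j c j ^+ (p ^ e * Q') *
    (zeta' j.2 ^+ (p ^ e) * zeta j.1) =
    \sum_j (\sum_j' c (j, j') ^+ Q' * zeta' j') ^+ (p ^ e) * zeta j.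
  under [RHS]eq_bigr do rewrite (frobX_sum chR) mulr_suml.
  rewrite pair_bigA /=; apply: eq_bigr => -[j j'] _ /=.
  by rewrite exprMn -exprM mulrA [(Q' * _)%N]mulnC.
split=> [y|c [j j']]; last by rewrite E /= DK D'K.
by rewrite E /= {1}[y]Dy; apply: eq_bigr => j _; rewrite -D'y.
Qed.

Lemma field_power_basis (k : fieldType) p (chk : p \in [pchar k]) q :
  pth_power_degree k p q -> forall e, exists (J : finType) (beta : J -> k) D,
    #|J| = (q ^ e)%N /\ power_basis (p ^ e) beta D.
Proof.
move=> [b bP].
have [D1 D1P] : exists D1, power_basis (p ^ 1) b D1.
  have /choice [D Dy] : forall y : k, exists c : 'I_q -> k,
      y = \sum_j c j ^+ (p ^ 1) * b j.
    move=> y; have [c [[/choice [d dP] ->] _]] := bP y; exists d.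
    by apply: eq_bigr => j _; rewrite dP expn1.
  exists D; split=> // c j; set y := \sum_j _.
  have [c0 [_ c0P]] := bP y.
  have E (d : 'I_q -> k) : y = \sum_j d j ^+ (p ^ 1) * b j ->
      c0 = [ffun j => d j ^+ p].
    move=> yd; apply: c0P; split=> [i|]; first by exists (d i); rewrite ffunE.
    by rewrite yd; apply: eq_bigr => i _; rewrite ffunE expn1.
  (* Uniqueness in [bP] concerns p-th powers; as the Frobenius map of a field is injective, the
     roots agree too. *)
  have := E _ (erefl y); rewrite (E _ (Dy y)) => /ffunP/(_ j); rewrite !ffunE => /eqP.
  rewrite -subr_eq0 -[p]expn1 -(frob_B chk 1) expf_eq0 => /andP[_].
  by rewrite subr_eq0 => /eqP.
elim=> [|e [J [beta [D [cardJ DP]]]]].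
  exists unit, (fun=> 1), (fun y _ => y); split; first by rewrite card_unit.
  by split=> [y|c []]; rewrite (big_pred1 tt) ?expr1 ?mulr1 // => -[].
exists ('I_q * J)%type, (fun j => beta j.2 ^+ (p ^ 1) * b j.1),
  (fun y j => D (D1 y j.1) j.2); split.
  by rewrite card_prod card_ord cardJ expnS.
have -> : (p ^ e.+1 = p ^ 1 * p ^ e)%N by rewrite expnS expn1.
exact: (power_basis_comp chk D1P DP).
Qed.

Section Polynomials.
Variables (k : fieldType) (p : nat) (chk : p \in [pchar k]) (e n : nat).
Local Notation Q := (p ^ e)%N.
Variables (J : finType) (beta : J -> k) (Dk : k -> J -> k).
Hypothesis beta_basis : power_basis Q beta Dk.
Local Notation B := {mpoly k[n]}.
Implicit Types (m : 'X_{1..n}) (r : {ffun 'I_n -> 'I_Q}).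

Lemma frob_pow_gt0 : (0 < Q)%N.
Proof. by rewrite expn_gt0 (frob_p_gt0 chk). Qed.

Definition mnm_quo m : 'X_{1..n} := [multinom (m i %/ Q)%N | i < n].
Definition mnm_rem m : {ffun 'I_n -> 'I_Q} :=
  [ffun i => Ordinal (ltn_pmod (m i) frob_pow_gt0)].
Definition mnm_small r : 'X_{1..n} := [multinom (r i : nat) | i < n].

Lemma mnm_quo_rem m : m = (mnm_quo m *+ Q + mnm_small (mnm_rem m))%MM.
Proof.
by apply/mnmP => i; rewrite mnmDE mulmnE !mnmE ffunE /= -divn_eq.
Qed.

Lemma mnm_quoK m r : mnm_quo (m *+ Q + mnm_small r)%MM = m.
Proof.
apply/mnmP => i; rewrite mnmE mnmDE mulmnE mnmE divnMDl ?frob_pow_gt0 //.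
by rewrite divn_small ?addn0.
Qed.

Lemma mnm_remK m r : mnm_rem (m *+ Q + mnm_small r)%MM = r.
Proof.
apply/ffunP => i; apply: val_inj; rewrite ffunE /= mnmDE mulmnE mnmE.
by rewrite modnMDl modn_small.
Qed.

Definition mpoly_zeta (j : J * {ffun 'I_n -> 'I_Q}) : B :=
  beta j.1 *: 'X_[mnm_small j.2].

Definition mpoly_digit (y : B) (j : J * {ffun 'I_n -> 'I_Q}) : B :=
  \sum_(m <- msupp y | mnm_rem m == j.2) Dk y@_m j.1 *: 'X_[mnm_quo m].

Lemma digit0 j : Dk 0 j = 0.
Proof.
rewrite -[RHS](beta_basis.2 (fun=> 0) j); congr Dk; rewrite big1 // => i _.
by rewrite (frob_0 chk) mul0r.
Qed.

Lemma mpoly_digit_coef y j m :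
  (mpoly_digit y j)@_m = Dk y@_(m *+ Q + mnm_small j.2) j.1.
Proof.
set M := (_ + _)%MM.
rewrite /mpoly_digit raddf_sum /=.
under eq_bigr do rewrite mcoeffZ mcoeffX.
have E m' : mnm_rem m' == j.2 -> mnm_quo m' = m -> m' = M.
  by move=> /eqP r mq; rewrite /M -mq -r; exact: mnm_quo_rem.
have [My|My] := boolP (M \in msupp y).
  rewrite big_mkcond (bigD1_seq M) ?msupp_uniq //= mnm_remK eqxx.
  rewrite mnm_quoK eqxx mulr1 big1 ?addr0 // => m' m'M; case: ifP => // r.
  by case: eqP => [/(E _ r) e'|_]; [rewrite e' eqxx in m'M | rewrite mulr0].
rewrite (memN_msupp_eq0 My) digit0 big_seq_cond big1 // => m' /andP[m'y r].
by case: eqP => [/(E _ r) e'|_]; [rewrite -e' m'y in My | rewrite mulr0].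
Qed.

Lemma mpoly_power_coef (c : J * {ffun 'I_n -> 'I_Q} -> B) m :
  (\sum_j c j ^+ Q * mpoly_zeta j)@_m =
  \sum_i (c (i, mnm_rem m))@_(mnm_quo m) ^+ Q * beta i.
Proof.
rewrite raddf_sum /=.
have E j : (c j ^+ Q * mpoly_zeta j)@_m =
    if j.2 == mnm_rem m then (c j)@_(mnm_quo m) ^+ Q * beta j.1 else 0.
  rewrite {1}[c j]mpolyE (frobX_sum (mpoly_pchar n chk)) mulr_suml raddf_sum /=.
  under eq_bigr do rewrite exprZn mpolyXn -scalerAl -scalerAr -mpolyXD scalerA
    mcoeffZ mcoeffX.
  have key m' : ((m' *+ Q + mnm_small j.2)%MM == m) =
      (m' == mnm_quo m) && (j.2 == mnm_rem m).
    apply/eqP/andP => [<-|[/eqP -> /eqP ->]]; last by rewrite -mnm_quo_rem.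
    by rewrite mnm_quoK mnm_remK.
  under eq_bigr do rewrite key.
  case: eqP => [jm|jm]; last by rewrite big1 // => m' _; rewrite andbF mulr0.
  have [mc|mc] := boolP (mnm_quo m \in msupp (c j)).
    rewrite (bigD1_seq (mnm_quo m)) ?msupp_uniq //= eqxx mulr1 big1 ?addr0 //.
    by move=> m' /negPf ->; rewrite mulr0.
  rewrite (memN_msupp_eq0 mc) (frob_0 chk) mul0r big_seq big1 // => m' m'c.
  by case: eqP => [e'|_]; [rewrite -e' m'c in mc | rewrite mulr0].
under eq_bigr do rewrite E.
transitivity (\sum_i \sum_r
    if r == mnm_rem m then (c (i, r))@_(mnm_quo m) ^+ Q * beta i else 0).
  by rewrite pair_bigA; apply: eq_bigr => -[].
by apply: eq_bigr => i _; rewrite -big_mkcond big_pred1_eq.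
Qed.

(** Division of exponents by Q with remainder separates the monomials, and [beta] separates the
    coefficients, so the claim can be checked one coefficient at a time. *)
Lemma mpoly_power_basis : power_basis Q mpoly_zeta mpoly_digit.
Proof.
split=> [y|c [i r]]; apply/mpolyP => m.
  rewrite mpoly_power_coef.
  under eq_bigr do rewrite mpoly_digit_coef -mnm_quo_rem.
  exact: beta_basis.1.
rewrite mpoly_digit_coef mpoly_power_coef /= mnm_quoK mnm_remK.
by rewrite beta_basis.2.
Qed.

End Polynomials.

End PowerBases.

(** * Completion *)

Section IdealPowers.
Variables (k : fieldType) (n : nat) (w : 'I_n -> nat).
Hypothesis w_gt0 : forall i, (0 < w i)%N.
Local Notation B := {mpoly k[n]}.
Local Notation Irr := (irrelevant k w).

Lemma wdeg_gt0 (m : 'X_{1..n}) : (0 < wdeg w m)%N = (m != 0%MM).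
Proof.
have [->|m0] := eqVneq m 0%MM; first by rewrite wdeg0.
have [i mi] : exists i, m i != 0%N.
  apply/existsP; apply: contraNT m0; rewrite negb_exists => /forallP H.
  by apply/eqP/mnmP => i; rewrite mnm0E; apply/eqP; have := H i; rewrite negbK.
by rewrite /wdeg (bigD1 i) //= addn_gt0 muln_gt0 lt0n mi w_gt0.
Qed.

Lemma irrelevantE (b : B) : (b \in Irr) = (b@_0%MM == 0).
Proof.
rewrite mcoeff_eq0; apply/allP/idP => [H|b0 m mb].
  by apply/negP => /H; rewrite wdeg_gt0 eqxx.
by rewrite wdeg_gt0; apply: contraNneq b0 => <-.
Qed.

(** The weights are positive, so the irrelevant ideal is generated by the variables, and its powers
    are detected by the ordinary degree of monomials whatever the weights are. *)
Lemma ideal_powP N (b : B) :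
  ideal_pow Irr N b <-> forall m, (mdeg m < N)%N -> b@_m = 0.
Proof.
split.
- elim: N b => [|N IHN] b //= ; elim=> [_ [x [y [xI yN ->]]]||x y _ Hx _ Hy] m mN.
  + rewrite mcoeffM big1 // => /= i /eqP Em.
    have [i0|i0] := eqVneq (i.1 : 'X_{1..n}) 0%MM.
      by rewrite i0 (eqP (_ : x@_0%MM == 0)) ?mul0r // -irrelevantE.
    have dm := congr1 (@mdeg n) Em; rewrite mdegD in dm.
    have lt2 : (mdeg i.2 < mdeg i.1 + mdeg i.2)%N.
      by rewrite -add1n leq_add2r lt0n mdeg_eq0.
    by rewrite (IHN y yN) ?mulr0 //; apply: leq_trans lt2 _; rewrite -dm -ltnS.
  + exact: mcoeff0.
  + by rewrite mcoeffB Hx // Hy // subrr.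
- have XP N' (m : 'X_{1..n}) : (N' <= mdeg m)%N -> ideal_pow Irr N' 'X_[k, m].
    elim: N' m => [//|N' IHN] m mN.
    have m0 : m != 0%MM by rewrite -mdeg_eq0 -lt0n; exact: leq_trans mN.
    have [i mi] : exists i, (0 < m i)%N.
      apply/existsP; apply: contraNT m0; rewrite negb_exists => /forallP H.
      by apply/eqP/mnmP => i; rewrite mnm0E; have := H i; rewrite lt0n negbK => /eqP.
    have Um : (U_(i) <= m)%MM.
      by apply/mnm_lepP => j; rewrite mnm1E; case: eqP => // <-.
    have dm : (mdeg (m - U_(i))%MM).+1 = mdeg m.
      by rewrite -{2}(submK Um) mdegD mdeg1 addn1.
    rewrite -(submK Um) addmC mpolyXD /=; apply: add_span_gen.
    exists 'X_i, 'X_[(m - U_(i))%MM]; split=> //.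
      by rewrite irrelevantE mcoeffX mnm1_eq0.
    by apply: IHN; rewrite -ltnS dm.
  move=> H; rewrite [b]mpolyE.
  apply: (add_subgroup_sum (ideal_pow_subgroup _ _)) => m mb _.
  rewrite -mul_mpolyC; apply: ideal_powM; apply: XP.
  by rewrite leqNgt; apply: contraL mb => /H b0; rewrite mcoeff_msupp b0 eqxx.
Qed.

Lemma ideal_pow_le N N' (b : B) : (N <= N')%N ->
  ideal_pow Irr N' b -> ideal_pow Irr N b.
Proof.
move=> NN' /ideal_powP H; apply/ideal_powP => m mN; apply: H.
exact: leq_trans NN'.
Qed.

Lemma ideal_powX N (b : B) : b \in Irr -> ideal_pow Irr N (b ^+ N).
Proof.
by move=> bI; elim: N => //= N IHN; apply: add_span_gen; exists b, (b ^+ N); rewrite exprS.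
Qed.

Local Notation Bh := (hat_ring k w).
Local Notation pi := (@completion_pi _ Irr).
Local Notation cseq := (coherent_seq Irr).

Definition eval_seq N (x : cseq) : B := coherent_val x N.

Fact eval_seq_additive N : zmod_morphism (eval_seq N).
Proof. by []. Qed.

Fact eval_seq_multiplicative N : monoid_morphism (eval_seq N).
Proof. by []. Qed.

HB.instance Definition _ N := GRing.isZmodMorphism.Build cseq B (eval_seq N)
  (eval_seq_additive N).
HB.instance Definition _ N := GRing.isMonoidMorphism.Build cseq B (eval_seq N)
  (eval_seq_multiplicative N).

Lemma coherentP (x : cseq) N M : (N <= M)%N ->
  ideal_pow Irr N (eval_seq M x - eval_seq N x).
Proof. by move=> NM; have /asboolP := coherent_valP x; apply. Qed.

(** Index 1 is the first at which the constant coefficient is determined by the class; modulo the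
    0-th power of the ideal a term is arbitrary. *)
Definition hat_eps (y : Bh) : k :=
  (eval_seq 1 (sval (cid (completion_piP y))))@_0%MM.

Lemma hat_epsE x N : (0 < N)%N -> hat_eps (pi x) = (eval_seq N x)@_0%MM.
Proof.
move=> N0; rewrite /hat_eps; case: cid => x' /= /completion_eqP /(_ 1%N).
move=> /ideal_powP /(_ 0%MM); rewrite mdeg0 => /(_ isT) /eqP.
rewrite mcoeffB subr_eq0 => /eqP <-; apply/eqP; rewrite eq_sym -subr_eq0 -mcoeffB.
by apply/eqP; move/ideal_powP: (coherentP x N0); apply; rewrite mdeg0.
Qed.

Fact hat_eps_additive : zmod_morphism hat_eps.
Proof.
move=> y y'; have [x ->] := completion_piP y; have [x' ->] := completion_piP y'.
by rewrite -rmorphB !(hat_epsE _ (ltn0Sn 0)); exact: mcoeffB.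
Qed.

Fact hat_eps_multiplicative : monoid_morphism hat_eps.
Proof.
split=> [|y y'].
  rewrite -(rmorph1 pi) (hat_epsE _ (ltn0Sn 0)) -[eval_seq _ _]/(1 : B).
  by rewrite mcoeff1 eqxx.
have [x ->] := completion_piP y; have [x' ->] := completion_piP y'.
rewrite -rmorphM !(hat_epsE _ (ltn0Sn 0)).
exact: (rmorphM (mcoeff 0%MM)).
Qed.

HB.instance Definition _ := GRing.isZmodMorphism.Build Bh k hat_eps
  hat_eps_additive.
HB.instance Definition _ := GRing.isMonoidMorphism.Build Bh k hat_eps
  hat_eps_multiplicative.

Definition hat_iota : k -> Bh := to_completion Irr \o @mpolyC n k.

HB.instance Definition _ := GRing.RMorphism.on hat_iota.

Lemma hat_iotaK : cancel hat_iota hat_eps.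
Proof. by move=> c; rewrite (hat_epsE _ (ltn0Sn 0)) mcoeffC eqxx mulr1. Qed.

(** Truncated geometric series: u_N = 1 - x_N / c has no constant term, so x_N v_N = 1 - u_N^N is 1
    modulo the N-th power of the ideal. The v_N are coherent because v_M and v_N both invert x_N
    modulo that power when M >= N. *)
Lemma hat_eps_unit (y : Bh) : hat_eps y != 0 -> exists z, z * y = 1.
Proof.
have [x ->] := completion_piP y; set c := hat_eps _ => c0.
pose u N : B := 1 - c^-1 *: eval_seq N x.
pose v N : B := c^-1 *: \sum_(i < N) u N ^+ i.
have vP N : ideal_pow Irr N (eval_seq N x * v N - 1).
  case: N => [//|N]; rewrite (_ : _ - 1 = - u N.+1 ^+ N.+1).
    apply: add_subgroupN; first exact: ideal_pow_subgroup.
    apply: ideal_powX; rewrite irrelevantE mcoeffB mcoeff1 eqxx mcoeffZ.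
    by rewrite -(hat_epsE x (ltn0Sn N)) mulVf // subrr.
  apply/eqP; rewrite subr_eq addrC -opprB subrX1 /v -scalerAr scalerAl.
  by rewrite -mulNr; apply/eqP; congr (_ * _); rewrite opprB /u opprB addrC subrK.
have vc : (v : nat -> B) \in coherent Irr.
  apply/asboolP => N M NM.
  have -> : v M - v N = - v M * (eval_seq N x * v N - 1) +
      v N * ((eval_seq M x * v M - 1) - v M * (eval_seq M x - eval_seq N x)).
    by move: (eval_seq M x) (eval_seq N x) (v M) (v N) => *; ring.
  have sub := ideal_pow_subgroup Irr N.
  apply: (add_subgroupD sub); apply: ideal_powM; first exact: vP.
  apply: sub.2; first exact: ideal_pow_le NM (vP M).
  by apply: ideal_powM; exact: coherentP.
exists (pi (CoherentSeq vc)); rewrite -rmorphM -(rmorph1 pi).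
by apply/completion_eqP => N; rewrite mulrC; exact: vP.
Qed.

Lemma eps_graded_act (G : finGroupType) (a : graded_action k w G) g (b : B) :
  (a g b)@_0%MM = b@_0%MM.
Proof.
have bI : b - b@_0%MM *: 1 \in Irr.
  by rewrite irrelevantE mcoeffB mcoeffZ mcoeff1 eqxx mulr1 subrr.
have := graded_ract_irrelevant a g bI.
rewrite rmorphB graded_ractZ rmorph1 irrelevantE mcoeffB mcoeffZ mcoeff1 eqxx.
by rewrite mulr1 subr_eq0 => /eqP.
Qed.

Lemma hat_eps_act (G : finGroupType) (a : graded_action k w G) g (y : Bh) :
  hat_eps (hat_action a g y) = hat_eps y.
Proof.
have [x ->] := completion_piP y.
rewrite [hat_action a g _]completion_mapE !(hat_epsE _ (ltn0Sn 0)).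
exact: eps_graded_act.
Qed.

Section PowerBasis.
Variables (p : nat) (chk : p \in [pchar k]) (e : nat).
Local Notation Q := (p ^ e)%N.
Variables (J : finType) (beta : J -> k) (Dk : k -> J -> k).
Hypothesis beta_basis : power_basis Q beta Dk.
Local Notation zeta := (@mpoly_zeta k p e n J beta).
Local Notation D := (@mpoly_digit k p chk e n J Dk).
Let J' := (J * {ffun 'I_n -> 'I_Q})%type.

Lemma mpoly_digitB y y' j : D (y - y') j = D y j - D y' j.
Proof.
have [Dy DK] := mpoly_power_basis chk n beta_basis.
rewrite {1}[y]Dy {1}[y']Dy -sumrB.
under eq_bigr do rewrite -mulrBl -(frob_B (mpoly_pchar n chk)).
exact: DK.
Qed.

(* For a power Q N of the ideal, the remainders of the exponents modulo Q may
   take up to Q n of the degree. *)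
Lemma mpoly_digit_pow N y j : ideal_pow Irr (Q * (N + n)) y ->
  ideal_pow Irr N (D y j).
Proof.
move=> /ideal_powP yN; apply/ideal_powP => m mN.
rewrite (mpoly_digit_coef chk beta_basis) yN ?(digit0 chk beta_basis) //.
rewrite mdegD mdegMn mulnDr mulnC -[X in (X < _)%N]addn0 -addnA addn0.
apply: leq_ltn_trans (_ : (Q * mdeg m + Q * n < _)%N).
  rewrite leq_add2l mdegE; apply: leq_trans (_ : \sum_(i < n) Q <= _)%N.
    by apply: leq_sum => i _; rewrite mnmE ltnW.
  by rewrite sum_nat_const card_ord mulnC.
by rewrite ltn_add2r ltn_pmul2l // (frob_pow_gt0 chk).
Qed.

Lemma hat_digit_coherent (x : cseq) j :
  (fun N => D (eval_seq (Q * (N + n))%N x) j) \in coherent Irr.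
Proof.
apply/asboolP => N M NM; rewrite -mpoly_digitB; apply: mpoly_digit_pow.
by apply: coherentP; rewrite leq_mul2l leq_add2r NM orbT.
Qed.

Definition hat_digit (y : Bh) (j : J') : Bh :=
  pi (CoherentSeq (hat_digit_coherent (sval (cid (completion_piP y))) j)).

Lemma hat_digitE x j : hat_digit (pi x) j = pi (CoherentSeq (hat_digit_coherent x j)).
Proof.
rewrite /hat_digit; case: cid => x' /= /completion_eqP xx'.
apply/completion_eqP => N /=; rewrite -mpoly_digitB; apply: mpoly_digit_pow.
rewrite -opprB; apply: add_subgroupN; first exact: ideal_pow_subgroup.
exact: xx'.
Qed.

(** Digits for index N are read off at Q (N + n) >= N, so recombining them gives a later term of the
    same sequence, which agrees with the N-th one modulo the N-th power of the ideal. *)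
Lemma hat_power_basis :
  power_basis Q (to_completion Irr \o zeta) hat_digit.
Proof.
have [Dy DK] := mpoly_power_basis chk n beta_basis.
have Q0 := frob_pow_gt0 chk e.
have NQ N : (N <= Q * (N + n))%N.
  by apply: leq_trans (leq_addr n N) _; rewrite leq_pmull.
pose comb (s : J' -> cseq) : cseq :=
  \sum_j s j ^+ Q * CoherentSeq (const_coherent Irr (zeta j)).
have combE s : \sum_j pi (s j) ^+ Q * (to_completion Irr \o zeta) j = pi (comb s).
  by rewrite rmorph_sum; apply: eq_bigr => j _; rewrite rmorphM rmorphXn.
have comb_eval s N : eval_seq N (comb s) = \sum_j eval_seq N (s j) ^+ Q * zeta j.
  by rewrite rmorph_sum; apply: eq_bigr => j _; rewrite rmorphM rmorphXn.
split=> [y|c j].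
  have [x ->] := completion_piP y.
  under eq_bigr do rewrite hat_digitE.
  rewrite combE; apply/completion_eqP => N.
  have -> : coherent_val (comb (fun j => CoherentSeq (hat_digit_coherent x j))) N =
      eval_seq (Q * (N + n))%N x.
    by rewrite -[LHS]/(eval_seq N _) comb_eval [RHS]Dy.
  rewrite -opprB; apply: add_subgroupN; first exact: ideal_pow_subgroup.
  exact: coherentP.
have /choice [s sP] := fun j => completion_piP (c j).
have -> : \sum_j c j ^+ Q * (to_completion Irr \o zeta) j = pi (comb s).
  by rewrite -combE; apply: eq_bigr => i _; rewrite sP.
rewrite hat_digitE sP; apply/completion_eqP => N /=.
by rewrite comb_eval DK; exact: coherentP.
Qed.

End PowerBasis.

End IdealPowers.

(** The universal property extends the coordinates of M to a map h' from M' to A'^I. The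
    endomorphism y |-> sum_i h'(y)_i j(v_i) fixes the image of j, so it is the identity by
    uniqueness. *)
Lemma base_change_basis (A A' : comNzRingType) (theta : {rmorphism A -> A'})
    (M : lmodType A) (M' : lmodType A') (j : M -> M') (I : finType)
    (v : I -> M) co :
  is_base_change theta j -> free_basis v co -> exists co', free_basis (j \o v) co'.
Proof.
move=> [jl univ] vb; pose N : lmodType A' := {ffun I -> A'^o}.
pose h (x : M) : N := [ffun i => theta (co x i)].
have hl : semilinear theta h.
  split=> [x y|b x]; apply/ffunP => i; rewrite !ffunE.
    by rewrite (coordD vb) rmorphD.
  by rewrite (coordZ vb) rmorphM.
have [h' [h'j _]] := univ N h hl.
pose t (y : M') : M' := \sum_i (h' y i : A') *: j (v i).
have tB : zmod_morphism t.
  move=> y y'; rewrite /t -sumrB; apply: eq_bigr => i _.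
  by rewrite linearB !ffunE scalerBl.
have tZ : scalable t.
  move=> b y; rewrite /t scaler_sumr; apply: eq_bigr => i _.
  by rewrite linearZ !ffunE scalerA.
pose T : {linear M' -> M'} := HB.pack_for {linear M' -> M'} t
  (GRing.isZmodMorphism.Build _ _ _ tB) (GRing.isScalable.Build _ _ _ _ _ tZ).
have Tid y : T y = y.
  have [h1 [_ h1P]] := univ M' j jl.
  rewrite (h1P T) => [|x].
    by rewrite -(h1P (idfun : {linear M' -> M'})).
  rewrite [RHS](congr1 j (basis_sum vb x)) (semilinear_sum jl) /= /t.
  by apply: eq_bigr => i _; rewrite h'j ffunE.
exists (fun y i => h' y i); split=> [y|c i]; first by rewrite -[LHS]Tid.
rewrite linear_sum sum_ffunE (bigD1 i) //= big1 => [|l /negPf li].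
  rewrite linearZ ffunE /= h'j ffunE (coord_basis vb) eqxx rmorph1 addr0.
  exact: mulr1.
by rewrite linearZ ffunE /= h'j ffunE (coord_basis vb) eq_sym li rmorph0 scaler0.
Qed.

(** * Bases of Frobenius direct images *)

Section FrobeniusBases.
Variables (G : finGroupType) (R : comNzRingType) (a : ring_action G R).
Local Notation S := (twisted a).

Lemma ffun_basis (M : lmodType S) (U I : finType) (v : I -> M) co :
  free_basis (v : I -> underlying M) co ->
  free_basis ((fun ui => [ffun u => if u == ui.1 then v ui.2 else 0]) :
      U * I -> underlying {ffun U -> M})
    (fun x ui => co (x ui.1) ui.2).
Proof.
move=> vb.
have E (c : U * I -> R) u : (\sum_ui c ui *: ([ffun u => if u == ui.1 then v ui.2
    else 0] : underlying {ffun U -> M}) : {ffun U -> M}) u =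
    \sum_i c (u, i) *: (v i : underlying M).
  transitivity (\sum_u' \sum_i (tw_const a (c (u', i)) *:
      [ffun u => if u == u' then v i else 0]) u).
    by rewrite pair_bigA sum_ffunE; apply: eq_bigr => -[].
  rewrite (bigD1 u) //= [X in _ + X]big1 ?addr0 => [|u' /negPf uu'].
    by apply: eq_bigr => i _; rewrite !ffunE eqxx.
  by rewrite big1 // => i _; rewrite !ffunE eq_sym uu' scaler0.
split=> [x|c [u i]].
  by apply/ffunP => u; rewrite [RHS]E {1}(basis_sum vb (x u)).
by rewrite -[RHS](coordK vb (fun i => c (u, i))); congr co; exact: E.
Qed.

Variables (p : nat) (chR : p \in [pchar R]) (e : nat).

Lemma frob_scaleE (M : lmodType S) b (x : M) :
  b *: (x : underlying (frob_image chR e M)) = tw_const a (b ^+ (p ^ e)) *: x.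
Proof.
rewrite underlyingE -[LHS]/(tw_frobenius p e (tw_const a b) *: x).
have -> // : tw_frobenius p e (tw_const a b) = tw_const a (b ^+ (p ^ e)).
apply/ffunP => g; rewrite !ffunE; case: eqP => // _; exact: frob_0.
Qed.

Lemma frob_gactE (M : lmodType S) g (x : M) :
  gact g (x : frob_image chR e M) = gact g x.
Proof.
rewrite /gact -[LHS]/(tw_frobenius p e (tw_mono a 1 g) *: x).
have -> // : tw_frobenius p e (tw_mono a 1 g) = tw_mono a 1 g.
apply/ffunP => h; rewrite !ffunE; case: eqP => // _; first exact: expr1n.
exact: frob_0.
Qed.

Lemma frob_basis (M : lmodType S) (I J : finType) (v : I -> M) co
    (zeta : J -> R) D :
  free_basis (v : I -> underlying M) co -> power_basis (p ^ e) zeta D ->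
  free_basis ((fun ij => tw_const a (zeta ij.2) *: v ij.1) :
      I * J -> underlying (frob_image chR e M))
    (fun x ij => D (co x ij.1) ij.2).
Proof.
move=> vb [Dy DK].
have E (c : I * J -> R) : (\sum_ij c ij *: ((tw_const a (zeta ij.2) *: v ij.1 : M) :
    underlying (frob_image chR e M)) : M) =
    \sum_i (\sum_j c (i, j) ^+ (p ^ e) * zeta j) *: (v i : underlying M).
  under [RHS]eq_bigr do rewrite scaler_suml.
  rewrite pair_bigA; apply: eq_bigr => -[i j] _ /=.
  by rewrite frob_scaleE scalerA -rmorphM.
split=> [x|c [i j]].
  rewrite [RHS]E {1}(basis_sum vb x); apply: eq_bigr => i _.
  by rewrite /= -Dy.
by rewrite [X in co X]E (coordK vb) DK.
Qed.

End FrobeniusBases.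

Lemma sum_mul_exchange (R : comNzRingType) (I J : Type) (r : seq I) (s : seq J)
    (c : I -> R) (u : J -> R) (F : I -> J -> R) :
  \sum_(i <- r) c i * (\sum_(j <- s) u j * F i j) =
  \sum_(j <- s) u j * (\sum_(i <- r) c i * F i j).
Proof.
under eq_bigr do rewrite mulr_sumr.
rewrite exchange_big /=; apply: eq_bigr => j _; rewrite mulr_sumr.
by apply: eq_bigr => i _; rewrite mulrCA.
Qed.

(** * Translates of monomials *)

Section Faithful.
Variables (k : fieldType) (n : nat) (w : 'I_n -> nat) (G : finGroupType).
Variable a : graded_action k w G.
Hypothesis a_faithful : forall g : G, (forall b : {mpoly k[n]}, a g b = b) -> g = 1%g.
Local Notation B := {mpoly k[n]}.

Lemma dedekind (I : eqType) (g : I -> G) (s : seq I) (c : I -> B) :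
  injective g -> uniq s -> (forall b, \sum_(i <- s) c i * a (g i) b = 0) ->
  forall i, i \in s -> c i = 0.
Proof.
move=> g_inj; elim: s c => // i0 s IHs c /= /andP[ns us] c0.
have cs i : i \in s -> c i = 0.
  move=> si; have [y yP] : exists y, a (g i) y != a (g i0) y.
    apply: contrapT => H; have gi : g i = g i0.
      suff e : ((g i0)^-1 * g i)%g = 1%g by rewrite -[g i](mulKVg (g i0)) e mulg1.
      apply: a_faithful => b; rewrite ractM.
      have -> : a (g i) b = a (g i0) b.
        by apply: contrapT => nb; apply: H; exists b; exact/eqP.
      by rewrite -ractM mulVg ract1.
    by move: ns; rewrite -(g_inj _ _ gi) si.
  (* The relation at y b minus [a (g i0) y] times the relation at b has no term for i0, and y was
     chosen to keep the factor at i nonzero. *)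
  have cy : forall b, \sum_(j <- s) c j * (a (g j) y - a (g i0) y) * a (g j) b = 0.
    move=> b; have := c0 (y * b); have := c0 b; rewrite !big_cons => cb cyb.
    transitivity (\sum_(j <- s) c j * a (g j) (y * b) -
        a (g i0) y * \sum_(j <- s) c j * a (g j) b).
      rewrite mulr_sumr -sumrB; apply: eq_bigr => j _; rewrite rmorphM.
      by rewrite mulrBr mulrBl [in RHS]mulrA [a (g i0) y * _]mulrCA mulrA.
    move/eqP: cb; rewrite addrC addr_eq0 => /eqP ->.
    move/eqP: cyb; rewrite addrC addr_eq0 => /eqP ->.
    by rewrite rmorphM mulrN opprK addrC mulrCA subrr.
  have := IHs _ us cy i si => /eqP; rewrite mulf_eq0 subr_eq0 (negPf yP) orbF.
  by move/eqP.
move=> i; rewrite inE => /predU1P[->|]; last exact: cs.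
have := c0 1; rewrite big_cons rmorph1 mulr1 big_seq big1 ?addr0 // => j /cs ->.
exact: mul0r.
Qed.

Lemma action_sum_monomials g (b : B) :
  a g b = \sum_(m <- msupp b) (b@_m)%:MP * a g 'X_[m].
Proof.
rewrite {1}[b]mpolyE rmorph_sum; apply: eq_bigr => m _.
by rewrite graded_ractZ mul_mpolyC.
Qed.

(** Induction on t with expansion along a new first column. The cofactors do not depend on that
    column, and one of them is nonzero by induction; if every monomial in the new column gave
    determinant 0, they would form a relation that contradicts Dedekind's independence, since
    monomials span B over k. *)
Lemma det_monomials t (g : 'I_t -> G) : injective g ->
  exists m : 'I_t -> 'X_{1..n}, \det (\matrix_(i, j) a (g i) 'X_[m j]) != 0.
Proof.
elim: t g => [|t IHt] g g_inj.
  by exists (fun=> 0%MM); rewrite det_mx00 oner_neq0.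
have [m mP] := IHt (g \o lift ord0) (inj_comp g_inj (@lift_inj _ _)).
pose A (b : B) : 'M[B]_t.+1 := \matrix_(i, j)
  a (g i) (if unlift ord0 j is Some j' then 'X_[m j'] else b).
have cofA i b : cofactor (A b) i ord0 = cofactor (A 0) i ord0.
  rewrite /cofactor; congr (_ * \det _); apply/matrixP => s u.
  by rewrite !mxE liftK.
have [cof [detA cof0]] : exists cof : 'I_t.+1 -> B,
    (forall b, \det (A b) = \sum_i cof i * a (g i) b) /\ cof ord0 <> 0.
  exists (fun i => cofactor (A 0) i ord0); split=> [b|].
    rewrite (expand_det_col _ ord0); apply: eq_bigr => i _.
    by rewrite cofA mulrC mxE unlift_none.
  move/eqP; rewrite /cofactor mulf_eq0 expf_eq0 oppr_eq0 oner_eq0 andbF /=.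
  apply/negP; apply: contra mP => /eqP det0; apply/eqP; rewrite -[RHS]det0.
  by congr (\det _); apply/matrixP => s u; rewrite !mxE liftK.
have [m0 m0P] : exists m0, \det (A 'X_[m0]) != 0.
  apply: contrapT => H; apply: cof0; move: (ord0) => i.
  have d0 mm : \sum_i cof i * a (g i) 'X_[mm] = 0.
    by rewrite -detA; apply: contrapT => d0; apply: H; exists mm; exact/eqP.
  apply: (@dedekind _ g (index_enum 'I_t.+1) _ g_inj) => [|b|].
  - exact: index_enum_uniq.
  - under eq_bigr do rewrite action_sum_monomials.
    rewrite sum_mul_exchange big1 // => mm _.
    by rewrite d0 mulr0.
  - exact: mem_index_enum.
exists (fun j => if unlift ord0 j is Some j' then m j' else m0).
rewrite (_ : \matrix_(i, j) _ = A 'X_[m0]) //; apply/matrixP => i j.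
by rewrite !mxE; case: unliftP.
Qed.

End Faithful.

(** Union bound: divisibility by c fails in some coordinate i with r_i < c_i, and this holds for a
    fraction of at most c_i / Q of the box. *)
Lemma card_not_dominated (n Q : nat) (c : 'X_{1..n}) : (0 < Q)%N ->
  (#|[set r : {ffun 'I_n -> 'I_Q} | ~~ (c <= [multinom (r i : nat) | i < n])%MM]|
     * Q <= mdeg c * Q ^ n)%N.
Proof.
move=> Q0; pose bad i := [set r : {ffun 'I_n -> 'I_Q} | (r i < c i)%N].
have sub : [set r : {ffun 'I_n -> 'I_Q} | ~~ (c <= [multinom (r i : nat) | i < n])%MM]
    \subset \bigcup_i bad i.
  apply/fintype.subsetP => r; rewrite inE => /mnm_lepP H.
  have [i ri] : exists i, ~~ (c i <= r i)%N.
    apply/existsP; apply: contra_notT H; rewrite negb_exists => /forallP H i.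
    by rewrite mnmE -[(_ <= _)%N]negbK; exact: H.
  by apply/bigcupP; exists i => //; rewrite inE ltnNge.
have card_bad i : (#|bad i| * Q <= c i * Q ^ n)%N.
  pose Fi (j : 'I_n) : pred 'I_Q := fun x => (j == i) ==> (x < c i)%N.
  have -> : #|bad i| = #|family Fi|.
    apply: eq_card => r; rewrite inE; apply/idP/familyP => [ri j|/(_ i)].
      by rewrite unfold_in /Fi; apply/implyP => /eqP ->.
    by rewrite unfold_in /Fi eqxx.
  rewrite card_family foldrE big_image /= (bigD1 i) //=.
  rewrite (eq_bigr (fun=> Q)) => [|j ji]; last first.
    by rewrite -[RHS]card_ord; apply: eq_card => x; rewrite unfold_in /Fi (negPf ji).
  have -> : (Q ^ n = Q * \prod_(j < n | j != i) Q)%N.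
    by rewrite -[n in LHS]card_ord -prod_nat_const (bigD1 i).
  rewrite -mulnA [(_ * Q)%N]mulnC leq_mul2r; apply/orP; right.
  have FiE x : (x \in Fi i) = (x < c i)%N by rewrite unfold_in /Fi eqxx.
  have [c0|ci] := posnP (c i); first by rewrite eq_card0 // => x; rewrite FiE c0.
  rewrite -[X in (_ <= X)%N]card_ord.
  have sur : {in Fi i &, injective (fun x : 'I_Q => insubd (Ordinal ci) (x : nat))}.
    move=> x y; rewrite !FiE => xc yc /(congr1 val); rewrite !val_insubd xc yc.
    exact: val_inj.
  by rewrite -(card_in_image sur); exact: max_card.
have cup : (#|\bigcup_i bad i| <= \sum_i #|bad i|)%N.
  elim/big_ind2: _ => [|A x A' x' Ax Ax'|//]; first by rewrite cards0.
  exact: leq_trans (leq_card_setU x x').1 (leq_add Ax Ax').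
apply: leq_trans (leq_mul (leq_trans (subset_leq_card sub) cup) (leqnn Q)) _.
rewrite big_distrl mdegE big_distrl; exact: leq_sum.
Qed.

Lemma dim_ffun_const (k : fieldType) (K : finType) :
  \dim {:{ffun K -> k^o}} = #|K|.
Proof. by rewrite dimvf /dim /= muln1. Qed.

Lemma tw_const_scaleC (G : finGroupType) (R : comNzRingType) (a : ring_action G R)
    (M : lmodType (twisted a)) b b' (x : M) :
  tw_const a b *: (tw_const a b' *: x) = tw_const a b' *: (tw_const a b *: x).
Proof. by rewrite !scalerA -!rmorphM mulrC. Qed.

(** * Spanning by orbits modulo the irrelevant ideal *)

Section RankBound.
Variables (k : fieldType) (p : nat) (chk : p \in [pchar k]) (e n : nat).
Variables (w : 'I_n -> nat) (G : finGroupType) (a : graded_action k w G).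
Variables (J : finType) (beta : J -> k) (Dk : k -> J -> k).
Hypothesis beta_basis : power_basis (p ^ e) beta Dk.
Local Notation B := {mpoly k[n]}.
Local Notation S := (twisted a).
Local Notation zeta := (@mpoly_zeta k p e n J beta).
Local Notation D := (@mpoly_digit k p chk e n J Dk).
Local Notation chB := (mpoly_pchar n chk).
Local Notation J' := (J * {ffun 'I_n -> 'I_(p ^ e)})%type.
Variables (F : lmodType S) (I : finType) (v : I -> F) (co : F -> I -> B).
Hypothesis v_basis : free_basis (v : I -> underlying F) co.
Variables (t : nat) (g : 'I_t -> G) (m : 'I_t -> 'X_{1..n}).
Local Notation A := (\matrix_(i, j) a (g i) 'X_[m j] : 'M[B]_t).
Hypothesis detA : \det A != 0.

Local Notation N := {ffun 'I_t -> frob_image chB e F}.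
Local Notation K := ('I_t * (I * J'))%type.

Definition std_basis (l : K) : N :=
  [ffun i => if i == l.1 then tw_const a (zeta l.2.2) *: v l.2.1 else 0].

Definition std_coord (x : N) (l : K) : B := D (co (x l.1) l.2.1) l.2.2.

Lemma std_basisP : free_basis (std_basis : K -> underlying N) std_coord.
Proof.
have zb := mpoly_power_basis chk n beta_basis.
exact: (ffun_basis _ (frob_basis chB v_basis zb)).
Qed.

Lemma std_generates (x : N) : x = \sum_l tw_const a (std_coord x l) *: std_basis l.
Proof. by rewrite {1}(basis_sum std_basisP x); apply: eq_bigr => l _; exact: underlyingE. Qed.

Definition reduction (x : N) : {ffun K -> k^o} := [ffun l => (std_coord x l)@_0%MM].

Definition orbit_gen (u : I * J') : N :=
  [ffun i => tw_const a 'X_[m i] *: (tw_const a (zeta u.2) *: v u.1 : F)].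

Lemma reductionD x y : reduction (x + y) = reduction x + reduction y.
Proof. by apply/ffunP => l; rewrite !ffunE (coordD std_basisP) mcoeffD. Qed.

Lemma reductionZ b x : reduction (tw_const a b *: x) = b@_0%MM *: reduction x.
Proof.
apply/ffunP => l; rewrite !ffunE -underlyingE (coordZ std_basisP).
exact: (rmorphM (mcoeff 0%MM)).
Qed.

Lemma power_scaleE b (x : N) i :
  (tw_const a b *: x) i = tw_const a (b ^+ (p ^ e)) *: (x i : F).
Proof. by rewrite ffunE; exact: frob_scaleE. Qed.

Lemma power_sumE T (s : seq T) (P : pred T) (f : T -> N) i :
  (\sum_(j <- s | P j) f j) i = \sum_(j <- s | P j) (f j i : F).
Proof. by rewrite sum_ffunE. Qed.

Lemma gact_power h (x : N) i : gact h x i = gact h (x i : F).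
Proof. by rewrite gact_ffun frob_gactE. Qed.

Let c : 'X_{1..n} := mlead (\det A).
Let Y := {l : K | ~~ (c <= mnm_small l.2.2.2)%MM}.
Let W := (<<codom (fun ug : (I * J') * G => reduction (gact ug.2 (orbit_gen ug.1))) ++
  codom (fun y : Y => reduction (std_basis (val y)))>>)%VS.

(** [Sp] is closed under sums and under the action of B on N through p^e-th powers, so spanning
    modulo the irrelevant ideal can be argued with elements of N itself. *)
Let Sp (x : N) := reduction x \in W.

Let SpD x y : Sp x -> Sp y -> Sp (x + y).
Proof. by rewrite /Sp reductionD; exact: memvD. Qed.

Let SpZ b x : Sp x -> Sp (tw_const a b *: x).
Proof. by rewrite /Sp reductionZ; exact: memvZ. Qed.

Let Sp0 : Sp 0.
Proof. by rewrite /Sp -(scale0r 0) -(rmorph0 (tw_const a)) reductionZ mcoeff0 scale0r mem0v. Qed.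

Let Sp_sum T (s : seq T) (P : pred T) (f : T -> N) :
  (forall i, P i -> Sp (f i)) -> Sp (\sum_(i <- s | P i) f i).
Proof. by move=> Pf; elim/big_ind: _ => //; exact: SpD. Qed.

Let SpN x : Sp x -> Sp (- x).
Proof.
move=> Sx; have -> : - x = tw_const a (-1) *: x by rewrite rmorphN rmorph1 scaleN1r.
exact: SpZ.
Qed.

Let Sp_orbit h u : Sp (gact h (orbit_gen u)).
Proof.
apply: memv_span; rewrite mem_cat; apply/orP; left.
by apply/codomP; exists (u, h).
Qed.

Let Sp_std l b : b@_0%MM = 0 \/ ~~ (c <= mnm_small l.2.2.2)%MM ->
  Sp (tw_const a b *: std_basis l).
Proof.
move=> [b0|yl]; first by rewrite /Sp reductionZ b0 scale0r mem0v.
apply/SpZ/memv_span; rewrite mem_cat; apply/orP; right.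
by apply/codomP; exists (exist _ l yl).
Qed.

Lemma frob_expansion (z : F) : z = \sum_u tw_const a (D (co z u.1) u.2 ^+ (p ^ e)) *:
  (tw_const a (zeta u.2) *: v u.1).
Proof.
have zb := mpoly_power_basis chk n beta_basis.
rewrite {1}(basis_sum (frob_basis chB v_basis zb) z); apply: eq_bigr => u _.
exact: frob_scaleE.
Qed.

(** In the expansion of z over the basis of ^eF the coefficients are p^e-th powers, hence scalars of
    N. So the orbits of the generators account for the vectors built from an arbitrary z. *)
Let Sp_translate h (z : F) :
  Sp [ffun i => tw_const a (a h 'X_[m i]) *: gact h z].
Proof.
pose d u := D (co z u.1) u.2.
have -> : [ffun i => tw_const a (a h 'X_[m i]) *: gact h z] =
    \sum_u tw_const a (a h (d u)) *: gact h (orbit_gen u) :> N.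
  apply/ffunP => i; rewrite ffunE power_sumE {1}(frob_expansion z) gact_sum scaler_sumr.
  apply: eq_bigr => u _; rewrite power_scaleE gact_power ffunE !gactZ.
  by rewrite [LHS](tw_const_scaleC (M := F)) (rmorphXn (a h)).
by apply: Sp_sum => u _; apply/SpZ/Sp_orbit.
Qed.

Let single (i : 'I_t) (z : F) : N := [ffun j => if j == i then z else 0].

Let singleD i z z' : single i (z + z') = single i z + single i z'.
Proof. by apply/ffunP => j; rewrite !ffunE; case: eqP => // _; rewrite addr0. Qed.

Let single0 i : single i 0 = 0.
Proof. by apply/ffunP => j; rewrite !ffunE; case: eqP. Qed.

Let single_sum i T (s : seq T) (P : pred T) (f : T -> F) :
  single i (\sum_(j <- s | P j) f j) = \sum_(j <- s | P j) single i (f j).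
Proof. by apply: (big_morph (single i)); [exact: singleD | exact: single0]. Qed.

(* Cramer's rule: over B, the translates of the orbit generators span det A
   times everything. *)
Let Sp_det i (z : F) : Sp (single i (tw_const a (\det A) *: z)).
Proof.
(* The vector translated by g_s is built from g_s^-1 applied to the adjugate multiple of z, so that
   g_s undoes this twist and the sum over s gives the product of adjugate and matrix. *)
have -> : single i (tw_const a (\det A) *: z) = \sum_s
    ([ffun j => tw_const a (a (g s) 'X_[m j]) *:
       gact (g s) (gact (g s)^-1 (tw_const a ((\adj A) i s) *: z))] : N).
  apply/ffunP => j; rewrite ffunE power_sumE.
  under eq_bigr do rewrite ffunE gactVK scalerA -rmorphM.
  rewrite -scaler_suml -rmorph_sum.
  have -> : \sum_s a (g s) 'X_[m j] * (\adj A) i s = (\adj A *m A) i j.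
    by rewrite [RHS]mxE; apply: eq_bigr => s _; rewrite [A s j]mxE mulrC.
  rewrite mul_adj_mx mxE eq_sym; case: eqP => _; first by rewrite mulr1n.
  by rewrite mulr0n rmorph0 scale0r.
by apply: Sp_sum => s _; exact: Sp_translate.
Qed.

(* The leading monomial c of det A either does not divide X^m', and Sp_std
   applies, or it does, and a multiple of det A is subtracted. *)
Let Sp_monomial i l m' d : Sp (single i (tw_const a (d *: 'X_[m']) *: v l)).
Proof.
elim/(@ltmwf n): m' d => m' IHm d.
have [cm|cm] := boolP (c <= m')%MM; last first.
  have -> : single i (tw_const a (d *: 'X_[m']) *: v l) =
      \sum_j tw_const a (Dk d j *: 'X_[mnm_quo p e m']) *:
        std_basis (i, (l, (j, mnm_rem chk e m'))).
    have Ed : d *: 'X_[m'] = \sum_j (Dk d j *: 'X_[mnm_quo p e m']) ^+ (p ^ e) *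
        zeta (j, mnm_rem chk e m').
      rewrite {1}(mnm_quo_rem chk e m') {1}(beta_basis.1 d) scaler_suml.
      apply: eq_bigr => j _; rewrite /mpoly_zeta /= exprZn mpolyXn -!mul_mpolyC.
      rewrite mpolyXD mpolyCM; move: (_%:MP) (_%:MP) ('X_[_]) ('X_[_]) => *.
      exact: mulrACA.
    apply/ffunP => i'; rewrite ffunE power_sumE.
    under eq_bigr do rewrite power_scaleE ffunE /=.
    case: eqP => _; last by rewrite big1 // => j _; rewrite scaler0.
    rewrite Ed rmorph_sum scaler_suml; apply: eq_bigr => j _.
    by rewrite scalerA -rmorphM.
  apply: Sp_sum => j _; apply: Sp_std => /=.
  (* With quotient 0 the exponent m' is its own remainder, which c does not divide; otherwise the
     coefficient has no constant term and vanishes under reduction. *)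
  have [q0|q0] := eqVneq (mnm_quo p e m') 0%MM.
    right; apply: contra cm => cm; rewrite (mnm_quo_rem chk e m') q0.
    by rewrite (_ : (0 *+ _ + _)%MM = mnm_small (mnm_rem chk e m')) //; apply/mnmP => j'; rewrite mnmDE mulmnE mnm0E.
  by left; rewrite mcoeffZ mcoeffX (negPf q0) mulr0.
pose Delta := \det A.
have lc0 : Delta@_c != 0 by rewrite /Delta /c mleadc_eq0.
(* The multiplier b turns the leading term of Delta into d X^m'; all other terms of Delta b are
   smaller than m' in the monomial order. *)
pose b : B := ((Delta@_c)^-1 * d) *: 'X_[(m' - c)%MM].
have Eb : Delta * b = d *: 'X_[m'] + \sum_(m1 <- msupp Delta | m1 != c)
    (Delta@_m1 * ((Delta@_c)^-1 * d)) *: 'X_[(m1 + (m' - c))%MM].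
  have E m1 : (Delta@_m1 *: 'X_[m1]) * b =
      (Delta@_m1 * ((Delta@_c)^-1 * d)) *: 'X_[(m1 + (m' - c))%MM].
    by rewrite /b -!mul_mpolyC mpolyXD mpolyCM; move: (_%:MP) (_%:MP) ('X_[_]) ('X_[_]) => *; rewrite mulrACA.
  rewrite {1}[Delta]mpolyE mulr_suml (bigD1_seq c) ?msupp_uniq ?mlead_supp //=.
  under eq_bigr do rewrite E.
  by rewrite E mulrA mulfV // mul1r addmC submK.
have -> : single i (tw_const a (d *: 'X_[m']) *: v l) =
    single i (tw_const a Delta *: (tw_const a b *: v l)) +
    \sum_(m1 <- msupp Delta | m1 != c) - single i (tw_const a
      ((Delta@_m1 * ((Delta@_c)^-1 * d)) *: 'X_[(m1 + (m' - c))%MM]) *: v l).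
  rewrite sumrN -single_sum -scaler_suml -rmorph_sum scalerA -rmorphM Eb.
  by rewrite rmorphD scalerDl singleD addrK.
apply: SpD; first exact: Sp_det.
rewrite big_seq_cond; apply: Sp_sum => m1 /andP[m1D m1c]; apply/SpN/IHm.
rewrite -{2}(submK cm) [(m' - c + c)%MM]addmC ltmc_add2l.
by rewrite lt_neqAle m1c /=; exact: msupp_le_mlead.
Qed.

Let reduction_sum (z : {ffun K -> k^o}) : z = \sum_l z l *: reduction (std_basis l).
Proof.
apply/ffunP => l; rewrite sum_ffunE (bigD1 l) //= !ffunE.
rewrite (coord_basis std_basisP) eqxx mcoeff1 eqxx big1 ?addr0 => [|l' /negPf ll'].
  by rewrite [RHS]mulr1.
by rewrite !ffunE (coord_basis std_basisP) eq_sym ll' mcoeff0 scaler0.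
Qed.

Lemma reduction_span z : z \in W.
Proof.
have SpT x : Sp x.
  have -> : x = \sum_i single i (x i).
    apply/ffunP => j; rewrite sum_ffunE (bigD1 j) //= ffunE eqxx.
    by rewrite big1 ?addr0 // => i /negPf ij; rewrite ffunE eq_sym ij.
  apply: Sp_sum => i _; rewrite (basis_sum v_basis (x i)) single_sum.
  apply: Sp_sum => l _; rewrite underlyingE (mpolyE (co (x i) l)) rmorph_sum.
  rewrite scaler_suml single_sum; apply: Sp_sum => m' _; exact: Sp_monomial.
rewrite [z]reduction_sum.
by apply: memv_suml => l _; apply: memvZ; exact: SpT.
Qed.

Lemma reduction_std_span z : z \in <<codom (reduction \o std_basis)>>%VS.
Proof.
rewrite [z]reduction_sum.
apply: memv_suml => l _; apply/memvZ/memv_span; exact: (codom_f (reduction \o std_basis)).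
Qed.

Lemma card_small_digits :
  (#|{: Y}| * p ^ e <= t * (#|I| * (#|J| * (mdeg c * (p ^ e) ^ n))))%N.
Proof.
pose bad := [set r : {ffun 'I_n -> 'I_(p ^ e)} | ~~ (c <= mnm_small r)%MM].
have -> : #|{: Y}| = (t * (#|I| * (#|J| * #|bad|)))%N.
  rewrite card_sig -[t in RHS]card_ord -[#|bad|]/(#|mem bad|).
  transitivity #|[set l : K | l.2.2.2 \in bad]|.
    by apply: eq_card => l; rewrite !inE.
  have -> : [set l : K | l.2.2.2 \in bad] = 
      finset.setX [set: 'I_t] (finset.setX [set: I] (finset.setX [set: J] bad)).
    by apply/setP => -[i [l [j r]]]; rewrite !inE.
  by rewrite !finset.cardsX !cardsT.
rewrite -!mulnA; do 3!rewrite leq_mul2l; apply/orP; right; apply/orP; right.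
by apply/orP; right; apply: card_not_dominated; exact: frob_pow_gt0 chk e.
Qed.

End RankBound.

(** * Limits *)

Section Limit.
Variables (R : realType) (D : theta_data).
Hypothesis top_exists : forall M : tobj D, exists l, top_length M l.
Hypothesis top_sum : forall (M M1 M2 : tobj D) l l1 l2, is_sum M M1 M2 ->
  top_length M l -> top_length M1 l1 -> top_length M2 l2 -> (l1 + l2 <= l)%N.
Hypothesis top_gt0 : forall (M : tobj D) l, ~ is_zero M -> top_length M l -> (0 < l)%N.
Hypothesis zero_sum : forall M : tobj D, is_zero M -> is_sum M M M.

(** After f / g [M0] is subtracted, [M0] keeps the coefficient -s / (g^2 P^e), by the rank count,
    and [N] has coefficient 1 / (g P^e) and top length at most s. Both contributions are of order s
    / P^e, hence O(p^-e). *)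
Lemma theta_limit_split (u : nat -> formal_sum R D) (M0 : tobj D) (p P C g f : nat) :
  (1 < p)%N -> (0 < P)%N -> (0 < g)%N ->
  (forall e, exists r s (N : tobj D),
    [/\ forall l, top_length N l -> (l <= s)%N, (r * g + s = f * g * P ^ e)%N,
        (s * p ^ e <= C * P ^ e)%N &
        theta_eq (u e) [:: ((P ^ e)%:R^-1 / g%:R * r%:R, M0);
                           ((P ^ e)%:R^-1 / g%:R, N)]]) ->
  theta_limit u [:: (f%:R / g%:R, M0)].
Proof.
move=> p1 P0 g0 uP eps eps0; have [l0 Ml0] := top_exists M0.
(* The norm will be at most (l0 + 1) s / P^e <= K / p^e, and e < p^e turns e >= K / eps into the
   required bound. *)
pose K : R := C%:R * (l0%:R + 1); exists (Num.bound (K / eps)) => e Ne.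
have [r [s [N [Ns rs sC ue]]]] := uP e.
have [lN NlN] := top_exists N; have {}Ns := Ns _ NlN.
have gR : (0 : R) < g%:R by rewrite ltr0n.
have PR : (0 : R) < (P ^ e)%:R by rewrite ltr0n expn_gt0 P0.
have pR : (0 : R) < (p ^ e)%:R by rewrite ltr0n expn_gt0 (ltnW p1).
pose c := (P ^ e)%:R^-1 / g%:R * r%:R - f%:R / g%:R : R.
have [|i M1|x nx xle] := @theta_norm_le R D top_exists top_sum top_gt0 zero_sum
    [:: (c, M0); ((P ^ e)%:R^-1 / g%:R, N)] [:: l0; lN].
- by [].
- by case: i => [|[|]].
exists x; split.
  have [n [c' [M' [l' [? ? eq_u ? ?]]]]] := nx.
  exists n, c', M', l'; split=> //; apply: theta_trans eq_u.
  apply: theta_trans (theta_eq_catr _ ue) _ => /=.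
  apply: theta_trans (theta_eq_catl [:: _] (theta_comm [:: _] [:: _])) _ => /=.
  rewrite mulN1r; apply: (theta_eq_catr [:: _] (a := [:: _; _]) (a' := [:: _])).
  exact/theta_sym/theta_scaleD.
apply: le_lt_trans xle _; rewrite /= !big_cons big_nil addr0 /=.
have rE : r%:R * g%:R = f%:R * g%:R * (P ^ e)%:R - s%:R :> R.
  by rewrite -!natrM -rs natrD addrK.
have cE : c = - (s%:R / (g%:R * g%:R * (P ^ e)%:R)).
  rewrite /c; have -> : r%:R = f%:R * (P ^ e)%:R - s%:R / g%:R :> R.
    by apply: (mulIf (lt0r_neq0 gR)); rewrite rE mulrBl mulfVK ?lt0r_neq0 // mulrAC.
  by field; rewrite !lt0r_neq0.
rewrite cE normrN !ger0_norm ?divr_ge0 ?mulr_ge0 ?invr_ge0 ?ler0n //.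
have sp : s%:R / (P ^ e)%:R <= C%:R / (p ^ e)%:R :> R.
  by rewrite ler_pdivrMr // mulrAC ler_pdivlMr // -!natrM ler_nat.
have g1 : (1 : R) <= g%:R by rewrite ler1n.
apply: le_lt_trans (_ : s%:R / (P ^ e)%:R * (l0%:R + 1) < _).
  rewrite mulrDr; apply: lerD.
    rewrite ler_wpM2r // ler_wpM2l // lef_pV2 ?posrE ?mulr_gt0 //.
    by rewrite ler_peMl ?(ltW PR) ?mulr_ege1.
  rewrite mulr1 mulrC mulrA ler_pdivrMr // -mulrA [_^-1 * g%:R]mulrC mulrA.
  apply: ler_wpM2r; first by rewrite invr_ge0 ltW.
  rewrite -natrM ler_nat; apply: leq_trans Ns _.
  by rewrite leq_pmulr.
apply: le_lt_trans (ler_wpM2r _ sp) _; first by rewrite addr_ge0.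
rewrite mulrAC ltr_pdivrMr // -/K -ltr_pdivrMl // mulrC.
have K0 : 0 <= K / eps by rewrite divr_ge0 ?(ltW eps0) // mulr_ge0 // addr_ge0.
apply: lt_trans (archi_boundP K0) _; rewrite ltr_nat.
exact: leq_ltn_trans Ne (ltn_expl e p1).
Qed.

End Limit.

Lemma frob_deltaE (R : realType) (p q n e : nat) : (1 < p)%N -> (0 < q)%N ->
  powR p%:R (- (frob_delta R n p q * e%:R)) = ((p ^ n * q) ^ e)%:R^-1.
Proof.
move=> p1 q0; have pR : (1 : R) < p%:R by rewrite ltr1n.
have p0 : (0 : R) < p%:R by apply: lt_trans pR.
have ln0 : ln (p%:R : R) != 0 by rewrite lt0r_neq0 // ln_gt0.
rewrite powRN; congr (_^-1); rewrite powRrM powR_mulrn ?powR_ge0 // natrX.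
congr (_ ^+ e); rewrite /frob_delta powRD ?(lt0r_neq0 p0) ?implybT //.
rewrite powR_mulrn ?ltW // natrM natrX; congr (_ * _).
rewrite /powR (negPf (lt0r_neq0 p0)) divfK // lnK // posrE ltr0n.
exact: q0.
Qed.

(** * The weighted polynomial ring and homogeneous bases over it *)

Section PolynomialGrading.
Variables (k : fieldType) (n : nat) (w : 'I_n -> nat).
Hypothesis w_gt0 : forall i, (0 < w i)%N.
Local Notation B := {mpoly k[n]}.

Lemma wgrading_pos d (b : B) : (0 < d)%N -> wgrading k w d b -> b@_0%MM = 0.
Proof.
move=> d0 bd; apply: (dhomog_nemf_coeff bd).
by rewrite /= wdeg0 eq_sym -lt0n.
Qed.

Lemma wgrading_0 (b : B) : wgrading k w 0 b -> b = (b@_0%MM)%:MP.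
Proof.
move=> b0; apply/mpolyP => m; rewrite mcoeffC.
have [->|m0] := eqVneq m 0%MM; first by rewrite mulr1.
rewrite mulr0; apply: (dhomog_nemf_coeff b0).
by rewrite /= -lt0n wdeg_gt0.
Qed.

Lemma wgrading_monomial (c : k) m : wgrading k w (wdeg w m) (c *: 'X_[m]).
Proof. by apply: dhomogZ; rewrite dhomogX. Qed.

End PolynomialGrading.

Section GradedBases.
Variables (k : fieldType) (n : nat) (w : 'I_n -> nat).
Hypothesis w_gt0 : forall i, (0 < w i)%N.
Variables (G : finGroupType) (a : graded_action k w G).
Local Notation B := {mpoly k[n]}.
Local Notation S := (twisted a).

Let eps : {rmorphism B -> k} := mcoeff 0%MM.
Let iota : {rmorphism k -> B} := @mpolyC n k.

Lemma poly_homogeneous_basis (M : graded_module (tw_wgrading a)) (I0 Y Z : finType)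
    (y0 : I0 -> M) co0 (y : Y -> M) (dy : Y -> rat) (z : Z -> M) (dz : Z -> rat) :
  free_basis (y0 : I0 -> underlying M) co0 ->
  (forall i, gcomp (dy i) (y i)) -> (forall i, gcomp (dz i) (z i)) ->
  (forall x : M, exists c : Y -> B, x = \sum_i tw_const a (c i) *: y i) ->
  #|Z| = #|I0| ->
  (forall j, exists c : Z -> k, forall i,
     (co0 (y j) i)@_0%MM = \sum_l c l * (co0 (z l) i)@_0%MM) ->
  exists co, free_basis (z : Z -> underlying M) co.
Proof.
apply: (@homogeneous_basis G _ a k iota eps).
- exact: mpolyCK.
- by move=> d b; exact: wgrading_pos.
- by move=> b; exact: (wgrading_0 w_gt0).
Qed.

(** The given basis need not be homogeneous, but its homogeneous components generate F. A selection
    of them whose reductions form a basis of k^f is a basis of F by graded Nakayama. *)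
Lemma exists_homogeneous_basis (F : graded_module (tw_wgrading a)) f :
  free_of_rank (underlying F) f ->
  exists (I : finType) (v : I -> F) (dv : I -> rat) co,
    [/\ #|I| = f, free_basis (v : I -> underlying F) co &
        forall i, gcomp (dv i) (v i)].
Proof.
move=> /free_of_rank_basis [v0 [co0 vb0]].
pose H := @gcomp_grading _ _ F.
pose Ds := undup (flatten [seq gr_supp H (v0 i) | i <- enum 'I_f]).
pose Y := ('I_f * 'I_(size Ds))%type.
pose dy (j : Y) := nth 0 Ds j.2.
pose y (j : Y) : F := gr_proj H (dy j) (v0 j.1).
have v0E i : v0 i = \sum_(t < size Ds) y (i, t).
  rewrite {1}(gr_sum H (v0 i)) (big_uniq_extend (u := Ds)) => [||||j].
  - by rewrite (big_nth 0) big_mkord.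
  - exact: gr_suppP.
  - exact: undup_uniq.
  - move=> nu nuv; rewrite mem_undup; apply/flattenP.
    by exists (gr_supp H (v0 i)) => //; apply: map_f; rewrite mem_enum.
  - exact: gr_proj_out.
have yP (x : F) : exists c : Y -> B, x = \sum_j tw_const a (c j) *: y j.
  exists (fun j => co0 x j.1); rewrite {1}(basis_sum vb0 x).
  transitivity (\sum_i \sum_t tw_const a (co0 x i) *: y (i, t)).
    by apply: eq_bigr => i _; rewrite underlyingE {1}v0E scaler_sumr.
  by rewrite pair_bigA.
pose red (x : F) : {ffun 'I_f -> k^o} := [ffun i => (co0 x i)@_0%MM].
have redD x x' : red (x + x') = red x + red x'.
  by apply/ffunP => i; rewrite !ffunE (coordD vb0) mcoeffD.
have red0 : red 0 = 0 by apply/ffunP => i; rewrite !ffunE (coord0 vb0) mcoeff0.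
have redZ b x : red (tw_const a b *: x) = b@_0%MM *: red x.
  apply/ffunP => i; rewrite !ffunE -underlyingE (coordZ vb0).
  exact: (rmorphM (mcoeff 0%MM)).
have spY z : z \in <<codom (red \o y)>>%VS.
  have -> : z = red (\sum_i tw_const a (z i)%:MP *: v0 i).
    apply/ffunP => i; rewrite ffunE (coordK vb0 (fun i => (z i)%:MP)).
    by rewrite mcoeffC eqxx mulr1.
  rewrite (big_morph red redD red0); apply: memv_suml => i _; rewrite redZ.
  apply: memvZ; rewrite v0E (big_morph red redD red0); apply: memv_suml => j _.
  by apply: memv_span; exact: (codom_f (red \o y)).
(* The family to be completed is empty, so this extracts a basis of k^f from the reductions of the
   components. *)
have [K' [kappa [cardK spK]]] := @complete_basis k _ 'I_0 Y (fun=> 0) (red \o y)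
  (eq_ind_r (fun s => free s) (nil_free _) (size0nil (etrans (size_codom _) (card_ord 0)))) spY.
have cK : #|K'| = #|'I_f| by rewrite -[LHS]add0n -[0%N in LHS]card_ord cardK dim_ffun_const.
have y_hom j : gcomp (dy j) (y j) by exact: gr_projP.
have [|co zb] := poly_homogeneous_basis (z := y \o kappa) (dz := dy \o kappa)
    vb0 y_hom (fun i => y_hom (kappa i)) yP cK.
  move=> j; have [c cE] := spK (red (y j)); exists (fun l => c (inr l)) => i.
  have := congr1 (fun h : {ffun _ -> _} => h i) cE.
  rewrite big_ord0 add0r sum_ffunE !ffunE => ->.
  by apply: eq_bigr => l _; rewrite !ffunE.
exists K', (y \o kappa), (dy \o kappa), co; split=> [||i] //.
  by rewrite cK card_ord.
exact: y_hom.
Qed.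

End GradedBases.

Section MainBasis.
Variables (k : fieldType) (p : nat) (chk : p \in [pchar k]) (n : nat).
Variable w : 'I_n -> nat.
Hypothesis w_gt0 : forall i, (0 < w i)%N.
Variables (G : finGroupType) (a : graded_action k w G).
Local Notation B := {mpoly k[n]}.
Local Notation S := (twisted a).
Variables (F : graded_module (tw_wgrading a)) (I : finType) (v : I -> F).
Variables (dv : I -> rat) (co : F -> I -> B).
Hypothesis v_basis : free_basis (v : I -> underlying F) co.
Hypothesis v_hom : forall i, gcomp (dv i) (v i).
Variable m : 'I_#|G| -> 'X_{1..n}.
Local Notation A :=
  (\matrix_(i, j) a (enum_val i : G) 'X_[m j] : 'M[B]_#|G|).
Hypothesis detA : \det A != 0.
Variable e : nat.
Variables (J : finType) (beta : J -> k) (Dk : k -> J -> k).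
Hypothesis beta_basis : power_basis (p ^ e) beta Dk.
Local Notation chB := (mpoly_pchar n chk).
Local Notation J' := (J * {ffun 'I_n -> 'I_(p ^ e)})%type.

Definition translate_shift (i : 'I_#|G|) : rat := (wdeg w (m i))%:R / p%:R ^+ e.

(* The i-th copy is shifted so that the orbit generators are homogeneous. *)
Definition frob_power : graded_module (tw_wgrading a) :=
  gpow (graded_frob_image chB e F) translate_shift.

Local Notation N := frob_power.
Local Notation std := (@std_basis k p chk e n w G a J beta F I v #|G|).
Local Notation orb := (@orbit_gen k p chk e n w G a J beta F I v #|G| m).
Local Notation stdP := (std_basisP chk beta_basis v_basis #|G|).

Let orb_deg (u : I * J') : rat :=
  ((wdeg w (mnm_small u.2.2))%:R + dv u.1) / p%:R ^+ e.

Let pe0 : (p%:R ^+ e : rat) != 0.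
Proof. by rewrite expf_neq0 // pnatr_eq0 -lt0n (frob_p_gt0 chk). Qed.

Lemma zeta_hom (u : I * J') : @gcomp _ _ F (p%:R ^+ e * orb_deg u)
  (tw_const a (mpoly_zeta beta u.2) *: v u.1).
Proof.
rewrite mulrC mulfVK //; apply: gcompZ (v_hom _).
by apply: (tw_const_comp (graded_ract_homog a)); exact: wgrading_monomial.
Qed.

Lemma orbit_gen_hom u : @gcomp _ _ N (orb_deg u) (orb u).
Proof.
move=> i; rewrite ffunE.
suff h : @gcomp _ _ F (p%:R ^+ e * (translate_shift i + orb_deg u))
  (tw_const a 'X_[m i] *: (tw_const a (mpoly_zeta beta u.2) *: v u.1)) by exact: h.
rewrite mulrDr /translate_shift [p%:R ^+ e * (_ / _)]mulrC mulfVK //.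
apply: gcompZ (zeta_hom u); apply: (tw_const_comp (graded_ract_homog a)).
by have := wgrading_monomial w (1 : k) (m i); rewrite scale1r.
Qed.

Lemma std_basis_hom l :
  @gcomp _ _ N (orb_deg l.2 - translate_shift l.1) (std l).
Proof.
move=> i; rewrite ffunE; case: eqP => [->|_]; last exact: gcomp0.
by rewrite addrC subrK; exact: zeta_hom.
Qed.

(** The selection is linear algebra over k; it lifts to a basis over B because the orbit vectors and
    the standard vectors are all homogeneous. In the bound, one factor #|G| is the number of basis
    vectors per lost orbit, the other the number of copies of ^eF. *)
Lemma orbit_basis : exists r (x : 'I_r -> N) (K' : finType)
    (z : ('I_r * G) + K' -> N) coz (dz : ('I_r * G) + K' -> rat),
  [/\ free_basis (z : _ -> underlying N) coz,
      forall u h, z (inl (u, h)) = gact h (x u),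
      forall i, gcomp (dz i) (z i),
      (r * #|G| + #|K'| = #|I| * #|G| * (#|J| * (p ^ e) ^ n))%N &
      (#|K'| * p ^ e <=
        #|G| * #|G| * #|I| * mdeg (mlead (\det A)) * (#|J| * (p ^ e) ^ n))%N].
Proof.
have cardJ' : #|{: J'}| = (#|J| * (p ^ e) ^ n)%N.
  by rewrite card_prod card_ffun !card_ord.
have [|r [u [K' [kappa [dimE cardU spK]]]]] := orbit_selection _
    (reduction_span chk beta_basis v_basis detA)
    (reduction_std_span chk beta_basis v_basis (t := #|G|)).
  by rewrite dim_ffun_const !card_prod card_ord mulnC.
rewrite dim_ffun_const !card_prod card_ord card_ffun !card_ord in dimE.
pose z (i : ('I_r * G) + K') : N :=
  match i with inl i => gact i.2 (orb (u i.1)) | inr j => std (kappa j) end.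
pose dz (i : ('I_r * G) + K') := match i with
  inl i => orb_deg (u i.1)
  | inr j => orb_deg (kappa j).2 - translate_shift (kappa j).1 end.
have z_hom i : gcomp (dz i) (z i).
  case: i => [[i h]|j]; last exact: std_basis_hom.
  exact: (gact_hom (M := N) h (orbit_gen_hom (u i))).
have zP l : exists c : ('I_r * G) + K' -> k, forall i,
    (std_coord Dk co (std l) i)@_0%MM =
    \sum_j c j * (std_coord Dk co (z j) i)@_0%MM.
  have [c cE] := spK (reduction Dk co (std l)); exists c => i.
  have := congr1 (fun h : {ffun _ -> _} => h i) cE.
  rewrite ffunE => ->; rewrite big_sumType /= ffunE; congr (_ + _).
    by rewrite sum_ffunE; apply: eq_bigr => j _; rewrite !ffunE.
  by rewrite sum_ffunE; apply: eq_bigr => j _; rewrite !ffunE.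
have stdT (x : N) : exists c, x = \sum_i tw_const a (c i) *: std i.
  exists (std_coord Dk co x); exact (std_generates beta_basis v_basis x).
have [|coz zb] := poly_homogeneous_basis (M := N) w_gt0 stdP std_basis_hom
    z_hom stdT _ zP.
  by rewrite card_sum !card_prod !card_ord dimE card_ffun !card_ord.
exists r, (fun i => orb (u i)), K', z, coz, dz; split=> //.
  by rewrite dimE mulnCA mulnA.
(* By the dimension count #|K'| is #|G| times the number of orbits not selected, and these are at
   most as many as the standard vectors that had to be added. *)
have K'le : (#|K'| <= #|G| * #|{: {l : 'I_#|G| * (I * J') |
    ~~ (mlead (\det A) <= mnm_small l.2.2.2)%MM}}|)%N.
  rewrite -(leq_add2l (r * #|G|)) dimE mulnC mulnC [(r * _)%N]mulnC -mulnDr.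
  rewrite leq_mul2l; apply/orP; right.
  by move: cardU; rewrite !card_prod card_ffun !card_ord.
apply: leq_trans (leq_mul K'le (leqnn (p ^ e))) _; rewrite -!mulnA leq_mul2l.
apply/orP; right; rewrite [(mdeg _ * _)%N]mulnCA.
exact: card_small_digits.
Qed.

End MainBasis.

Lemma basis_finitely_generated (G : finGroupType) (R : comNzRingType)
    (a : ring_action G R) (M : lmodType (twisted a)) (I : finType) (v : I -> M) co :
  free_basis (v : I -> underlying M) co -> finitely_generated M.
Proof.
move=> vb; apply: (generated_underlying (v := v)) => x; exists (co x).
by rewrite {1}(basis_sum vb x); apply: eq_bigr => i _; exact: underlyingE.
Qed.

(** * Semilinear maps between powers of direct images *)

Section FrobeniusMaps.
Variables (G : finGroupType) (R R' : comNzRingType).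
Variables (a : ring_action G R) (a' : ring_action G R') (theta : {rmorphism R -> R'}).
Variables (M : lmodType (twisted a)) (M' : lmodType (twisted a')) (j : M -> M').
Hypothesis jl : semilinear theta (j : underlying M -> underlying M').
Variables (p : nat) (chR : p \in [pchar R]) (chR' : p \in [pchar R']) (e : nat).
Variable U : finType.

Definition frob_map (y : {ffun U -> frob_image chR e M}) :
    {ffun U -> frob_image chR' e M'} := [ffun u => j (y u)].

Lemma frob_map_semilinear : semilinear theta
  (frob_map : underlying {ffun U -> frob_image chR e M} ->
              underlying {ffun U -> frob_image chR' e M'}).
Proof.
split=> [y y'|b y]; apply/ffunP => u; rewrite !ffunE; first exact: jl.1.
transitivity (j (tw_const a (b ^+ (p ^ e)) *: (y u : M))).
  congr j; exact: frob_scaleE.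
transitivity (tw_const a' (theta b ^+ (p ^ e)) *: (j (y u) : M')).
  by rewrite -rmorphXn; exact: jl.2.
exact/esym/frob_scaleE.
Qed.

Lemma frob_map_single u b (z : M) :
  frob_map [ffun u' => if u' == u then (tw_const a b *: z : M) else 0] =
  [ffun u' => if u' == u then (tw_const a' (theta b) *: j z : M') else 0].
Proof.
apply/ffunP => u'; rewrite !ffunE; case: eqP => _; first exact: jl.2.
by have := jl.2 0 0; rewrite rmorph0 !scale0r.
Qed.

Lemma frob_map_gact g y : (forall x, j (gact g x) = gact g (j x)) ->
  frob_map (gact g y) = gact g (frob_map y).
Proof.
move=> jg; apply/ffunP => u; rewrite [RHS]gact_ffun [LHS]ffunE gact_ffun ffunE.
transitivity (j (gact g (y u : M))); first by congr j; exact: frob_gactE.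
by rewrite jg; exact/esym/frob_gactE.
Qed.

End FrobeniusMaps.

(** * Splitting off the free part of a class *)

Section Splitting.
Variables (G : finGroupType) (R : comNzRingType) (a : ring_action G R).
Variables (k : fieldType) (iota : {rmorphism k -> R}) (eps : {rmorphism R -> k}).
Hypothesis iotaK : cancel iota eps.
Local Notation S := (twisted a).
Variable K : realType.

Lemma theta_circ_split (gr : ring_grading R)
    (gr_act : forall n g r, gr n r -> gr n (a g r))
    (gr_pos : forall n b, (0 < n)%N -> gr n b -> eps b = 0)
    (gr_0 : forall b, gr 0%N b -> b = iota (eps b))
    (M : graded_module (tw_grading gr_act)) r (I : finType) (x : 'I_r -> M)
    (z : ('I_r * G) + I -> M) co (dz : ('I_r * G) + I -> rat)
    (fM : finitely_generated M) (c : K) :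
  free_basis (z : _ -> underlying M) co ->
  (forall u g, z (inl (u, g)) = gact g (x u)) -> (forall i, gcomp (dz i) (z i)) ->
  exists N : tobj (theta_circ (tw_grading gr_act)),
    (forall l, top_length N l -> (l <= #|I|)%N) /\
    theta_eq (D := theta_circ (tw_grading gr_act)) [:: (c, FgGradedModule fM)]
      [:: (c * r%:R, regular_circ (tw_grading gr_act)); (c, N)].
Proof.
move=> zb z_orbit z_hom; pose N := split_gmodule zb z_orbit z_hom.
have gN := split_kernel_generated z_orbit : forall y : N, _.
have fN : finitely_generated N by exact: (generated_underlying gN).
exists (@FgGradedModule _ _ N fN); split.
  by move=> l Nl; exact: (circ_top_le (M := @FgGradedModule _ _ N fN) iotaK gr_pos gr_0 gN Nl).
pose P := gpow (regular_module (tw_grading gr_act)) (fun u : 'I_r => - dz (inl (u, 1%g))).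
have fP : finitely_generated P.
  exact: ffun_finitely_generated (regular_finitely_generated S).
have sumP : @is_sum (theta_circ (tw_grading gr_act)) (FgGradedModule fM)
    (@FgGradedModule _ _ P fP) (@FgGradedModule _ _ N fN).
  exact: split_graded_iso.
apply: theta_trans (theta_sum c sumP) _; apply: (theta_eq_catr [:: _]
  (a := [:: _]) (a' := [:: _])).
exact: theta_circ_power.
Qed.

Hypothesis eps_act : forall g b, eps (a g b) = eps b.
Hypothesis eps_unit : forall b, eps b != 0 -> exists c, c * b = 1.

Lemma theta_wedge_split (M : lmodType S) r (I : finType) (x : 'I_r -> M)
    (z : ('I_r * G) + I -> M) co (fM : finitely_generated M) (c : K) :
  free_basis (z : _ -> underlying M) co ->
  (forall u g, z (inl (u, g)) = gact g (x u)) ->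
  exists N : tobj (theta_wedge S),
    (forall l, top_length N l -> (l <= #|I|)%N) /\
    theta_eq (D := theta_wedge S) [:: (c, FgModule fM)]
      [:: (c * r%:R, regular_wedge S); (c, N)].
Proof.
move=> zb z_orbit; pose N : lmodType S := submod (split_kernel_submodule zb).
have gN := split_kernel_generated z_orbit : forall y : N, _.
have fN : finitely_generated N by exact: (generated_underlying gN).
exists (@FgModule _ N fN); split.
  by move=> l Nl; exact: (wedge_top_le (M := @FgModule _ N fN) iotaK eps_act eps_unit gN Nl).
have fP : finitely_generated ({ffun 'I_r -> S^o} : lmodType S).
  exact: ffun_finitely_generated (regular_finitely_generated S).
have sumP : @is_sum (theta_wedge S) (FgModule fM)
    (@FgModule S {ffun 'I_r -> S^o} fP) (@FgModule _ N fN).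
  by exists (split_lmap zb z_orbit); exact: split_map_bij.
apply: theta_trans (theta_sum c sumP) _; apply: (theta_eq_catr [:: _]
  (a := [:: _]) (a' := [:: _])).
exact: theta_wedge_power.
Qed.

End Splitting.

(** * The two limits *)

Section Main.
Variables (R : realType) (k : fieldType) (p : nat) (chk : p \in [pchar k]).
Variables (q : nat) (kdeg : pth_power_degree k p q) (n : nat) (w : 'I_n -> nat).
Hypothesis w_gt0 : forall i, (0 < w i)%N.
Variables (G : finGroupType) (a : graded_action k w G).
Hypothesis a_faithful : forall g : G, (forall b : {mpoly k[n]}, a g b = b) -> g = 1%g.
Variables (f : nat) (F : graded_module (tw_wgrading a)).
Hypothesis F_free : free_of_rank (underlying F) f.
Local Notation B := {mpoly k[n]}.
Local Notation S := (twisted a).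
Local Notation chB := (mpoly_pchar n chk).
Local Notation P := (p ^ n * q)%N.

Let p_gt1 : (1 < p)%N := prime_gt1 (pcharf_prime chk).

Let q_gt0 : (0 < q)%N.
Proof.
case: (posnP q) => // q0; have := kdeg; rewrite q0 => -[b /(_ 1) [c [[_ /eqP]]]].
by rewrite big_ord0 oner_eq0.
Qed.

Let P_gt0 : (0 < P)%N.
Proof. by rewrite muln_gt0 expn_gt0 (ltnW p_gt1) q_gt0. Qed.

Let cardP e (J : finType) : #|J| = (q ^ e)%N -> (#|J| * (p ^ e) ^ n = P ^ e)%N.
Proof. by move=> ->; rewrite expnMn -expnM -expnM mulnC [(e * n)%N]mulnC. Qed.

Let translates : exists m : 'I_#|G| -> 'X_{1..n},
  \det (\matrix_(i, j) a (enum_val i : G) 'X_[m j] : 'M[B]_#|G|) != 0.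
Proof. exact: (det_monomials a_faithful (@enum_val_inj _ _)). Qed.

(** The module that is split consists of #|G| copies of the direct image, so its class carries the
    weight p^(-delta e) divided by #|G|. *)
Let frob_coef e : R := (P ^ e)%:R^-1 / #|G|%:R.

Let frob_coefE e : powR p%:R (- (frob_delta R n p q * e%:R)) = frob_coef e * #|G|%:R.
Proof.
rewrite frob_deltaE // /frob_coef divfK // pnatr_eq0 -lt0n.
by apply/card_gt0P; exists 1%g.
Qed.

Lemma graded_limit : is_graded_FL chB (frob_delta R n p q) F
  [:: (f%:R / #|G|%:R, regular_circ (tw_wgrading a))].
Proof.
have [I [v [dv [co [cardI vb v_hom]]]]] := exists_homogeneous_basis w_gt0 F_free.
have [m detA] := translates.
have fgM e : finitely_generated (graded_frob_image chB e F).
  have [J [beta [Dk [_ bb]]]] := field_power_basis chk kdeg e.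
  have yb := frob_basis chB vb (mpoly_power_basis chk n bb).
  exact: (basis_finitely_generated (M := frob_image chB e F) yb).
exists fgM; pose eps : {rmorphism B -> k} := mcoeff 0%MM.
pose iota : {rmorphism k -> B} := @mpolyC n k.
have iotaK : cancel iota eps by exact: mpolyCK.
have gr_pos d b : (0 < d)%N -> wgrading k w d b -> eps b = 0 by exact: wgrading_pos.
have gr_0 b : wgrading k w 0 b -> b = iota (eps b) by exact: wgrading_0.
apply: (@theta_limit_split R _ (circ_top_exists iotaK gr_pos gr_0) (@circ_top_sum _ _ _ _ _)
  (circ_top_gt0 iotaK gr_pos gr_0) (@circ_zero_sum _ _) _ _ p P
  (#|G| * #|G| * #|I| * mdeg (mlead (\det (\matrix_(i, j) a (enum_val i : G) 'X_[m j] : 'M[B]_#|G|))))) => //.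
- by apply/card_gt0P; exists 1%g.
move=> e; have [J [beta [Dk [cardJ bb]]]] := field_power_basis chk kdeg e.
have [r [x [K' [z [coz [dz [zb z_orbit z_hom cardE boundE]]]]]]] :=
  orbit_basis chk w_gt0 vb v_hom detA bb.
rewrite (cardP cardJ) in cardE boundE; rewrite cardI in cardE.
have fN : finitely_generated (frob_power chk F m e).
  exact: ffun_finitely_generated (fgM e).
have [N [topN eqN]] := theta_circ_split iotaK gr_pos gr_0 fN (frob_coef e)
  zb z_orbit z_hom.
exists r, #|K'|, N; split=> //.
apply: theta_trans eqN; rewrite frob_coefE; apply: theta_sym.
exact: theta_circ_power.
Qed.

(** The orbits are chosen in the graded module, where homogeneity makes them part of a basis. The
    standard basis of the powers of ^eF maps to a standard basis after completion, by base change of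
    v and by the digits of the completed ring; [basis_transport] then carries the orbit basis along
    with the same counts. *)
Lemma completed_limit (Fh : lmodType (twisted (hat_action a))) (j : F -> Fh) :
  is_completed_module j ->
  is_FL (completion_pchar (irrelevant k w) chB) (frob_delta R n p q) Fh
    [:: (f%:R / #|G|%:R, regular_wedge (twisted (hat_action a)))].
Proof.
move=> [bc j_act]; have [jl _] := bc.
set theta := to_completion (irrelevant k w) in bc jl.
set chBh := completion_pchar _ _.
have [I [v [dv [co [cardI vb v_hom]]]]] := exists_homogeneous_basis w_gt0 F_free.
have [coh vhb] : exists coh, free_basis (j \o v : I -> underlying Fh) coh.
  exact: (base_change_basis (theta := theta) bc vb).
have [m detA] := translates.
have fgM e : finitely_generated (frob_image chBh e Fh).
  have [J [beta [Dk [_ bb]]]] := field_power_basis chk kdeg e.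
  have yb := frob_basis chBh vhb (hat_power_basis w_gt0 chk bb).
  exact: (basis_finitely_generated (M := frob_image chBh e Fh) yb).
exists fgM.
have eps_act := hat_eps_act w_gt0 a.
have eps_unit := hat_eps_unit w_gt0.
have iotaK := hat_iotaK w_gt0.
apply: (@theta_limit_split R _ (wedge_top_exists (iotaK k) eps_act (eps_unit k))
  (@wedge_top_sum _ _ _) (wedge_top_gt0 (iotaK k) eps_act (eps_unit k))
  (@wedge_zero_sum _) _ _ p P
  (#|G| * #|G| * #|I| * mdeg (mlead (\det (\matrix_(i, j) a (enum_val i : G) 'X_[m j] : 'M[B]_#|G|))))) => //.
- by apply/card_gt0P; exists 1%g.
move=> e; have [J [beta [Dk [cardJ bb]]]] := field_power_basis chk kdeg e.
have [r [x [K' [z [coz [dz [zb z_orbit z_hom cardE boundE]]]]]]] :=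
  orbit_basis chk w_gt0 vb v_hom detA bb.
rewrite (cardP cardJ) in cardE boundE; rewrite cardI in cardE.
pose Nh : lmodType (twisted (hat_action a)) := {ffun 'I_#|G| -> frob_image chBh e Fh}.
pose N : lmodType S := {ffun 'I_#|G| -> frob_image chB e F}.
pose jp : N -> Nh := @frob_map G _ _ a (hat_action a) F Fh j p chB chBh e 'I_#|G|.
have jpl := frob_map_semilinear (a := a) (a' := hat_action a) (theta := theta)
  jl chB chBh e 'I_#|G|.
have stdb := std_basisP chk bb vb #|G|.
pose std := @std_basis k p chk e n w G a J beta F I v #|G|.
have [cos stdhb] : exists cos, free_basis (jp \o std : _ -> underlying Nh) cos.
  have yb := ffun_basis 'I_#|G| (frob_basis chBh vhb (hat_power_basis w_gt0 chk bb)).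
  move: yb; set zh := (X in free_basis X _); set coz' := (X in free_basis _ X) => yb.
  exists coz'; suff -> : jp \o std = zh by exact: yb.
  apply/funext => l; exact: (frob_map_single jl).
have [coh' zhb] : exists co', free_basis (jp \o z : _ -> underlying Nh) co'.
  apply: (basis_transport jpl _ stdb zb stdhb).
  rewrite card_sum !card_prod !card_ord cardE card_ffun !card_ord (cardP cardJ).
  by rewrite cardI mulnCA mulnA.
have zh_orbit u h : (jp \o z) (inl (u, h)) = gact h (jp (x u)).
  by rewrite /= z_orbit; exact: (frob_map_gact chBh (x u) (j_act h)).
have fN : finitely_generated Nh by exact: ffun_finitely_generated (fgM e).
have split := theta_wedge_split (iotaK k) eps_act (eps_unit k) fN (frob_coef e)
  zhb zh_orbit.
have [Ne [topN eqN]] := split w_gt0.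
exists r, #|K'|, Ne; split=> //.
apply: theta_trans eqN; rewrite frob_coefE; apply: theta_sym.
exact: theta_wedge_power.
Qed.

End Main.

Theorem theorem4p13 (R : realType) (k : fieldType) (p : nat)
    (chk : p \in [pchar k]) (q : nat) (kdeg : pth_power_degree k p q)
    (n : nat) (w : 'I_n -> nat) (w_gt0 : forall i, (0 < w i)%N)
    (G : finGroupType) (a : graded_action k w G)
    (a_faithful : forall g : G, (forall b : {mpoly k[n]}, a g b = b) -> g = 1%g)
    (f : nat) (F : graded_module (tw_wgrading a))
    (F_free : free_of_rank (underlying F) f) :
  is_graded_FL (mpoly_pchar n chk) (frob_delta R n p q) F
    [:: (f%:R / #|G|%:R, regular_circ (tw_wgrading a))]
  /\
  forall (Fh : lmodType (twisted (hat_action a))) (j : F -> Fh),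
    is_completed_module j ->
    is_FL (completion_pchar (irrelevant k w) (mpoly_pchar n chk))
      (frob_delta R n p q) Fh
      [:: (f%:R / #|G|%:R, regular_wedge (twisted (hat_action a)))].
Proof.
split; first exact: (graded_limit R chk kdeg w_gt0 a_faithful F_free).
by move=> Fh j; exact: (completed_limit R chk kdeg w_gt0 a_faithful F_free).
Qed.
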